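(* Let $m\in\mathbb Z_{>0}$ and $\nu,\nu'\in H_m\cup L_m$. (i) If $C_m^{\nu'}\subseteq C_m^\nu$ then $\nu\le_p\nu'$. (ii) If moreover $\nu,\nu'\in H_m\cup L_m^{=}$, then $C_m^{\nu'}\subseteq C_m^\nu$ if and only if $\nu\le_p\nu'$.
   Context: **Setting.** Let $f\in\mathbb C\{x_1,x_2\}[z]$ be an irreducible quasi-ordinary Weierstrass polynomial of degree $n$ in $z$ (its $z$-discriminant is $x_1^{\delta_1}x_2^{\delta_2}$ times a unit), defining the germ $(X,0)\subset(\mathbb C^3,0)$. A root $\zeta=\sum\beta_\lambda x^\lambda\in\mathbb C\{x_1^{1/n},x_2^{1/n}\}$ of $f$ has characteristic exponents $0\neq\lambda_1\le\dots\le\lambda_g$ in $\mathbb Q^2_{\ge0}$ ($g\ge1$, $\le$ coordinatewise): with $M_0=\mathbb Z^2$, $M_j=M_{j-1}+\mathbb Z\lambda_j$, $\lambda_0=0$, $\lambda_{g+1}=\infty$, one has $\beta_{\lambda_i}\ne0$; $\beta_\lambda\neq0$ implies $\lambda\in M_j$ for the unique $j$ with $\lambda_j\le\lambda$, $\lambda_{j+1}\not\le\lambda$; and $\lambda_j\notin M_{j-1}$. Put $n_j=[M_j:M_{j-1}]>1$ and $e_j=n_{j+1}\cdots n_g$ ($e_0=n$, $e_g=1$). Standing assumptions: $(\lambda_1^{(1)},\dots,\lambda_g^{(1)})\ge_{lex}(\lambda_1^{(2)},\dots,\lambda_g^{(2)})$; $\zeta$ is normalized, i.e. $\lambda_1$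 is not of the form $(a,0)$ with $a<1$; coordinates are such that $\zeta$ has no terms $\beta_\lambda x^\lambda$ with $\lambda\not\ge\lambda_1$. Put $\gamma_0=0$, $\gamma_1=\lambda_1$, $\gamma_{j+1}=n_j\gamma_j+\lambda_{j+1}-\lambda_j$. Let $N_0=\mathbb Z^2$, $N_j=\{\nu\in\mathbb Z^2:\langle\nu,\lambda\rangle\in\mathbb Z\ \forall\lambda\in M_j\}$, $\sigma=\mathbb R^2_{\ge0}$, $\rho_1=\mathbb R_{\ge0}(1,0)$, $\rho_2=\mathbb R_{\ge0}(0,1)$. **Singular locus.** Let $Z_i=X\cap\{x_i=0\}$, $Z_{12}=X\cap\{x_1=x_2=0\}$. The singular locus $X_{Sing}$ is one of $Z_{12}$, $Z_1$, $Z_1\cup Z_2$, and correspondingly $\sigma_{Sing}=\sigma\setminus(\rho_1\cup\rho_2)$, $\sigma\setminus\rho_2$, $\sigma\setminus\{(0,0)\}$. **Jets.** $X_m$ is the scheme of $m$-jets of $X$. $X$ is a germ: only jets with center in a sufficiently small neighbourhood of $0$ are considered. For $\nu\in\sigma_{Sing}\cap N_0$ with $\nu_i\le m$, $C_m^\nu$ is the Zariski closure of $D_m^\nu=\{\gamma\in X_m: \mathrm{ord}_t(x_i\circ\gamma)=\nu_i,\ i=1,2\}$ (reduced structure). **Index sets.** $l_i(\nu)=n_ie_i\langle\nu,\gamma_i\rangle$ ($1\le i\le g$), $l_{g+1}(\nu)=\infty$; $i(\nu)=g+1$ if $\nu\in N_g$ and otherwise $i(\nu)=\min\{i\in\{1,\dots,g\}:\nu\notin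 N_i\}$; $m(\nu)=\min\{1\le i\le g: n_i\langle\nu,\gamma_i\rangle<\langle\nu,\gamma_{i+1}\rangle\}$ (with $\langle\nu,\gamma_{g+1}\rangle=\infty$). Put $H_m=\{\nu\in[0,m]^2\cap\sigma_{Sing}\cap N_0: l_{m(\nu)}(\nu)\ge m+1\}$, $L_m=\{\nu\in[0,m]^2\cap\sigma_{Sing}\cap N_1: l_{m(\nu)}(\nu)\le m<l_{i(\nu)}(\nu)\}$, $L_m^{=}=\{\nu\in L_m: m<\min\{l_{m(\nu)}(\nu)+e_{m(\nu)},l_{i(\nu)}(\nu)\}\}$. The order $\nu\le_p\nu'$ means $\nu_i\le\nu'_i$ for $i=1,2$. *)

(* Defs.v *)
From HB Require Import structures.
From mathcomp Require Import all_boot all_order all_algebra.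
From mathcomp Require Import finmap all_classical reals constructive_ereal topology.
From mathcomp Require Import normedtype sequences.
From mathcomp Require Export complex.
Import numFieldNormedType.Exports.
Import Order.TTheory GRing.Theory Num.Theory.

Set Implicit Arguments.
Unset Strict Implicit.
Unset Printing Implicit Defensive.

Local Open Scope classical_set_scope.
Local Open Scope ring_scope.

(* [a] is the coefficient family of a power series in two variables whose     *)
(* domain of convergence contains the polydisc of polyradius (1/K, 1/K).      *)
Definition geom_bounded (C : numClosedFieldType) (a : nat -> nat -> C) :=
  exists M K : C, [/\ 0 <= M, 0 <= K &
    forall i j, `|a i j| <= M * K ^+ (i + j)].

(* The ring C{x_1, x_2}; [coefs a i j] is the coefficient of x_1^i x_2^j.     *)
Record cps (C : numClosedFieldType) := CPS {
  coefs :> nat -> nat -> C;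
  coefs_bounded : geom_bounded coefs }.

HB.instance Definition _ (C : numClosedFieldType) := gen_eqMixin (cps C).
HB.instance Definition _ (C : numClosedFieldType) := gen_choiceMixin (cps C).

Lemma leq_mul2_exp (i j : nat) : (i.+1 * j.+1 <= 2 ^ (i + j))%N.
Proof. by rewrite expnD; apply: leq_mul; exact: ltn_expl. Qed.

Section ConvergentPowerSeries.
Variable C : numClosedFieldType.
Implicit Types a b c : cps C.

Lemma cpsP a b : (forall i j, a i j = b i j) -> a = b.
Proof.
case: a b => [a pa] [b pb] /= ab.
have {}ab : a = b by apply: funext => i; apply: funext => j; exact: ab.
by case: _ / ab pb => pb; congr CPS; exact: Prop_irrelevance.
Qed.

Lemma cps0_bounded : geom_bounded (fun _ _ => 0 : C).
Proof. by exists 0, 0; split => // i j; rewrite normr0 mul0r. Qed.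
Definition cps0 := CPS cps0_bounded.

Lemma monom_bounded p q :
  geom_bounded (fun i j => ((i == p) && (j == q))%:R : C).
Proof.
exists 1, 1; split => // i j; rewrite expr1n mulr1.
by case: andP => _; rewrite ?normr1 ?normr0.
Qed.
Definition monom p q := CPS (monom_bounded p q).

Lemma cps_opp_bounded a : geom_bounded (fun i j => - a i j).
Proof.
have [M [K [M0 K0 aMK]]] := coefs_bounded a.
by exists M, K; split => // i j; rewrite normrN.
Qed.
Definition cps_opp a := CPS (cps_opp_bounded a).

Lemma cps_add_bounded a b : geom_bounded (fun i j => a i j + b i j).
Proof.
have [M [K [M0 K0 aMK]]] := coefs_bounded a.
have [N [L [N0 L0 bNL]]] := coefs_bounded b.
exists (M + N), (K + L); split; rewrite ?addr_ge0 // => i j.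
rewrite (le_trans (ler_normD _ _)) // mulrDl lerD //.
  by rewrite (le_trans (aMK i j)) // ler_wpM2l // lerXn2r ?nnegrE ?addr_ge0 // lerDl.
by rewrite (le_trans (bNL i j)) // ler_wpM2l // lerXn2r ?nnegrE ?addr_ge0 // lerDr.
Qed.
Definition cps_add a b := CPS (cps_add_bounded a b).

Definition conv_coef a b i j : C :=
  \sum_(k < i.+1) \sum_(l < j.+1) a k l * b (i - k)%N (j - l)%N.

Lemma cps_mul_bounded a b : geom_bounded (conv_coef a b).
Proof.
have [M [K [M0 K0 aMK]]] := coefs_bounded a.
have [N [L [N0 L0 bNL]]] := coefs_bounded b.
have KL0 : 0 <= K + L by rewrite addr_ge0.
exists (M * N), (2 * (K + L)); split; rewrite ?mulr_ge0 // => i j.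
apply: (@le_trans _ _
  (\sum_(k < i.+1) \sum_(l < j.+1) M * N * (K + L) ^+ (i + j))); last first.
  rewrite !sumr_const !card_ord -mulrnA -[X in X <= _]mulr_natr.
  rewrite -mulrA ler_wpM2l ?mulr_ge0 // exprMn mulrC.
  rewrite ler_wpM2r ?exprn_ge0 // -natrX ler_nat.
  by rewrite addnC; exact: leq_mul2_exp.
rewrite (le_trans (ler_norm_sum _ _ _)) // ler_sum // => k _.
rewrite (le_trans (ler_norm_sum _ _ _)) // ler_sum // => l _.
rewrite normrM.
have ki : (k <= i)%N by rewrite -ltnS.
have lj : (l <= j)%N by rewrite -ltnS.
have -> : (i + j = (k + l) + ((i - k) + (j - l)))%N.
  by rewrite addnACA !subnKC.
rewrite exprD mulrACA ler_pM //.
  by rewrite (le_trans (aMK _ _)) // ler_wpM2l // lerXn2r ?nnegrE // lerDl.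
by rewrite (le_trans (bNL _ _)) // ler_wpM2l // lerXn2r ?nnegrE // lerDr.
Qed.
Definition cps_mul a b := CPS (cps_mul_bounded a b).

Let trunc n (a : nat -> nat -> C) : {poly {poly C}} :=
  \poly_(i < n) \poly_(j < n) a i j.

Let agree n (P : {poly {poly C}}) (a : nat -> nat -> C) :=
  forall i j, (i < n)%N -> (j < n)%N -> P`_i`_j = a i j.

Let agree_trunc n a : agree n (trunc n a) a.
Proof. by move=> i j i_n j_n; rewrite coef_poly i_n coef_poly j_n. Qed.

Let agree_mul n P Q a b :
  agree n P a -> agree n Q b -> agree n (P * Q) (cps_mul a b).
Proof.
move=> Pa Qb i j i_n j_n; rewrite coefM coef_sum; apply: eq_bigr => k _.
rewrite coefM; apply: eq_bigr => l _.
rewrite Pa ?Qb ?(leq_ltn_trans (leq_subr _ _)) //.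
  by rewrite (leq_ltn_trans _ i_n) // -ltnS.
by rewrite (leq_ltn_trans _ j_n) // -ltnS.
Qed.

Let agree_eq P a b : (forall n, agree n (P n) a) -> (forall n, agree n (P n) b) ->
  a = b.
Proof.
move=> Pa Pb; apply: cpsP => i j; rewrite -(Pa (maxn i j).+1).
- by rewrite (Pb (maxn i j).+1) // ltnS ?leq_maxl ?leq_maxr.
- by rewrite ltnS leq_maxl.
- by rewrite ltnS leq_maxr.
Qed.

Let cps_mulA : associative cps_mul.
Proof.
move=> a b c; apply: (@agree_eq (fun n => trunc n a * (trunc n b * trunc n c))) => n.
  apply: agree_mul; first exact: agree_trunc.
  by apply: agree_mul; exact: agree_trunc.
rewrite mulrA; apply: agree_mul; last exact: agree_trunc.
by apply: agree_mul; exact: agree_trunc.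
Qed.

Let cps_mulC : commutative cps_mul.
Proof.
move=> a b; apply: (@agree_eq (fun n => trunc n a * trunc n b)) => n.
  by apply: agree_mul; exact: agree_trunc.
by rewrite mulrC; apply: agree_mul; exact: agree_trunc.
Qed.

Let agree1 n : agree n 1 (monom 0 0).
Proof. by move=> i j _ _; rewrite coef1 /=; case: i => [|i]; rewrite /= ?coef1 ?coef0. Qed.

Let cps_mul1 : left_id (monom 0 0) cps_mul.
Proof.
move=> a; apply: (@agree_eq (fun n => 1 * trunc n a)) => n.
  by apply: agree_mul; [exact: agree1 | exact: agree_trunc].
by rewrite mul1r; exact: agree_trunc.
Qed.

Let cps_mulDl : left_distributive cps_mul cps_add.
Proof.
move=> a b c; apply: cpsP => i j /=; rewrite /conv_coef -big_split /=.
apply: eq_bigr => k _; rewrite -big_split /=.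
by apply: eq_bigr => l _; rewrite mulrDl.
Qed.

Let cps_addA : associative cps_add.
Proof. by move=> a b c; apply: cpsP => i j /=; rewrite addrA. Qed.
Let cps_addC : commutative cps_add.
Proof. by move=> a b; apply: cpsP => i j /=; rewrite addrC. Qed.
Let cps_add0 : left_id cps0 cps_add.
Proof. by move=> a; apply: cpsP => i j /=; rewrite add0r. Qed.
Let cps_addN : left_inverse cps0 cps_opp cps_add.
Proof. by move=> a; apply: cpsP => i j /=; rewrite addNr. Qed.

HB.instance Definition _ := GRing.isZmodule.Build (cps C)
  cps_addA cps_addC cps_add0 cps_addN.

Let cps_1neq0 : monom 0 0 != 0 :> cps C.
Proof.
apply/eqP => /(congr1 (fun a : cps C => a 0%N 0%N))/eqP /=.
by rewrite oner_eq0.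
Qed.

HB.instance Definition _ := GRing.Zmodule_isComNzRing.Build (cps C)
  cps_mulA cps_mulC cps_mul1 cps_mulDl cps_1neq0.

(* a(x_1, x_2) |-> a(u_1^n, u_2^n): C{x_1^{1/n}, x_2^{1/n}} is C{u_1, u_2}    *)
(* seen as an algebra over C{x_1, x_2} through x_i = u_i^n.                   *)
Definition ramify_coef n a i j : C :=
  if ((n %| i) && (n %| j))%N then a (i %/ n)%N (j %/ n)%N else 0.

Lemma ramify_bounded n a : geom_bounded (ramify_coef n a).
Proof.
have [M [K [M0 K0 aMK]]] := coefs_bounded a.
exists M, (K + 1); split; rewrite ?addr_ge0 // => i j; rewrite /ramify_coef.
case: ifP => _; last by rewrite normr0 mulr_ge0 // exprn_ge0 // addr_ge0.
rewrite (le_trans (aMK _ _)) // ler_wpM2l //.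
rewrite (@le_trans _ _ ((K + 1) ^+ (i %/ n + j %/ n))) //.
  by rewrite lerXn2r ?nnegrE ?addr_ge0 // lerDl.
by rewrite ler_weXn2l ?lerDr // leq_add // leq_div.
Qed.
Definition ramify n a := CPS (ramify_bounded n a).

Lemma deriv1_bounded a : geom_bounded (fun i j => a i.+1 j *+ i.+1).
Proof.
have [M [K [M0 K0 aMK]]] := coefs_bounded a.
exists (M * K), (2 * K); split; rewrite ?mulr_ge0 // => i j.
rewrite normrMn -[leLHS]mulr_natr exprMn mulrCA mulrC ler_pM //.
  by rewrite -natrX ler_nat (leq_trans (ltn_expl i (ltnSn 1))) // leq_exp2l ?leq_addr.
by rewrite (le_trans (aMK _ _)) // addSn exprS mulrA.
Qed.
Definition deriv1 a := CPS (deriv1_bounded a).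

Lemma deriv2_bounded a : geom_bounded (fun i j => a i j.+1 *+ j.+1).
Proof.
have [M [K [M0 K0 aMK]]] := coefs_bounded a.
exists (M * K), (2 * K); split; rewrite ?mulr_ge0 // => i j.
rewrite normrMn -[leLHS]mulr_natr exprMn mulrCA mulrC ler_pM //.
  by rewrite -natrX ler_nat (leq_trans (ltn_expl j (ltnSn 1))) // leq_exp2l ?leq_addl.
by rewrite (le_trans (aMK _ _)) // addnS exprS mulrA.
Qed.
Definition deriv2 a := CPS (deriv2_bounded a).

End ConvergentPowerSeries.

Definition is_unit (A : comNzRingType) (a : A) := exists b, a * b = 1.

Definition irreducible_elt (A : comNzRingType) (a : A) :=
  [/\ a <> 0, ~ is_unit a & forall b c, a = b * c -> is_unit b \/ is_unit c].

Definition discriminant (A : comNzRingType) (p : {poly A}) : A :=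
  (-1) ^+ 'C((size p).-1, 2) * resultant p p^`().

Section QuasiOrdinary.
Variable C : numClosedFieldType.

Definition weierstrass (n : nat) (f : {poly cps C}) :=
  [/\ f \is monic, size f = n.+1 &
      forall k, (k < n)%N -> f`_k 0%N 0%N = 0].

Definition quasi_ordinary (f : {poly cps C}) :=
  exists d1 d2 (u : cps C), is_unit u /\ discriminant f = monom C d1 d2 * u.

Definition is_branch (n : nat) (f : {poly cps C}) (zeta : cps C) :=
  root (map_poly (@ramify C n) f) zeta.

(* beta_lambda, for zeta = \sum beta_lambda x^lambda in C{x_1^{1/n}, x_2^{1/n}} *)
Definition beta (n : nat) (zeta : cps C) (l : rat * rat) : C :=
  if (n%:R * l.1 \is a Num.nat) && (n%:R * l.2 \is a Num.nat)
  then zeta (Num.truncn (n%:R * l.1)) (Num.truncn (n%:R * l.2)) else 0.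

End QuasiOrdinary.

Definition le_p (d : Order.disp_t) (T : porderType d) (a b : T * T) : bool :=
  ((a.1 <= b.1) && (a.2 <= b.2))%O.

(* The index as the number of cosets (0 if it is infinite).                   *)
Definition subgroup_index (V : zmodType) (G H : set V) : nat :=
  #|` fset_set [set [set v | H (v - w)] | w in G]|%fset.

Section Lattices.
(* [lam 1, ..., lam g] are the characteristic exponents; the other values of  *)
(* [lam] are never used.                                                      *)
Variables (g : nat) (lam : nat -> rat * rat).

Fixpoint latM (j : nat) : set (rat * rat) :=
  if j is k.+1 then [set v | exists2 w, latM k w & exists c : int, v = w + lam j *~ c]
  else [set v | (v.1 \is a Num.int) && (v.2 \is a Num.int)].

Definition ind_n (j : nat) : nat := subgroup_index (latM j) (latM j.-1).

Definition ind_e (j : nat) : nat := \prod_(j.+1 <= k < g.+1) ind_n k.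

Fixpoint gam (j : nat) : rat * rat :=
  match j with
  | 0 => 0
  | 1 => lam 1
  | (k.+1 as j').+1 => gam j' *+ ind_n j' + lam j'.+1 - lam j'
  end.

(* Elements of \sigma \cap N_0 are encoded as pairs of natural numbers.       *)
Definition pairing (nu : nat * nat) (l : rat * rat) : rat :=
  nu.1%:R * l.1 + nu.2%:R * l.2.

Definition latN (j : nat) : set (nat * nat) :=
  [set nu | forall l, latM j l -> pairing nu l \is a Num.int].

(* <nu, gamma_i>, with value +oo for i = g + 1 *)
Definition pair_gam (nu : nat * nat) (i : nat) : \bar rat :=
  if (i <= g)%N then (pairing nu (gam i))%:E else +oo%E.

Definition ell (nu : nat * nat) (i : nat) : \bar rat :=
  if (i <= g)%N then ((ind_n i * ind_e i)%:R * pairing nu (gam i))%:E else +oo%E.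

Definition idx_i (nu : nat * nat) : nat :=
  if nu \in latN g then g.+1
  else head g.+1 [seq i <- iota 1 g | nu \notin latN i].

Definition idx_m (nu : nat * nat) : nat :=
  head g [seq i <- iota 1 g |
    (((ind_n i)%:R * pairing nu (gam i))%:E < pair_gam nu i.+1)%E].

End Lattices.

Definition char_exponents (C : numClosedFieldType) (n : nat) (zeta : cps C)
    (g : nat) (lam : nat -> rat * rat) :=
  [/\ (1 <= g)%N /\ lam 1 <> 0,
      forall i, (1 <= i < g)%N -> le_p (lam i) (lam i.+1),
      forall i, (1 <= i <= g)%N -> beta n zeta (lam i) <> 0,
      forall l j, (j <= g)%N -> beta n zeta l <> 0 ->
        ((0 < j)%N -> le_p (lam j) l) -> ((j < g)%N -> ~~ le_p (lam j.+1) l) ->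
        latM lam j l
    & forall j, (1 <= j <= g)%N -> ~ latM lam j.-1 (lam j)].

Definition lex_ordered (g : nat) (lam : nat -> rat * rat) : bool :=
  (([seq (lam k).2 | k <- iota 1 g] : seqlexi rat) <=
   ([seq (lam k).1 | k <- iota 1 g] : seqlexi rat))%O.

Definition normalized (lam : nat -> rat * rat) :=
  ~ exists2 a : rat, a < 1 & lam 1 = (a, 0).

Definition good_coordinates (C : numClosedFieldType) (n : nat) (zeta : cps C)
    (lam : nat -> rat * rat) :=
  forall l, beta n zeta l <> 0 -> le_p (lam 1) l.

Section Analytic.
Variable C : numClosedFieldType.
Implicit Types (f : {poly cps C}) (r : C).

Definition cps_eval (a : cps C) (c1 c2 : C) : C :=
  limn (fun N => \sum_(p < N) \sum_(q < N) a p q * c1 ^+ p * c2 ^+ q).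

Definition eval3 f (c1 c2 d : C) : C :=
  \sum_(k < size f) cps_eval f`_k c1 c2 * d ^+ k.

Definition in_polydisc r (c1 c2 : C) : bool := (`|c1| < r) && (`|c2| < r).

Definition singular_point f (c1 c2 d : C) :=
  [/\ eval3 f c1 c2 d = 0,
      eval3 (map_poly (@deriv1 C) f) c1 c2 d = 0,
      eval3 (map_poly (@deriv2 C) f) c1 c2 d = 0 &
      eval3 f^`() c1 c2 d = 0].

End Analytic.

Inductive sing_type := SingZ12 | SingZ1 | SingZ1Z2.

Definition in_sing_type (C : numClosedFieldType) (S : sing_type) (c1 c2 : C) :=
  match S with
  | SingZ12 => c1 = 0 /\ c2 = 0
  | SingZ1 => c1 = 0
  | SingZ1Z2 => c1 = 0 \/ c2 = 0
  end.

(* Equality of the germs at 0 of X_Sing and of Z_12, Z_1 or Z_1 \cup Z_2.     *)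
(* As f is a Weierstrass polynomial, the sets X \cap {|x_1|, |x_2| < r} form  *)
(* a basis of neighbourhoods of 0 in X; z needs no bound.                     *)
Definition has_sing_type (C : numClosedFieldType) (f : {poly cps C})
    (S : sing_type) :=
  exists2 r : C, 0 < r & forall c1 c2 d, in_polydisc r c1 c2 ->
    eval3 f c1 c2 d = 0 -> (singular_point f c1 c2 d <-> in_sing_type S c1 c2).

Definition sigma_Sing (S : sing_type) (nu : nat * nat) : bool :=
  match S with
  | SingZ12 => (nu.1 != 0) && (nu.2 != 0)
  | SingZ1 => nu.1 != 0
  | SingZ1Z2 => nu != (0, 0)
  end%N.

Section Jets.
Variables (C : numClosedFieldType) (f : {poly cps C}).
(* Only jets centered over the polydisc |x_1|, |x_2| < r are considered.      *)
Variables (r : C) (m : nat).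

(* An m-jet of C^3: row 0, 1, 2 lists the coefficients of 1, t, ..., t^m in   *)
(* x_1, x_2, z respectively.                                                  *)
Definition jet := 'M[C]_(3, m.+1).

Definition jet_poly (i : 'I_3) (gm : jet) : {poly C} := rVpoly (row i gm).

Definition ix1 : 'I_3 := inord 0.
Definition ix2 : 'I_3 := inord 1.
Definition iz : 'I_3 := inord 2.

(* a(x_1(t), x_2(t)) modulo t^{m+1}, coefficient by coefficient *)
Definition cps_comp (a : cps C) (gm : jet) : {poly C} :=
  \poly_(j < m.+1) limn (fun N => \sum_(p < N) \sum_(q < N)
    a p q * (jet_poly ix1 gm ^+ p * jet_poly ix2 gm ^+ q)`_j).

Definition f_comp (gm : jet) : {poly C} :=
  \sum_(k < size f) cps_comp f`_k gm * jet_poly iz gm ^+ k.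

Definition centered (gm : jet) : bool := in_polydisc r (gm ix1 ord0) (gm ix2 ord0).

Definition jets_X : set jet :=
  [set gm | centered gm /\ forall j, (j <= m)%N -> (f_comp gm)`_j = 0].

(* ord_t p(t) = k for p in C[t]/(t^{m+1}) and k <= m *)
Definition has_ord (p : {poly C}) (k : nat) :=
  (forall j, (j < k)%N -> p`_j = 0) /\ p`_k <> 0.

Definition jets_D (nu : nat * nat) : set jet :=
  [set gm | [/\ jets_X gm, has_ord (jet_poly ix1 gm) nu.1 &
                has_ord (jet_poly ix2 gm) nu.2]].

Definition converges_on (a : cps C) :=
  forall s : C, 0 < s < r -> exists M : C, forall i j, `|a i j| * s ^+ (i + j) <= M.

(* Regular functions on the m-jets of C^3 centered over the polydisc:         *)
(* polynomials in the jet coordinates whose coefficients are holomorphic in   *)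
(* (x_1, x_2) on the polydisc.                                                *)
Definition regular (F : jet -> C) :=
  exists s : seq (cps C * ('I_3 -> 'I_m.+1 -> nat)),
    (forall t, t \in s -> converges_on t.1) /\
    (forall gm, centered gm ->
      F gm = \sum_(t <- s) cps_eval t.1 (gm ix1 ord0) (gm ix2 ord0) *
                           \prod_i \prod_j gm i j ^+ t.2 i j).

Definition zariski_closure (A : set jet) : set jet :=
  [set gm | jets_X gm /\ forall F, regular F ->
              (forall y, A y -> F y = 0) -> F gm = 0].

Definition jets_C (nu : nat * nat) : set jet := zariski_closure (jets_D nu).

End Jets.

Arguments jets_X {C} f r m _.
Arguments jets_D {C} f r m nu _.
Arguments zariski_closure {C} f r m A _.
Arguments jets_C {C} f r m nu _.

Section IndexSets.
Variables (g : nat) (lam : nat -> rat * rat) (S : sing_type) (m : nat).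

Definition in_box (nu : nat * nat) : bool := (nu.1 <= m)%N && (nu.2 <= m)%N.

Definition setH : set (nat * nat) :=
  [set nu | [/\ in_box nu, sigma_Sing S nu &
    (m.+1%:R%:E <= ell g lam nu (idx_m g lam nu))%E]].

Definition setL : set (nat * nat) :=
  [set nu | [/\ in_box nu, sigma_Sing S nu, latN lam 1 nu &
    (ell g lam nu (idx_m g lam nu) <= m%:R%:E < ell g lam nu (idx_i g lam nu))%E]].

Definition setLeq : set (nat * nat) :=
  [set nu | setL nu /\
    (m%:R%:E < Order.min
      (ell g lam nu (idx_m g lam nu) + (ind_e g lam (idx_m g lam nu))%:R%:E)
      (ell g lam nu (idx_i g lam nu)))%E].

End IndexSets.

(* Main.v *)
(* Write x_i = u_i^n. As f is irreducible, it is the product of z - b over the *)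
(* n conjugates b of zeta under u_i |-> omega^{s_i} u_i, omega a primitive    *)
(* n-th root of unity. Along an m-jet with ord x_i = nu_i, the substitution   *)
(* t = s^n turns x_i into w_i^n and f into the product of the                 *)
(* z(s^n) - b(w_1, w_2), all modulo s^{n(m+1)}; on D_m^nu one of the factors  *)
(* vanishes modulo s^{m+1}, so z(s^n) = zeta(w_1, w_2) modulo s^{m+1} after   *)
(* changing the roots w_i.                                                    *)
(* Conversely, the conjugations fixing the monomials with exponents in M_j    *)
(* form the annihilator of M_j in (Z/n)^2, which has n e_j elements. Adding up *)
(* the orders of the factors, one finds that for nu in H_m or L_m^= the jet is *)
(* in X_m as soon as z(s^n) and zeta(w_1, w_2) agree up to order              *)
(* n <nu, lambda_1>. This condition survives a perturbation of a jet of       *)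
(* D_m^nu' into jets of D_m^nu when nu <= nu', which gives the inclusion of   *)
(* the closures. For nu in L_m the jet with monomial x_i and with z made of   *)
(* the powers of s^n in zeta(w_1, w_2) shows that D_m^nu is not empty, whence *)
(* (i), since ord x_i >= nu_i is a closed condition.                          *)

From HB Require Import structures.
Require Import Defs.
From mathcomp Require Import all_boot all_order all_algebra.
From mathcomp Require Import cyclic separable cyclotomic finmap.
From mathcomp Require Import all_classical reals constructive_ereal topology.
From mathcomp Require Import normedtype sequences.
From mathcomp Require Import zify ring.
Import numFieldNormedType.Exports.
Import Order.TTheory GRing.Theory Num.Theory.

Set Implicit Arguments.
Unset Strict Implicit.
Unset Printing Implicit Defensive.

Local Open Scope classical_set_scope.
Local Open Scope ring_scope.

(** The conditions that define the index sets are bounds on a sum of orders. By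
    [branch_factorization], f splits over C{u_1, u_2}, x_i = u_i^n, into linear factors, one for
    each of the n distinct conjugates of zeta. [f_comp_factor] carries this splitting to a jet after
    t = s^n. A jet is then on X as soon as the orders in s of the n factors add up to more than n m.
    Conversely, on a jet of X some factor vanishes modulo s^(m+1) ([f_comp_root]), and a change of
    the roots of the x_i makes it the factor of zeta itself ([jets_D_elim]).

    How close are the conjugates to zeta along a jet of order nu? A conjugation that annihilates M_j
    changes only monomials with exponent >= lambda_(j+1), that is, terms of order at least n <nu,
    lambda_(j+1)> ([ev_annA]). Duality in (Z/n)^2 and the orbit count give n e_j such conjugations
    ([card_annA_e]), so adding up the orders produces the weights e_j. The resulting weighted sum is
    n l_i(nu), because the recursion for the gamma_j telescopes in the same way ([ellE]).
    [f_comp_vanish] is the general criterion; [f_comp_setH], [f_comp_setLeq] and [f_comp_setL] apply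
    it to the three index sets.

    For (i), [jets_D_nonempty] gives a jet of order exactly nu' in each stratum, and the equations
    saying that x_i has no term below t^nu_i pass to the closure ([jets_C_sub_le]). For (ii), the
    criterion on H_m and L_m^= constrains z only up to order n <nu, lambda_1>. A jet of order nu' >=
    nu can thus be approached by jets of order nu, correcting a single coefficient of z
    ([jets_D_closure]); regular functions being continuous, the limit is in the Zariski closure
    ([regular_cvg]).

    Since nu_i may be 0, the coordinates of a jet can have nonzero constant terms, and substitution
    into a power series is a true limit. The series involved are therefore bounded by geometric ones
    throughout. *)

(* Geometric estimates make sense in any number field, and this is the only   *)
(* form of archimedeanity and completeness of the complex numbers in use.     *)
Definition geo_complete (C : numFieldType) :=
  (forall M th : C, 0 <= th < 1 -> forall e : C, 0 < e ->
     exists N, forall k, (N <= k)%N -> `|M * th ^+ k| < e) /\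
  (forall (u : nat -> C) (M th : C), 0 <= th < 1 ->
     (forall j k, (j <= k)%N -> `|u k - u j| <= M * th ^+ j) ->
     exists l, forall k, `|l - u k| <= M * th ^+ k).

(** * Geometric completeness of the complex numbers *)

Section ComplexComplete.
Variable R : realType.

Lemma complex_geometric_small (M th : R[i]) : 0 <= th < 1 ->
  forall e : R[i], 0 < e ->
  exists N, forall k, (N <= k)%N -> `|M * th ^+ k| < e.
Proof.
move=> /andP[th0 th1] e e0.
have thR : th = (complex.Re th)%:C%C by rewrite RRe_real ?ger0_real.
have eR : e = (complex.Re e)%:C%C by rewrite RRe_real ?gtr0_real.
have MR : `|M| = (complex.Re `|M|)%:C%C by rewrite RRe_real ?ger0_real.
have Re0 : 0 < complex.Re e by move: e0; rewrite eR ltcR.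
have Rth : `|complex.Re th| < 1.
  by move: th0 th1; rewrite thR lecR ltcR => th0 th1; rewrite ger0_norm.
have /cvgr0Pnorm_lt /(_ _ Re0) [N _ Nth] := cvg_geometric (complex.Re `|M|) Rth.
exists N => k Nk; have := Nth k Nk; rewrite /geometric /= => lt_e.
rewrite normrM normrX (ger0_norm th0) eR MR thR -rmorphXn -rmorphM ltcR.
by apply: le_lt_trans lt_e; exact: ler_norm.
Qed.

Lemma normRe_le (a : R[i]) : (`|complex.Re a|)%:C%C <= `|a|.
Proof.
rewrite normc_def lecR -sqrtr_sqr ler_sqrt ?addr_ge0 ?sqr_ge0 //.
by rewrite lerDl sqr_ge0.
Qed.

Lemma normIm_le (a : R[i]) : (`|complex.Im a|)%:C%C <= `|a|.
Proof.
rewrite normc_def lecR -sqrtr_sqr ler_sqrt ?addr_ge0 ?sqr_ge0 //.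
by rewrite lerDr sqr_ge0.
Qed.

Lemma norm_le_ReIm (a : R[i]) :
  `|a| <= (`|complex.Re a| + `|complex.Im a|)%:C%C.
Proof.
rewrite normc_def lecR /= -[leRHS]ger0_norm ?addr_ge0 // -sqrtr_sqr.
rewrite ler_sqrt ?sqr_ge0 // sqrrD !real_normK ?num_real //.
by rewrite addrAC lerDl mulrn_wge0 // mulr_ge0.
Qed.

Lemma cauchy_geometric_real (u : nat -> R) (M th : R[i]) : 0 <= th < 1 ->
  (forall j k, (j <= k)%N -> (`|u k - u j|)%:C%C <= M * th ^+ j) ->
  exists l : R, forall e, 0 < e -> exists N, forall k, (N <= k)%N ->
    `|l - u k| < e.
Proof.
move=> th01 uM.
suff : cvg (u @ \oo).
  move=> /cvg_ex[l] /cvgrPdist_lt ul; exists l => e e0.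
  by have [N _ Nul] := ul e e0; exists N => k Nk; exact: Nul.
apply/cauchy_cvgP/cauchy_exP => e e0.
have e0C : (0 : R[i]) < e%:C%C by rewrite ltcR.
have [N Ne] := complex_geometric_small M th01 e0C.
exists (u N); exists N => // k /= Nk; rewrite /ball /= distrC -ltcR.
have uNk := uM _ _ Nk.
apply: (le_lt_trans uNk); apply: le_lt_trans (Ne N (leqnn N)).
rewrite real_ler_norm // ger0_real // (le_trans _ uNk) //.
by rewrite lecR.
Qed.

Lemma complex_geo_complete : geo_complete R[i].
Proof.
split=> [M th th01 e e0|u M th th01 uM]; first exact: complex_geometric_small.
have [|x ux] := @cauchy_geometric_real (fun k => complex.Re (u k)) M th th01.
  by move=> j k jk; rewrite -raddfB; apply: le_trans (normRe_le _) (uM _ _ jk).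
have [|y uy] := @cauchy_geometric_real (fun k => complex.Im (u k)) M th th01.
  by move=> j k jk; rewrite -raddfB; apply: le_trans (normIm_le _) (uM _ _ jk).
exists (Complex x y) => k; apply/ler_addgt0Pr => e e0.
have eR : e = (complex.Re e)%:C%C by rewrite RRe_real ?gtr0_real.
have Re0 : 0 < complex.Re e / 2 by rewrite divr_gt0 //; move: e0; rewrite eR ltcR.
have [N1 ux1] := ux _ Re0; have [N2 uy2] := uy _ Re0.
(* The limits of the real and imaginary parts come without a rate. The rate at [k] is recovered by
   passing through a far index [j], at the cost of an arbitrary [e]. *)
pose j := maxn k (maxn N1 N2).
have [kj N1j N2j] : [/\ (k <= j)%N, (N1 <= j)%N & (N2 <= j)%N].
  by rewrite /j !leq_max !leqnn !orbT.
rewrite -(subrKA (u j)) addrC (le_trans (ler_normD _ _)) //.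
apply: lerD; first exact: uM.
apply: le_trans (norm_le_ReIm _) _; rewrite !raddfB /= eR lecR.
by rewrite [leRHS]splitr lerD // ltW // ?ux1 ?uy2.
Qed.

End ComplexComplete.

(** * Geometrically dominated double series *)

(** Both sides run over the pairs with k + l < N, grouped on the left by their sum. It rewrites a
    partial sum of a convolution as a truncated product. *)
Lemma sum_triangle (V : nmodType) (G : nat -> nat -> V) N :
  \sum_(p < N) \sum_(k < p.+1) G k (p - k)%N =
  \sum_(k < N) \sum_(l < N) (if (k + l < N)%N then G k l else 0).
Proof.
transitivity (\sum_(p < N) \sum_(k < N) (if (k < p.+1)%N then G k (p - k)%N else 0)).
  apply: eq_bigr => p _; rewrite (big_ord_widen N (fun k => G k (p - k)%N)) //.
  by rewrite big_mkcond.
rewrite exchange_big; apply: eq_bigr => k _ /=.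
rewrite -big_mkcond /= -(big_mkord (fun p => k < p.+1)%N (fun p => G k (p - k)%N)).
rewrite -big_mkcond /= -(big_mkord (fun l => k + l < N)%N (fun l => G k l)).
rewrite (big_cat_nat (n := k)) //=; last exact: ltnW.
rewrite big_nat_cond big_pred0 ?add0r; last first.
  by move=> i /=; apply/negbTE; lia.
rewrite [RHS](big_cat_nat (n := N - k)) //=; last exact: leq_subr.
rewrite [X in _ = _ + X]big_nat_cond [X in _ = _ + X]big_pred0 ?addr0; last first.
  by move=> i /=; apply/negbTE; lia.
rewrite -{1}(add0n k) big_addn big_nat_cond [RHS]big_nat_cond.
apply: congr_big_nat => // i /=; last by rewrite addnK.
by rewrite ltn_subRL ltnS leq_addl andbT => ->.
Qed.

Section DoubleSeries.
Variable C : numClosedFieldType.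
Hypothesis hC : geo_complete C.
Implicit Types (u v : nat -> C) (c d : nat -> nat -> C) (M B th : C).

Lemma cvg_geometricP u (l : C) M th : 0 <= th < 1 ->
  (forall k, `|l - u k| <= M * th ^+ k) -> u @ \oo --> l.
Proof.
move=> th01 ul; apply/cvgrPdist_lt => e e0.
have [N Ne] := hC.1 M th th01 e e0.
exists N => // k /= Nk; apply: le_lt_trans (Ne k Nk).
apply: le_trans (ul k) (real_ler_norm _).
by rewrite ger0_real // (le_trans _ (ul k)).
Qed.

(** The difference of ((1 + th) / 2)^2 and th is the square of (1 - th) / 2. Of the two equal
    factors, one is summed over the quadrant and the other gives the rate of the tails. *)
Lemma geo_half th : 0 <= th < 1 ->
  exists2 ph, 0 <= ph < 1 & forall k, th ^+ k <= ph ^+ k * ph ^+ k.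
Proof.
move=> /andP[th0 th1]; exists ((1 + th) / 2).
  by rewrite divr_ge0 ?addr_ge0 //= ltr_pdivrMr // mul1r ltrD2l.
move=> k; rewrite -exprMn lerXn2r ?nnegrE ?mulr_ge0 ?invr_ge0 ?addr_ge0 //.
rewrite mulf_div -subr_ge0.
have -> : (1 + th) * (1 + th) / (2 * 2) - th = ((1 - th) / 2) ^+ 2 by field.
by rewrite exprn_ge0 // divr_ge0 // subr_ge0 ltW.
Qed.

Lemma cvg_sum (T : Type) (F : set_system T) (FF : Filter F) (I : Type) (s : seq I)
    (f : I -> T -> C) (l : I -> C) :
  (forall i, f i x @[x --> F] --> l i) ->
  \sum_(i <- s) f i x @[x --> F] --> \sum_(i <- s) l i.
Proof. by move=> fl; apply: cvg_big => //; exact: add_continuous. Qed.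

(** Square partial sums, as in [cps_eval] and [cps_comp], so that [dsum] unfolds to their limits. *)
Definition dpart c N : C := \sum_(p < N) \sum_(q < N) c p q.
Definition dsum c : C := limn (dpart c).

Lemma sum_geo_le th N : 0 <= th < 1 -> \sum_(p < N) th ^+ p <= (1 - th)^-1.
Proof.
move=> /andP[th0 th1]; rewrite -[leRHS]mul1r ler_pdivlMr ?subr_gt0 // mulrC.
have -> : (1 - th) * \sum_(p < N) th ^+ p = 1 - th ^+ N.
  by apply: oppr_inj; rewrite -mulNr !opprB subrX1.
by rewrite lerBlDr lerDl exprn_ge0.
Qed.

Lemma dpart_le c M th N : 0 <= M -> 0 <= th < 1 ->
  (forall p q, (p < N)%N -> (q < N)%N -> `|c p q| <= M * th ^+ (p + q)) ->
  `|dpart c N| <= M * (1 - th)^-1 ^+ 2.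
Proof.
move=> M0 th01 cM; have /andP[th0 th1] := th01.
apply: le_trans (_ : M * (\sum_(p < N) th ^+ p) ^+ 2 <= _); last first.
  rewrite ler_wpM2l // lerXn2r ?nnegrE ?sum_geo_le ?sumr_ge0 //.
    by move=> i _; rewrite exprn_ge0.
  by rewrite invr_ge0 subr_ge0 ltW.
rewrite expr2 mulr_suml mulr_sumr; apply: le_trans (ler_norm_sum _ _ _) _.
apply: ler_sum => p _; rewrite mulr_sumr mulr_sumr.
apply: le_trans (ler_norm_sum _ _ _) (ler_sum _ _) => q _.
by rewrite -exprD cM.
Qed.

Lemma dpart_widen c j k : (j <= k)%N ->
  dpart c j = dpart (fun p q => if (p < j)%N && (q < j)%N then c p q else 0) k.
Proof.
move=> jk; rewrite /dpart (big_ord_widen k (fun p => \sum_(q < j) c p q)) //.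
rewrite big_mkcond; apply: eq_bigr => p _; case: ifP => pj /=; last first.
  by rewrite big1.
by rewrite (big_ord_widen k (fun q => c p q)) // big_mkcond.
Qed.

Lemma dpartB c d N : dpart c N - dpart d N = dpart (fun p q => c p q - d p q) N.
Proof.
by rewrite /dpart -sumrB; apply: eq_bigr => p _; rewrite -sumrB.
Qed.

Lemma dpart_dist c M th j k : 0 <= th < 1 -> (j <= k)%N ->
  (forall p q, `|c p q| <= M * (th ^+ (p + q) * th ^+ (p + q))) ->
  `|dpart c k - dpart c j| <= M * (1 - th)^-1 ^+ 2 * th ^+ j.
Proof.
move=> th01 jk cM; have /andP[th0 th1] := th01.
have M0 : 0 <= M by have := cM 0%N 0%N; rewrite !mulr1; apply: le_trans.
rewrite (dpart_widen c jk) dpartB [leRHS]mulrAC.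
apply: dpart_le => [||p q _ _] //; first by rewrite mulr_ge0 ?exprn_ge0.
case: ifP => [_|/negbT]; first by rewrite subrr normr0 !mulr_ge0 ?exprn_ge0.
rewrite negb_and -!leqNgt => pq; rewrite subr0 (le_trans (cM p q)) // -mulrA.
rewrite ler_wpM2l // ler_wpM2r ?exprn_ge0 //.
apply: ler_wiXn2l => //; first exact: ltW.
by case/orP: pq => jpq; rewrite (leq_trans jpq) ?leq_addr ?leq_addl.
Qed.

Definition geo c := exists M th, 0 <= th < 1 /\
  forall p q, `|c p q| <= M * th ^+ (p + q).

Lemma dsum_dist c M th : 0 <= th < 1 ->
  (forall p q, `|c p q| <= M * (th ^+ (p + q) * th ^+ (p + q))) ->
  forall k, `|dsum c - dpart c k| <= M * (1 - th)^-1 ^+ 2 * th ^+ k.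
Proof.
move=> th01 cM.
have [l lP] := hC.2 _ _ _ th01 (fun j k jk => dpart_dist th01 jk cM).
suff -> : dsum c = l by [].
by apply/cvg_lim; [exact: norm_hausdorff|exact: cvg_geometricP th01 lP].
Qed.

Lemma dsum_cvg c : geo c -> dpart c @ \oo --> dsum c.
Proof.
move=> [M [th [th01 cM]]]; have [ph ph01 thph] := geo_half th01.
have M0 : 0 <= M by have := cM 0%N 0%N; rewrite mulr1; apply: le_trans.
apply: (cvg_geometricP ph01); apply: (@dsum_dist c M ph ph01) => p q.
by rewrite (le_trans (cM p q)) // ler_wpM2l.
Qed.

Lemma dsum_lim c l : dpart c @ \oo --> l -> dsum c = l.
Proof. by move=> /cvg_lim; apply; exact: norm_hausdorff. Qed.

Lemma eq_dsum c d : (forall p q, c p q = d p q) -> dsum c = dsum d.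
Proof.
by move=> cd; congr dsum; apply: funext => p; apply: funext => q.
Qed.

Lemma dsum0 c : (forall p q, c p q = 0) -> dsum c = 0.
Proof.
move=> c0; apply: dsum_lim; rewrite (_ : dpart c = cst 0); first exact: cvg_cst.
by apply: funext => N; rewrite /dpart big1 // => p _; rewrite big1.
Qed.

Lemma geoD c d : geo c -> geo d -> geo (fun p q => c p q + d p q).
Proof.
move=> [M [th [/andP[th0 th1] cM]]] [N [ph [/andP[ph0 ph1] dN]]].
have M0 : 0 <= M by have := cM 0%N 0%N; rewrite mulr1; apply: le_trans.
have N0 : 0 <= N by have := dN 0%N 0%N; rewrite mulr1; apply: le_trans.
wlog thph : M N c d th ph th0 th1 ph0 ph1 M0 N0 cM dN / th <= ph.
  move=> H; have /orP[thph|phth] : (th <= ph) || (ph <= th).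
  - by apply: real_leVge; apply: ger0_real.
  - exact: (H M N c d th ph).
  - have [K [eta [eta01 etaK]]] := H N M d c ph th ph0 ph1 th0 th1 N0 M0 dN cM phth.
    by exists K, eta; split => // p q; rewrite addrC.
exists (M + N), ph; rewrite ph0; split => // p q.
rewrite (le_trans (ler_normD _ _)) // mulrDl lerD // (le_trans (cM _ _)) //.
by rewrite ler_wpM2l // lerXn2r.
Qed.

Lemma geo_sum (I : Type) (s : seq I) (c : I -> nat -> nat -> C) :
  (forall i, geo (c i)) -> geo (fun p q => \sum_(i <- s) c i p q).
Proof.
move=> cg; elim: s => [|i s IHs].
  by exists 0, 0; rewrite lexx ltr01; split => // p q; rewrite big_nil normr0 mul0r.
rewrite (_ : (fun _ => _) = fun p q => c i p q + \sum_(j <- s) c j p q); first exact: geoD.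
by apply: funext => p; apply: funext => q; rewrite big_cons.
Qed.

Lemma dsumD c d : geo c -> geo d -> dsum (fun p q => c p q + d p q) = dsum c + dsum d.
Proof.
move=> cg dg; apply: dsum_lim; rewrite (_ : dpart _ = dpart c + dpart d).
  by apply: cvgD; apply: dsum_cvg.
apply: funext => N; rewrite -[RHS]/(dpart c N + dpart d N) /dpart -big_split /=.
by apply: eq_bigr => p _; rewrite -big_split.
Qed.

Lemma dsum_sum (I : Type) (s : seq I) (c : I -> nat -> nat -> C) :
  (forall i, geo (c i)) ->
  dsum (fun p q => \sum_(i <- s) c i p q) = \sum_(i <- s) dsum (c i).
Proof.
move=> cg; elim: s => [|i s IHs].
  by rewrite big_nil; apply: dsum0 => p q; rewrite big_nil.
rewrite big_cons -IHs -dsumD //; last exact: geo_sum.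
by apply: eq_dsum => p q; rewrite big_cons.
Qed.

Lemma geoZ a c : geo c -> geo (fun p q => a * c p q).
Proof.
move=> [M [th [th01 cM]]]; exists (`|a| * M), th; split => // p q.
by rewrite normrM -mulrA ler_wpM2l.
Qed.

Lemma dsumZ a c : geo c -> dsum (fun p q => a * c p q) = a * dsum c.
Proof.
move=> cg; apply: dsum_lim; rewrite (_ : dpart _ = cst a \* dpart c).
  by apply: cvgM; [exact: cvg_cst|exact: dsum_cvg].
apply: funext => N; rewrite -[RHS]/(a * dpart c N) /dpart mulr_sumr.
by apply: eq_bigr => p _; rewrite mulr_sumr.
Qed.

Definition dconv c d p q : C :=
  \sum_(k < p.+1) \sum_(l < q.+1) c k l * d (p - k)%N (q - l)%N.

Lemma dpart_conv c d N : dpart (dconv c d) N =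
  \sum_(k < N) \sum_(k' < N) \sum_(l < N) \sum_(l' < N)
    (if (k + k' < N)%N && (l + l' < N)%N then c k l * d k' l' else 0).
Proof.
rewrite /dpart /dconv.
under eq_bigr do rewrite exchange_big.
rewrite (sum_triangle (fun k k' => \sum_(q < N) \sum_(l < q.+1) c k l * d k' (q - l)%N)).
apply: eq_bigr => k _; apply: eq_bigr => k' _; case: ifP => _ /=; last first.
  by rewrite big1 // => l _; rewrite big1.
exact: (sum_triangle (fun l l' => c k l * d k' l')).
Qed.

Lemma dpartM c d N : dpart c N * dpart d N =
  \sum_(k < N) \sum_(k' < N) \sum_(l < N) \sum_(l' < N) c k l * d k' l'.
Proof.
rewrite /dpart mulr_suml; apply: eq_bigr => k _; rewrite mulr_sumr.
apply: eq_bigr => k' _; rewrite mulr_suml; apply: eq_bigr => l _.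
by rewrite mulr_sumr.
Qed.

Lemma natr_geo_le th k : 0 <= th < 1 -> k.+1%:R * th ^+ k <= (1 - th)^-1.
Proof.
move=> th01; apply: le_trans (sum_geo_le k.+1 th01).
rewrite mulr_natl -[k.+1 in X in X <= _]card_ord -sumr_const; apply: ler_sum => i _.
case/andP: th01 => th0 th1.
by apply: ler_wiXn2l; rewrite ?(ltW th1) // -ltnS.
Qed.

Lemma geo_conv c d : geo c -> geo d -> geo (dconv c d).
Proof.
move=> [M [th [th01 cM]]] [M' [th' [th'01 dM]]].
have M0 : 0 <= M by have := cM 0%N 0%N; rewrite mulr1; apply: le_trans.
have M'0 : 0 <= M' by have := dM 0%N 0%N; rewrite mulr1; apply: le_trans.
have [eta [thE th'E eta01]] : exists eta, [/\ th <= eta, th' <= eta & 0 <= eta < 1].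
  have [/andP[th0 th1] /andP[th'0 th'1]] := (th01, th'01).
  have /orP[?|?] : (th <= th') || (th' <= th).
  - by apply: real_leVge; apply: ger0_real.
  - by exists th'; rewrite th'0.
  - by exists th; rewrite th0.
have [ph ph01 etaph] := geo_half eta01; have /andP[ph0 ph1] := ph01.
have [/andP[th0 th1] /andP[th'0 th'1] /andP[eta0 eta1]] := And3 th01 th'01 eta01.
exists (M * M' * ((1 - ph)^-1 * (1 - ph)^-1)), ph; split => // p q.
apply: (@le_trans _ _ (\sum_(k < p.+1) \sum_(l < q.+1) M * M' * eta ^+ (p + q))).
  rewrite /dconv (le_trans (ler_norm_sum _ _ _)) //; apply: ler_sum => k _.
  rewrite (le_trans (ler_norm_sum _ _ _)) //; apply: ler_sum => l _.
  have -> : (p + q = (k + l) + (p - k + (q - l)))%N.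
    by case: k l => k /= kp [l /= lq]; lia.
  rewrite normrM exprD mulrACA ler_pM //.
    by rewrite (le_trans (cM _ _)) // ler_wpM2l // lerXn2r.
  by rewrite (le_trans (dM _ _)) // ler_wpM2l // lerXn2r.
rewrite !sumr_const !card_ord -mulrnA -[leLHS]mulr_natr.
apply: (@le_trans _ _ (M * M' * (ph ^+ (p + q) * ph ^+ (p + q)) * (q.+1 * p.+1)%:R)).
  by rewrite ler_wpM2r // ler_wpM2l ?mulr_ge0.
have -> : M * M' * (ph ^+ (p + q) * ph ^+ (p + q)) * (q.+1 * p.+1)%:R =
    M * M' * ((p.+1%:R * ph ^+ p) * (q.+1%:R * ph ^+ q)) * ph ^+ (p + q).
  by rewrite natrM !exprD; ring.
rewrite ler_wpM2r ?exprn_ge0 // ler_wpM2l ?mulr_ge0 //.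
by rewrite ler_pM ?mulr_ge0 ?exprn_ge0 ?natr_geo_le.
Qed.

(** The product of the partial sums and the partial sum of the convolution differ by the terms with
    k + k' >= N or l + l' >= N. There one of the two factors ph^(k + l + k' + l') is at most ph^N,
    and the other remains summable. *)
Lemma dsumM c d : geo c -> geo d -> dsum (dconv c d) = dsum c * dsum d.
Proof.
move=> cg dg; have [M [th [th01 cM]]] := cg; have [M' [th' [th'01 dM]]] := dg.
have M0 : 0 <= M by have := cM 0%N 0%N; rewrite mulr1; apply: le_trans.
have M'0 : 0 <= M' by have := dM 0%N 0%N; rewrite mulr1; apply: le_trans.
wlog thth' : c d cg dg M M' th th' th01 th'01 cM dM M0 M'0 / th <= th'.
  move=> H; have /orP[thth'|th'th] : (th <= th') || (th' <= th).
  - by case/andP: th01 th'01 => ? _ /andP[? _]; apply: real_leVge; apply: ger0_real.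
  - exact: (H c d cg dg M M' th th').
  - rewrite mulrC -(H d c dg cg M' M th' th) //; apply: eq_dsum => p q.
    rewrite /dconv (reindex_inj rev_ord_inj) /=; apply: eq_bigr => k _.
    rewrite (reindex_inj rev_ord_inj) /=; apply: eq_bigr => l _.
    by rewrite !subSS !subKn -1?ltnS // mulrC.
have [ph ph01 thph] := geo_half th'01; have /andP[ph0 ph1] := ph01.
have {}cM p q : `|c p q| <= M * (ph ^+ (p + q) * ph ^+ (p + q)).
  rewrite (le_trans (cM p q)) // ler_wpM2l // (le_trans _ (thph _)) //.
  by case/andP: th01 th'01 => ? _ /andP[? _]; rewrite lerXn2r.
have {}dM p q : `|d p q| <= M' * (ph ^+ (p + q) * ph ^+ (p + q)).
  by rewrite (le_trans (dM p q)) // ler_wpM2l.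
apply: dsum_lim.
pose K := M * M' * (1 - ph)^-1 ^+ 4.
have D N : `|dpart c N * dpart d N - dpart (dconv c d) N| <= K * ph ^+ N.
  rewrite dpartM dpart_conv -sumrB (le_trans (ler_norm_sum _ _ _)) //.
  pose S := \sum_(p < N) ph ^+ p.
  have S0 : 0 <= S by rewrite sumr_ge0 // => i _; rewrite exprn_ge0.
  apply: (@le_trans _ _ (M * M' * ph ^+ N * (S * (S * (S * S))))); last first.
    rewrite /K mulrAC ler_wpM2r ?exprn_ge0 // ler_wpM2l ?mulr_ge0 //.
    rewrite (_ : S * _ = S ^+ 4); last by rewrite !exprS expr0 mulr1.
    rewrite lerXn2r ?nnegrE ?sum_geo_le ?invr_ge0 ?subr_ge0 //; exact: ltW.
  rewrite mulr_suml mulr_sumr; apply: ler_sum => k _.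
  rewrite -sumrB (le_trans (ler_norm_sum _ _ _)) // mulr_suml mulr_sumr mulr_sumr.
  apply: ler_sum => k' _.
  rewrite -sumrB (le_trans (ler_norm_sum _ _ _)) // mulr_suml !mulr_sumr.
  apply: ler_sum => l _.
  rewrite -sumrB (le_trans (ler_norm_sum _ _ _)) // !mulr_sumr.
  apply: ler_sum => l' _; case: ifP => [_|/negbT].
    by rewrite subrr normr0 !mulr_ge0 ?exprn_ge0.
  rewrite subr0 normrM negb_and -!leqNgt => kl.
  apply: (@le_trans _ _ (M * M' * (ph ^+ (k + l + (k' + l')) * ph ^+ (k + l + (k' + l'))))).
    rewrite (le_trans (ler_pM _ _ (cM _ _) (dM _ _))) // le_eqVlt.
    by apply/orP; left; apply/eqP; rewrite !exprD; ring.
  rewrite -(mulrA _ (ph ^+ N)) ler_wpM2l ?mulr_ge0 // ler_pM ?exprn_ge0 //.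
    apply: ler_wiXn2l => //; first exact: ltW.
    by case/orP: kl => /leq_trans; apply; rewrite addnACA ?leq_addr ?leq_addl.
  by rewrite -!exprD addnACA -!addnA addnCA.
rewrite (_ : dpart _ = (dpart c \* dpart d) -
  (fun N => dpart c N * dpart d N - dpart (dconv c d) N)); last first.
  by apply: funext => N /=; rewrite opprB addrC subrK.
rewrite -[_ * _]subr0; apply: cvgB; first by apply: cvgM; exact: dsum_cvg.
by apply: (cvg_geometricP ph01) => k; rewrite sub0r normrN.
Qed.

(** Dominated convergence: the common majorant makes all tails small at once, and the remaining
    square is a finite sum. *)
Lemma dsum_dominated (c_ : nat -> nat -> nat -> C) c M th : 0 <= th < 1 ->
  (forall m p q, `|c_ m p q| <= M * th ^+ (p + q)) ->
  (forall p q, c_ m p q @[m --> \oo] --> c p q) ->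
  dsum (c_ m) @[m --> \oo] --> dsum c.
Proof.
move=> th01 cM c_c; have /andP[th0 th1] := th01.
have M0 : 0 <= M by have := cM 0%N 0%N 0%N; rewrite mulr1; apply: le_trans.
have {}cM' p q : `|c p q| <= M * th ^+ (p + q).
  apply/ler_addgt0Pr => e e0; have /cvgrPdist_lt /(_ _ e0) [N _ /(_ N (leqnn N)) lt_e] := c_c p q.
  rewrite -(subrK (c_ N p q) (c p q)) addrC (le_trans (ler_normD _ _)) // lerD //.
  exact: ltW.
have [ph ph01 thph] := geo_half th01.
have cMM m p q : `|c_ m p q| <= M * (ph ^+ (p + q) * ph ^+ (p + q)).
  by rewrite (le_trans (cM m p q)) // ler_wpM2l.
have cMM' p q : `|c p q| <= M * (ph ^+ (p + q) * ph ^+ (p + q)).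
  by rewrite (le_trans (cM' p q)) // ler_wpM2l.
apply/cvgrPdist_lt => e e0; have e3 : 0 < e / 3 by rewrite divr_gt0.
have [N /(_ N (leqnn N)) Ne] := hC.1 (M * (1 - ph)^-1 ^+ 2) ph ph01 _ e3.
have tail d : (forall p q, `|d p q| <= M * (ph ^+ (p + q) * ph ^+ (p + q))) ->
    `|dsum d - dpart d N| < e / 3.
  move=> dM; have dd := dsum_dist ph01 dM N; apply: le_lt_trans Ne.
  by apply: (le_trans dd (real_ler_norm _)); rewrite ger0_real // (le_trans _ dd).
have : dpart (c_ m) N @[m --> \oo] --> dpart c N.
  rewrite /dpart; apply: cvg_sum => p; apply: cvg_sum => q; exact: c_c.
move=> /cvgrPdist_lt /(_ _ e3); apply: filterS => m cmN.
have -> : dsum c - dsum (c_ m) = (dsum c - dpart c N) + (dpart c N - dpart (c_ m) N)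
    - (dsum (c_ m) - dpart (c_ m) N).
  by ring.
rewrite (le_lt_trans (ler_normB _ _)) // (le_lt_trans (lerD (ler_normD _ _) (lexx _))) //.
have -> : e = e / 3 + e / 3 + e / 3 by field.
by rewrite !ltrD // tail.
Qed.

End DoubleSeries.

(** * Substitution of polynomials in convergent power series *)

Section CpsCoefficients.
Variable C : numClosedFieldType.
Implicit Types a b : cps C.

Lemma cpsM a b p q : (a * b) p q = dconv a b p q. Proof. by []. Qed.
Lemma cpsD a b p q : (a + b) p q = a p q + b p q. Proof. by []. Qed.
Lemma cpsN a p q : (- a) p q = - a p q. Proof. by []. Qed.
Lemma cps0E p q : (0 : cps C) p q = 0. Proof. by []. Qed.
Lemma cps1E p q : (1 : cps C) p q = ((p == 0%N) && (q == 0%N))%:R. Proof. by []. Qed.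

End CpsCoefficients.

Section WeightedNorm.
Variable C : numClosedFieldType.
Implicit Types (P Q : {poly C}) (t : C).

(** A submultiplicative norm ([wnormM]): it bounds the coefficients of P^p geometrically in p,
    whatever the size of the higher coefficients of P, once the weight t is small. *)
Definition wnorm t P := \sum_(i < size P) `|P`_i| * t ^+ i.

Lemma wnorm_wide t P d : (size P <= d)%N -> wnorm t P = \sum_(i < d) `|P`_i| * t ^+ i.
Proof.
move=> sd; rewrite /wnorm (big_ord_widen d (fun i => `|P`_i| * t ^+ i)) //.
rewrite big_mkcond; apply: eq_bigr => i _; case: ltnP => // si.
by rewrite nth_default // normr0 mul0r.
Qed.

Lemma wnorm_ge0 t P : 0 <= t -> 0 <= wnorm t P.
Proof. by move=> t0; apply: sumr_ge0 => i _; rewrite mulr_ge0 ?exprn_ge0. Qed.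

Lemma wnorm_coef t P j : 0 <= t -> `|P`_j| * t ^+ j <= wnorm t P.
Proof.
move=> t0; case: (ltnP j (size P)) => jP; last first.
  by rewrite nth_default // normr0 mul0r wnorm_ge0.
rewrite /wnorm (bigD1 (Ordinal jP)) //= lerDl sumr_ge0 // => i _.
by rewrite mulr_ge0 ?exprn_ge0.
Qed.

Lemma wnormM t P Q : 0 <= t -> wnorm t (P * Q) <= wnorm t P * wnorm t Q.
Proof.
move=> t0; pose nP := \poly_(i < size P) `|P`_i|; pose nQ := \poly_(i < size Q) `|Q`_i|.
have nE (U : {poly C}) : wnorm t U = (\poly_(i < size U) `|U`_i|).[t].
  by rewrite horner_poly.
have nC (U : {poly C}) i : (\poly_(i < size U) `|U`_i|)`_i = `|U`_i|.
  by rewrite coef_poly; case: ltnP => // /(nth_default 0) ->; rewrite normr0.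
rewrite (nE P) (nE Q) -hornerM.
pose d := maxn (size (P * Q)) (size (nP * nQ)).
rewrite (wnorm_wide _ (leq_maxl _ _ : (size (P * Q)%R <= d)%N)).
rewrite (@horner_coef_wide _ d); last exact: leq_maxr.
apply: ler_sum => i _; rewrite ler_wpM2r ?exprn_ge0 // !coefM.
apply: le_trans (ler_norm_sum _ _ _) (ler_sum _ _) => k _.
by rewrite normrM !nC.
Qed.

Lemma wnorm1 t : wnorm t 1 = 1.
Proof. by rewrite /wnorm size_poly1 big_ord1 coef1 normr1 mulr1. Qed.

Lemma wnormX t P k B : 0 <= t -> wnorm t P <= B -> wnorm t (P ^+ k) <= B ^+ k.
Proof.
move=> t0 PB; elim: k => [|k IHk]; first by rewrite !expr0 wnorm1.
rewrite !exprS (le_trans (wnormM _ _ t0)) // ler_pM ?wnorm_ge0 //.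
Qed.

Lemma wnormZXn t (b : C) k : wnorm t (b *: 'X^k) = `|b| * t ^+ k.
Proof.
rewrite (@wnorm_wide _ _ k.+1); last first.
  by rewrite (leq_trans (size_scale_leq _ _)) ?size_polyXn.
rewrite (bigD1 ord_max) //= coefZ coefXn eqxx mulr1 big1 ?addr0 // => i ik.
by rewrite coefZ coefXn [_ == k](_ : _ = false) ?mulr0 ?normr0 ?mul0r //; apply/negbTE.
Qed.

Lemma wnorm_small P (rho : C) : `|P`_0| < rho -> exists t B,
  [/\ 0 < t, B < rho & forall s, 0 <= s <= t -> wnorm s P <= B].
Proof.
move=> P0; have rho0 : 0 < rho by apply: le_lt_trans P0.
pose W := \sum_(i < size P) `|P`_i.+1|.
have W0 : 0 <= W by apply: sumr_ge0.
have D0 : 0 < rho - `|P`_0| by rewrite subr_gt0.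
have Wr0 : 0 < 2 * (W + rho) by rewrite mulr_gt0 // ltr_wpDl.
(* With this weight, t (W + rho) is half of the gap between |P_0| and rho, which leaves the norm
   below the midpoint of the two. *)
pose t := (rho - `|P`_0|) / (2 * (W + rho)).
have t0 : 0 < t by rewrite divr_gt0.
have t1 : t <= 1.
  rewrite ler_pdivrMr // mul1r (@le_trans _ _ rho) //; first by rewrite gerBl.
  rewrite (_ : 2 * _ = rho + (W + W + rho)); last by ring.
  by rewrite lerDl !addr_ge0 // ltW.
exists t, ((`|P`_0| + rho) / 2); split => //.
  by rewrite ltr_pdivrMr // mulr_natr mulr2n ltrD2r.
move=> s /andP[s0 st].
have s1 : s <= 1 by apply: le_trans t1.
apply: (@le_trans _ _ (`|P`_0| + s * W)).
  rewrite (@wnorm_wide _ _ (size P).+1) // big_ord_recl expr0 mulr1 lerD2l.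
  rewrite /W mulr_sumr; apply: ler_sum => i _.
  rewrite (_ : nat_of_ord (lift ord0 i) = i.+1) // mulrC ler_wpM2r // exprS.
  by rewrite ler_piMr // exprn_ile1.
have W' : W + rho != 0 by rewrite gt_eqF // ltr_wpDl.
have -> : (`|P`_0| + rho) / 2 = `|P`_0| + t * (W + rho) by rewrite /t; field.
by rewrite lerD2l ler_pM // lerDl ltW.
Qed.

End WeightedNorm.

Section ConvergesOn.
Variable C : numClosedFieldType.
Implicit Types (a b : cps C) (rho s : C).

Lemma converges_onP rho a : converges_on rho a <->
  forall s, 0 < s < rho -> geo (fun p q => a p q * s ^+ (p + q)).
Proof.
split=> [a_rho s /andP[s0 s_rho]|a_rho s /[dup] /andP[s0 _] /a_rho].
  have rho0 : 0 < rho by apply: lt_trans s_rho.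
  have [B' sB' B'r] : exists2 B', s < B' & B' < rho.
    exists ((s + rho) / 2).
      by rewrite ltr_pdivlMr // mulr_natr mulr2n ltrD2l.
    by rewrite ltr_pdivrMr // mulr_natr mulr2n ltrD2r.
  have B'0 : 0 < B' by apply: lt_trans sB'.
  have [M aM] : exists M, forall i j, `|a i j| * B' ^+ (i + j) <= M.
    by apply: a_rho; rewrite B'0.
  exists M, (s / B'); split => [|p q].
    by rewrite divr_ge0 ?(ltW s0) ?(ltW B'0) //= ltr_pdivrMr // mul1r.
  rewrite normrM normrX (gtr0_norm s0) expr_div_n mulrA [M * _]mulrC -mulrA.
  by rewrite mulrC ler_wpM2l ?exprn_ge0 ?(ltW s0) // ler_pdivlMr ?exprn_gt0.
move=> [M [th [/andP[th0 th1] aM]]]; exists M => i j.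
have M0 : 0 <= M by have := aM 0%N 0%N; rewrite [leRHS]mulr1; apply: le_trans.
rewrite -[s in s ^+ _](gtr0_norm s0) -normrX -normrM (le_trans (aM i j)) //.
by rewrite ler_piMr // exprn_ile1 // ltW.
Qed.

Lemma converges_on0 rho : converges_on rho (0 : cps C).
Proof. by move=> s _; exists 0 => i j; rewrite cps0E normr0 mul0r. Qed.

Lemma converges_on1 rho : converges_on rho (1 : cps C).
Proof.
move=> s /andP[s0 _]; exists 1 => -[|i] [|j]; rewrite cps1E ?normr1 ?normr0 ?mul0r ?ler01 //.
by rewrite mul1r.
Qed.

Lemma converges_onN rho a : converges_on rho a -> converges_on rho (- a).
Proof.
by move=> + s s_rho => /(_ s s_rho)[M aM]; exists M => i j; rewrite cpsN normrN.
Qed.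

Lemma converges_onD rho a b :
  converges_on rho a -> converges_on rho b -> converges_on rho (a + b).
Proof.
move=> /converges_onP ha /converges_onP hb; apply/converges_onP => s s_rho.
have := geoD (ha s s_rho) (hb s s_rho).
rewrite [X in geo X -> _](_ : _ = fun p q => (a + b) p q * s ^+ (p + q)) //.
by apply: funext => p; apply: funext => q; rewrite cpsD mulrDl.
Qed.

Lemma converges_onM rho a b :
  converges_on rho a -> converges_on rho b -> converges_on rho (a * b).
Proof.
move=> /converges_onP ha /converges_onP hb; apply/converges_onP => s s_rho.
have := geo_conv (ha s s_rho) (hb s s_rho).
rewrite [X in geo X -> _](_ : _ = fun p q => (a * b) p q * s ^+ (p + q)) //.
apply: funext => p; apply: funext => q; rewrite cpsM /dconv mulr_suml.
apply: eq_bigr => k _; rewrite mulr_suml; apply: eq_bigr => l _.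
rewrite mulrACA -exprD; congr (_ * _ ^+ _).
by case: k l => k /= kp [l /= lq]; lia.
Qed.

End ConvergesOn.

Section Evaluation.
Variable C : numClosedFieldType.
Hypothesis hC : geo_complete C.
Implicit Types (P Q z : {poly C}) (a b : cps C) (rho t : C).

(** The coefficient of degree [j] of a(P, Q). It is an infinite sum as soon as P or Q has a nonzero
    constant term. *)
Definition ev a P Q j : C := dsum (fun p q => a p q * (P ^+ p * Q ^+ q)`_j).

Lemma ev_bound a P Q t B B' M j : 0 < t -> 0 < B' ->
  wnorm t P <= B -> wnorm t Q <= B ->
  (forall p q, `|a p q| * B' ^+ (p + q) <= M) ->
  forall p q, `|a p q * (P ^+ p * Q ^+ q)`_j| <= (M / t ^+ j) * (B / B') ^+ (p + q).
Proof.
move=> t0 B'0 PB QB aM p q.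
have B0 : 0 <= B by apply: le_trans PB; rewrite wnorm_ge0 // ltW.
have PQ : `|(P ^+ p * Q ^+ q)`_j| * t ^+ j <= B ^+ (p + q).
  rewrite (le_trans (wnorm_coef _ _ (ltW t0))) // (le_trans (wnormM _ _ (ltW t0))) //.
  by rewrite exprD ler_pM ?wnorm_ge0 ?(ltW t0) ?wnormX // ltW.
rewrite normrM expr_div_n mulrACA [_^-1 * _]mulrC mulrACA.
rewrite ler_pM // ?ler_pdivlMr ?exprn_gt0 //.
Qed.

Lemma ev_data rho a P Q : converges_on rho a -> `|P`_0| < rho -> `|Q`_0| < rho ->
  exists t B B' M, [/\ [/\ 0 < t, wnorm t P <= B & wnorm t Q <= B],
    0 <= B / B' < 1, 0 < B' & forall p q, `|a p q| * B' ^+ (p + q) <= M].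
Proof.
move=> a_rho P0 Q0.
have [t1 [B1 [t10 B1r PB]]] := wnorm_small P0.
have [t2 [B2 [t20 B2r QB]]] := wnorm_small Q0.
have rho0 : 0 < rho by apply: le_lt_trans P0.
have B10 : 0 <= B1.
  by apply: le_trans (PB 0 _); rewrite ?wnorm_ge0 // lexx ltW.
have B20 : 0 <= B2.
  by apply: le_trans (QB 0 _); rewrite ?wnorm_ge0 // lexx ltW.
have [B [BB1 BB2 Br B0]] : exists B, [/\ B1 <= B, B2 <= B, B < rho & 0 <= B].
  have /orP[le12|le21] : (B1 <= B2) || (B2 <= B1).
  - by apply: real_leVge; apply: ger0_real.
  - by exists B2.
  - by exists B1.
have [t [t0 tt1 tt2]] : exists t, [/\ 0 < t, t <= t1 & t <= t2].
  have /orP[le12|le21] : (t1 <= t2) || (t2 <= t1).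
  - by apply: real_leVge; apply: gtr0_real.
  - by exists t1.
  - by exists t2.
have [B' BB' B'r] : exists2 B', B < B' & B' < rho.
  exists ((B + rho) / 2).
    by rewrite ltr_pdivlMr // mulr_natr mulr2n ltrD2l.
  by rewrite ltr_pdivrMr // mulr_natr mulr2n ltrD2r.
have B'0 : 0 < B' by apply: le_lt_trans BB'.
have [M aM] : exists M, forall i j, `|a i j| * B' ^+ (i + j) <= M.
  by apply: a_rho; rewrite B'0.
exists t, B, B', M; split => //.
  split => //; first by rewrite (le_trans _ BB1) // PB // tt1 ltW.
  by rewrite (le_trans _ BB2) // QB // tt2 ltW.
by rewrite divr_ge0 ?(ltW B'0) //= ltr_pdivrMr // mul1r.
Qed.

Lemma ev_geo rho a P Q j : converges_on rho a -> `|P`_0| < rho -> `|Q`_0| < rho ->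
  geo (fun p q => a p q * (P ^+ p * Q ^+ q)`_j).
Proof.
move=> a_rho P0 Q0.
have [t [B [B' [M [[t0 PB QB] BB' B'0 aM]]]]] := ev_data a_rho P0 Q0.
by exists (M / t ^+ j), (B / B'); split => //; exact: ev_bound.
Qed.

Lemma cvg_coefM (P_ Q_ : nat -> {poly C}) P Q :
  (forall j, (P_ m)`_j @[m --> \oo] --> P`_j) ->
  (forall j, (Q_ m)`_j @[m --> \oo] --> Q`_j) ->
  forall j, (P_ m * Q_ m)`_j @[m --> \oo] --> (P * Q)`_j.
Proof.
move=> PP QQ j; rewrite coefM; under eq_cvg do rewrite coefM.
by apply: cvg_sum => i; apply: cvgM.
Qed.

Lemma cvg_coefX (P_ : nat -> {poly C}) P k :
  (forall j, (P_ m)`_j @[m --> \oo] --> P`_j) ->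
  forall j, (P_ m ^+ k)`_j @[m --> \oo] --> (P ^+ k)`_j.
Proof.
move=> PP; elim: k => [|k IHk] j.
  by under eq_cvg do rewrite expr0; exact: cvg_cst.
rewrite exprS; under eq_cvg do rewrite exprS.
exact: cvg_coefM.
Qed.

(** Continuity of the substitution. A weight and a bound common to the whole sequence provide the
    majorant for [dsum_dominated]. *)
Lemma ev_cvg rho a (P_ Q_ : nat -> {poly C}) P Q t B j :
  converges_on rho a -> 0 < t -> 0 <= B < rho ->
  (forall m, wnorm t (P_ m) <= B) -> (forall m, wnorm t (Q_ m) <= B) ->
  (forall i, (P_ m)`_i @[m --> \oo] --> P`_i) ->
  (forall i, (Q_ m)`_i @[m --> \oo] --> Q`_i) ->
  ev a (P_ m) (Q_ m) j @[m --> \oo] --> ev a P Q j.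
Proof.
move=> a_rho t0 /andP[B0 Br] PB QB PP QQ.
have [B' BB' B'r] : exists2 B', B < B' & B' < rho.
  exists ((B + rho) / 2).
    by rewrite ltr_pdivlMr // mulr_natr mulr2n ltrD2l.
  by rewrite ltr_pdivrMr // mulr_natr mulr2n ltrD2r.
have B'0 : 0 < B' by apply: le_lt_trans BB'.
have [M aM] : exists M, forall i j, `|a i j| * B' ^+ (i + j) <= M.
  by apply: a_rho; rewrite B'0.
apply: (@dsum_dominated _ hC _ _ (M / t ^+ j) (B / B')).
- by rewrite divr_ge0 ?(ltW B'0) //= ltr_pdivrMr // mul1r.
- by move=> m; apply: ev_bound.
- move=> p q; apply: cvgM; first exact: cvg_cst.
  by apply: cvg_coefM; apply: cvg_coefX.
Qed.

Lemma ev0 P Q j : ev 0 P Q j = 0.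
Proof. by apply: dsum0 => p q; rewrite cps0E mul0r. Qed.

Lemma ev1 P Q j : ev 1 P Q j = (j == 0%N)%:R.
Proof.
apply: dsum_lim; apply: cvg_near_cst; exists 1%N => // N /= N0.
rewrite /dpart -(prednK N0) big_ord_recl big_ord_recl big1 => [|i _]; last first.
  by rewrite /= mul0r.
rewrite big1 => [|i _]; last by rewrite big1 // => k _; rewrite /= mul0r.
by rewrite !addr0 /= !expr0 !mul1r coef1.
Qed.

Section Polydisc.
Variables (rho : C) (P Q : {poly C}).
Hypotheses (P0 : `|P`_0| < rho) (Q0 : `|Q`_0| < rho).

Lemma evB a b j : converges_on rho a -> converges_on rho b ->
  ev (a - b) P Q j = ev a P Q j - ev b P Q j.
Proof.
move=> ha hb.
have ga := ev_geo j ha P0 Q0; have gb := ev_geo j hb P0 Q0.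
have <- : -1 * ev b P Q j = - ev b P Q j by rewrite mulN1r.
have <- := dsumZ hC (-1) gb; have <- := dsumD hC ga (geoZ (-1) gb).
by apply: eq_dsum => p q; rewrite cpsD cpsN mulrDl mulNr mulN1r.
Qed.

Lemma evM a b j : converges_on rho a -> converges_on rho b ->
  ev (a * b) P Q j = \sum_(i < j.+1) ev a P Q i * ev b P Q (j - i)%N.
Proof.
move=> ha hb.
have ga i := ev_geo i ha P0 Q0; have gb i := ev_geo i hb P0 Q0.
transitivity (\sum_(i < j.+1) dsum (dconv (fun p q => a p q * (P ^+ p * Q ^+ q)`_i)
    (fun p q => b p q * (P ^+ p * Q ^+ q)`_(j - i)%N))); last first.
  by apply: eq_bigr => i _; exact: dsumM.
rewrite -(dsum_sum hC) => [|i]; last exact: geo_conv.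
apply: eq_dsum => p q; rewrite cpsM /dconv mulr_suml exchange_big /=.
apply: eq_bigr => k _; rewrite mulr_suml exchange_big /=; apply: eq_bigr => l _.
have -> : P ^+ p * Q ^+ q = (P ^+ k * Q ^+ l) * (P ^+ (p - k) * Q ^+ (q - l)).
  by rewrite mulrACA -!exprD !subnKC // -ltnS.
by rewrite coefM mulr_sumr; apply: eq_bigr => i _; rewrite mulrACA.
Qed.

End Polydisc.

End Evaluation.

(** * Congruence of polynomials modulo a power of the variable *)

Section Congruence.
Variables (A : comNzRingType) (N : nat).
Implicit Types p q : {poly A}.

Definition eqm p q := forall j, (j < N)%N -> p`_j = q`_j.

Lemma eqm_trans q p r : eqm p q -> eqm q r -> eqm p r.
Proof. by move=> pq qr j jN; rewrite pq ?qr. Qed.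

Lemma eqmB p p' q q' : eqm p p' -> eqm q q' -> eqm (p - q) (p' - q').
Proof. by move=> pp' qq' j jN; rewrite !coefB pp' ?qq'. Qed.

Lemma eqmM p p' q q' : eqm p p' -> eqm q q' -> eqm (p * q) (p' * q').
Proof.
move=> pp' qq' j jN; rewrite !coefM; apply: eq_bigr => i _.
have ij : (i <= j)%N by rewrite -ltnS.
by rewrite pp' ?qq' //; [exact: leq_ltn_trans (leq_subr _ _) jN|exact: leq_ltn_trans jN].
Qed.

Lemma eqmX p q k : eqm p q -> eqm (p ^+ k) (q ^+ k).
Proof. by move=> pq; elim: k => [|k IHk] //; rewrite !exprS; exact: eqmM. Qed.

Lemma eqm_sum (I : Type) (s : seq I) (p q : I -> {poly A}) :
  (forall i, eqm (p i) (q i)) -> eqm (\sum_(i <- s) p i) (\sum_(i <- s) q i).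
Proof. by move=> pq j jN; rewrite !coef_sum; apply: eq_bigr => i _; rewrite pq. Qed.

End Congruence.

Section PolynomialEvaluation.
Variable C : numClosedFieldType.
Hypothesis hC : geo_complete C.
Variables (N : nat) (rho : C) (P Q : {poly C}).
Hypotheses (P0 : `|P`_0| < rho) (Q0 : `|Q`_0| < rho).
Implicit Types (a b : cps C) (p : {poly cps C}) (z : {poly C}).

Definition evp a : {poly C} := \poly_(j < N) ev a P Q j.

Lemma evpB a b : converges_on rho a -> converges_on rho b ->
  eqm N (evp (a - b)) (evp a - evp b).
Proof. by move=> ha hb j jN; rewrite coefB !coef_poly jN (evB hC P0 Q0). Qed.

Lemma evpM a b : converges_on rho a -> converges_on rho b ->
  eqm N (evp (a * b)) (evp a * evp b).
Proof.
move=> ha hb j jN; rewrite coefM coef_poly jN (evM hC P0 Q0) //.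
apply: eq_bigr => i _; have ij : (i <= j)%N by rewrite -ltnS.
by rewrite !coef_poly (leq_ltn_trans ij jN) (leq_ltn_trans (leq_subr _ _) jN).
Qed.

Definition eval_poly p z := \sum_(k < size p) evp p`_k * z ^+ k.

Lemma evp0 : evp 0 = 0.
Proof. by apply/polyP => j; rewrite coef_poly coef0 ev0; case: ifP. Qed.

Lemma eval_poly_wide d p z : (size p <= d)%N ->
  eval_poly p z = \sum_(k < d) evp p`_k * z ^+ k.
Proof.
move=> sd; rewrite /eval_poly (big_ord_widen d (fun k => evp p`_k * z ^+ k)) //.
rewrite big_mkcond; apply: eq_bigr => k _; case: ltnP => // sk.
by rewrite nth_default // evp0 mul0r.
Qed.

Lemma eval_polyXsubC_mul a p z : converges_on rho a ->
  (forall k, converges_on rho p`_k) ->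
  eqm N (eval_poly (('X - a%:P) * p) z) ((z - evp a) * eval_poly p z).
Proof.
move=> ha hp.
have sX : (size (('X - a%:P) * p)%R <= (size p).+1)%N.
  by rewrite (leq_trans (size_polyMleq _ _)) // size_XsubC.
rewrite (eval_poly_wide _ sX) [X in eqm _ _ X]mulrBl.
apply: (@eqm_trans _ _ (\sum_(k < (size p).+1)
    (evp ('X * p)`_k * z ^+ k - evp a * (evp p`_k * z ^+ k)))).
  apply: eqm_sum => k.
  rewrite [X in eqm _ _ X](_ : _ = (evp ('X * p)`_k - evp a * evp p`_k) * z ^+ k); last first.
    by rewrite mulrBl mulrA.
  apply: eqmM => //; rewrite mulrBl coefB coefCM.
  have hX : converges_on rho ('X * p)`_k.
    by rewrite coefXM; case: ifP => _; [exact: converges_on0|exact: hp].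
  apply: (eqm_trans (evpB hX (converges_onM ha (hp k)))).
  by apply: eqmB => //; exact: evpM.
rewrite sumrB; apply: eqmB.
  rewrite big_ord_recl coefXM eqxx evp0 mul0r add0r /eval_poly mulr_sumr.
  by apply: eqm_sum => k; rewrite coefXM /= mulrCA -exprS.
by rewrite -mulr_sumr -eval_poly_wide.
Qed.

(** The convergence of the coefficients is proved along with the congruence: the induction needs it,
    and for the product over the roots it gives the convergence of the coefficients of f. *)
Lemma eval_poly_prod (s : seq (cps C)) z : (forall a, a \in s -> converges_on rho a) ->
  eqm N (eval_poly (\prod_(a <- s) ('X - a%:P)) z) (\prod_(a <- s) (z - evp a)) /\
  forall k, converges_on rho (\prod_(a <- s) ('X - a%:P))`_k.
Proof.
elim: s => [_|a s IHs has].
  rewrite !big_nil; split => [|k]; last first.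
    by rewrite coef1; case: k => [|k]; [exact: converges_on1|exact: converges_on0].
  rewrite /eval_poly size_poly1 big_ord1 coef1 expr0 mulr1 => j jN.
  by rewrite coef_poly jN ev1 coef1.
have ha : converges_on rho a by apply: has; rewrite mem_head.
have [|IH1 IH2] := IHs; first by move=> b bs; apply: has; rewrite inE bs orbT.
rewrite !big_cons; split => [|k].
  apply: eqm_trans (eval_polyXsubC_mul z ha IH2) _.
  by apply: eqmM.
rewrite mulrBl coefB coefCM coefXM; apply: converges_onD.
  by case: ifP => _; [exact: converges_on0|exact: IH2].
by apply: converges_onN; apply: converges_onM.
Qed.

End PolynomialEvaluation.

Local Close Scope classical_set_scope.

(** * The conjugates of the branch *)

(** One root is divided out at a time; another root stays a root of the quotient since the
    differences of distinct roots are not zero divisors. *)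
Lemma uniq_roots_factor (A : comNzRingType) :
  (forall a b : A, a * b = 0 -> a = 0 \/ b = 0) ->
  forall (p : {poly A}) (rs : seq A), uniq rs -> all (root p) rs ->
  exists q, p = q * \prod_(z <- rs) ('X - z%:P).
Proof.
move=> nzd p; elim=> [_ _|z rs IHrs /= /andP[z_rs rs_uniq] /andP[pz prs]].
  by exists p; rewrite big_nil mulr1.
have [q pE] := IHrs rs_uniq prs.
have /factor_theorem[q' qE] : root q z.
  apply/rootP; move/rootP: pz; rewrite pE hornerM => /nzd[//|].
  rewrite horner_prod; elim: rs z_rs {IHrs rs_uniq prs pE} => [|y rs IHrs].
    by rewrite big_nil => _ /eqP; rewrite oner_eq0.
  rewrite inE negb_or big_cons => /andP[zy zrs] /nzd[|/IHrs]; last exact.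
  by rewrite hornerXsubC => /subr0_eq zyE; rewrite zyE eqxx in zy.
by exists q'; rewrite big_cons pE qE mulrA.
Qed.

Section CpsDomain.
Variable C : numClosedFieldType.
Implicit Types a b : cps C.

(** The lexicographically smallest exponent of [a]. Initial coefficients for this order multiply,
    whence [cps_nzd]. *)
Lemma cps_lead a : a <> 0 -> exists p q, [/\ a p q != 0,
  forall i j, (i < p)%N -> a i j = 0 & forall j, (j < q)%N -> a p j = 0].
Proof.
move=> a0.
have ex1 : exists p, `[< exists q, a p q != 0 >].
  apply: contrapT => /forallNP a_0; apply: a0; apply: cpsP => i j.
  by apply/eqP; apply: contrapT => /negP aij; apply: (a_0 i); apply/asboolP; exists j.
have [p /asboolP exq p_min] := ex_minnP ex1.
have [q aq q_min] := ex_minnP exq.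
exists p, q; split => // [i j ip|j jq]; apply/eqP; apply: contraTT isT => aij.
  by have := p_min i; rewrite leqNgt ip => H; apply: H; apply/asboolP; exists j.
by have := q_min j aij; rewrite leqNgt jq.
Qed.

Lemma cps_nzd a b : a * b = 0 -> a = 0 \/ b = 0.
Proof.
move=> ab; apply: contrapT => /not_orP[/cps_lead[p [q [a_pq a1 a2]]]].
move=> /cps_lead[p' [q' [b_pq b1 b2]]].
have /(congr1 (fun c : cps C => c (p + p')%N (q + q')%N)) := ab.
rewrite cpsM cps0E /dconv.
have p1 : (p < (p + p').+1)%N by rewrite ltnS leq_addr.
have q1 : (q < (q + q').+1)%N by rewrite ltnS leq_addr.
rewrite (bigD1 (Ordinal p1)) //= (bigD1 (Ordinal q1)) //= !addKn.
rewrite big1 ?addr0 => [|j /eqP jq]; last first.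
  have [|qj] := ltnP j q; first by move=> /a2->; rewrite mul0r.
  rewrite b2 ?mulr0 //.
  have : nat_of_ord j != q by apply/eqP => jE; apply: jq; apply: val_inj.
  by case: j {jq} qj => j /= ? ? ?; lia.
rewrite big1 ?addr0 => [|i /eqP ip]; last first.
  apply: big1 => j _; have [|pi] := ltnP i p; first by move=> /a1->; rewrite mul0r.
  rewrite b1 ?mulr0 //.
  have : nat_of_ord i != p by apply/eqP => iE; apply: ip; apply: val_inj.
  by case: i {ip} pi => i /= ? ? ?; lia.
by move/eqP; rewrite mulf_eq0 (negbTE a_pq) (negbTE b_pq).
Qed.

End CpsDomain.

(** * The embedding of C{x_1, x_2} into C{u_1, u_2} *)

Section Ramification.
Variables (C : numClosedFieldType) (n' : nat).
Local Notation n := n'.+1.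
Implicit Types a b : cps C.

Lemma sum_dvdn (V : nmodType) (F : nat -> V) i :
  \sum_(k < (n * i).+1) (if (n %| k)%N then F (k %/ n)%N else 0) = \sum_(k < i.+1) F k.
Proof.
elim: i => [|i IHi]; first by rewrite muln0 !big_ord1 dvdn0 div0n.
rewrite [RHS]big_ord_recr -IHi /=.
rewrite -!(big_mkord xpredT (fun k => if (n %| k)%N then F (k %/ n)%N else 0)).
rewrite (big_cat_nat (n := (n * i).+1)) //=; last by lia.
congr (_ + _); rewrite (_ : (n * i.+1).+1 = ((n * i) + n).+1); last by lia.
rewrite big_nat_recr /=; last by lia.
rewrite -mulnSr dvdn_mulr // mulKn // big_nat_cond big1 ?add0r // => k.
rewrite andbT => /andP[k1 k2]; case: ifP => // /dvdnP[l lE].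
by move: k1 k2; rewrite lE [(l * n)%N]mulnC !ltn_mul2l /= leqNgt => /negbTE->.
Qed.

Lemma ramifyE a p q : ramify n a p q =
  if (n %| p)%N && (n %| q)%N then a (p %/ n)%N (q %/ n)%N else 0.
Proof. by []. Qed.

Lemma ramify_mul a p q : ramify n a (n * p) (n * q) = a p q.
Proof. by rewrite ramifyE !dvdn_mulr // !mulKn. Qed.

Lemma ramify_inj : injective (@ramify C n).
Proof. by move=> a b ab; apply: cpsP => p q; rewrite -(ramify_mul a) ab ramify_mul. Qed.

Lemma ramify_is_additive : GRing.zmod_morphism (@ramify C n).
Proof.
move=> a b; apply: cpsP => p q; rewrite cpsD cpsN !ramifyE.
by case: ifP => _; rewrite ?subr0.
Qed.

Lemma ramify_is_multiplicative : GRing.monoid_morphism (@ramify C n).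
Proof.
split=> [|a b].
  apply: cpsP => p q; rewrite ramifyE !cps1E.
  case: ifP => [/andP[/dvdnP[k ->] /dvdnP[l ->]]|/negbT].
    by rewrite !mulnK // !muln_eq0 /= !orbF.
  by case: p => [|p]; case: q => [|q].
apply: cpsP => p q; rewrite cpsM /dconv.
transitivity (\sum_(k < p.+1) \sum_(l < q.+1)
  (if (n %| p)%N && (n %| q)%N && (n %| k)%N && (n %| l)%N
   then a (k %/ n)%N (l %/ n)%N * b ((p %/ n) - (k %/ n))%N ((q %/ n) - (l %/ n))%N
   else 0)); last first.
  apply: eq_bigr => -[k kp] _; apply: eq_bigr => -[l lq] _; rewrite /= /ramify_coef.
  have [nk|] := boolP (n %| k)%N; last by rewrite andbF /= mul0r.
  have [nl|] := boolP (n %| l)%N; last by rewrite !andbF /= mul0r.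
  rewrite !andbT /= !dvdn_subl //.
  by case: ifP => [/andP[np nq]|]; rewrite ?mulr0 // !divnBr.
rewrite ramifyE; case: ifP => [/andP[/dvdnP[i ->] /dvdnP[j ->]]|_] /=; last first.
  by rewrite big1 // => k _; rewrite big1.
rewrite !mulnK // /conv_coef ![(_ * n)%N]mulnC.
rewrite -(sum_dvdn (fun k => \sum_(l < j.+1) a k l * b (i - k)%N (j - l)%N)).
apply: eq_bigr => k _; case: ifP => _ /=; last by rewrite big1.
exact/esym/(sum_dvdn (fun l => a (k %/ n)%N l * b (i - k %/ n)%N (j - l)%N)).
Qed.

HB.instance Definition _ := GRing.isZmodMorphism.Build (cps C) (cps C)
  (@ramify C n) ramify_is_additive.
HB.instance Definition _ := GRing.isMonoidMorphism.Build (cps C) (cps C)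
  (@ramify C n) ramify_is_multiplicative.

Lemma contract_bounded a : geom_bounded (fun i j => a (n * i)%N (n * j)%N).
Proof.
have [M [K [M0 K0 aMK]]] := coefs_bounded a.
exists M, (K ^+ n); split => // [|i j]; first exact: exprn_ge0.
by rewrite -exprM mulnDr.
Qed.
Definition contract a := CPS (contract_bounded a).

End Ramification.

(** * The action of (Z/n)^2 by roots of unity and the factorization of f *)

Section Conjugates.
Variables (C : numClosedFieldType) (n' : nat) (omega : C).
Local Notation n := n'.+1.
Local Notation T := ('I_n'.+1 * 'I_n'.+1)%type.
Hypothesis omega_prim : n.-primitive_root omega.
Implicit Types (a b : cps C) (s t : T).

(** The factor by which u_i |-> omega^(s_i) u_i multiplies u_1^p u_2^q. *)
Definition chi s p q : C := omega ^+ (s.1 * p + s.2 * q).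

Lemma chi_norm s p q : `|chi s p q| = 1.
Proof.
have w1 : `|omega| = 1.
  apply/eqP; rewrite -(@pexpr_eq1 _ _ n) // -normrX (prim_expr_order omega_prim).
  by rewrite normr1.
by rewrite normrX w1 expr1n.
Qed.

Lemma omega_mod k l : k = l %[mod n] -> omega ^+ k = omega ^+ l.
Proof. by move=> kl; rewrite -(prim_expr_mod omega_prim) kl (prim_expr_mod omega_prim). Qed.

Lemma chiD s t p q : chi (s + t) p q = chi s p q * chi t p q.
Proof.
have H x y z : omega ^+ (((x + y) %% n) * z) = omega ^+ (x * z) * omega ^+ (y * z).
  by rewrite -exprD -mulnDl; apply: omega_mod; rewrite modnMml.
by rewrite /chi !exprD /= !H mulrACA.
Qed.

Lemma chi0 p q : chi 0 p q = 1.
Proof. by rewrite /chi /= !mul0n expr0. Qed.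

Lemma chi_add s p q p' q' : chi s (p + p') (q + q') = chi s p q * chi s p' q'.
Proof. by rewrite -exprD; congr (_ ^+ _); lia. Qed.

Lemma chi_dvd s p q : (n %| p)%N -> (n %| q)%N -> chi s p q = 1.
Proof.
move=> np nq; rewrite /chi -(prim_expr_mod omega_prim).
by rewrite (eqP (dvdn_add (dvdn_mull s.1 np) (dvdn_mull s.2 nq))) expr0.
Qed.

Lemma chi_trivial p q : (forall s, chi s p q = 1) -> (n %| p)%N && (n %| q)%N.
Proof.
move=> chi1; have [n1|n_gt1] := leqP n 1.
  by move: n1; rewrite ltnS leqn0 => /eqP->; rewrite !dvd1n.
apply/andP; split; rewrite (prim_order_dvd omega_prim); apply/eqP.
  by have := chi1 (inord 1, 0); rewrite /chi /= inordK // mul1n mul0n addn0.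
by have := chi1 (0, inord 1); rewrite /chi /= inordK // mul1n mul0n add0n.
Qed.

Lemma conjugate_bounded s a : geom_bounded (fun p q => a p q * chi s p q).
Proof.
have [M [K [M0 K0 aMK]]] := coefs_bounded a.
by exists M, K; split => // p q; rewrite normrM chi_norm mulr1.
Qed.
Definition conjugate s a := CPS (conjugate_bounded s a).

Lemma conjugateE s a p q : conjugate s a p q = a p q * chi s p q.
Proof. by []. Qed.

Lemma conjugate_is_additive s : GRing.zmod_morphism (conjugate s).
Proof. by move=> a b; apply: cpsP => p q; rewrite cpsD cpsN !conjugateE mulrBl. Qed.

Lemma conjugate_is_multiplicative s : GRing.monoid_morphism (conjugate s).
Proof.
split=> [|a b]; apply: cpsP => p q; rewrite !conjugateE.
  rewrite !cps1E; case: eqP => [->|_]; last by rewrite mul0r.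
  by case: eqP => [->|_]; rewrite ?mul0r // /chi !muln0 expr0 mulr1.
rewrite !cpsM /dconv mulr_suml; apply: eq_bigr => -[k /= kp] _.
rewrite mulr_suml; apply: eq_bigr => -[l /= lq] _.
by rewrite mulrACA -chi_add !subnKC.
Qed.

HB.instance Definition _ s := GRing.isZmodMorphism.Build (cps C) (cps C)
  (conjugate s) (conjugate_is_additive s).
HB.instance Definition _ s := GRing.isMonoidMorphism.Build (cps C) (cps C)
  (conjugate s) (conjugate_is_multiplicative s).

Lemma conjugateD s t a : conjugate (s + t) a = conjugate s (conjugate t a).
Proof. by apply: cpsP => p q; rewrite !conjugateE chiD; ring. Qed.

Lemma conjugate0 a : conjugate 0 a = a.
Proof. by apply: cpsP => p q; rewrite conjugateE chi0 mulr1. Qed.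

Lemma conjugate_inj s : injective (conjugate s).
Proof.
by move=> a b ab; rewrite -(conjugate0 a) -(conjugate0 b) -(addNr s) !conjugateD ab.
Qed.

Lemma conjugate_ramify s a : conjugate s (ramify n a) = ramify n a.
Proof.
apply: cpsP => p q; rewrite conjugateE ramifyE; case: ifP => [/andP[np nq]|_].
  by rewrite chi_dvd // mulr1.
by rewrite mul0r.
Qed.

(** Every character is 1 at an exponent of an invariant series, so both of its entries are divisible
    by n: the invariants are the series in x_1, x_2. *)
Lemma contractK a : (forall s, conjugate s a = a) -> ramify n (contract n' a) = a.
Proof.
move=> a_inv; apply: cpsP => p q; rewrite ramifyE; case: ifP => [/andP[np nq]|/negP npq].
  by rewrite /= ![(n * _)%N]mulnC !divnK.
apply/eqP; rewrite eq_sym; apply: contrapT => /negP apq; apply: npq; apply: chi_trivial => s.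
apply: (mulfI apq); rewrite mulr1 -conjugateE a_inv //.
Qed.

(** Duplicates have to be removed: n^2 conjugations act, and several of them can give the same
    series. *)
Definition conj_roots a : seq (cps C) := undup [seq conjugate s a | s <- enum {: T}].

Lemma conj_rootsP a b : reflect (exists s, b = conjugate s a) (b \in conj_roots a).
Proof.
rewrite mem_undup; apply: (iffP mapP) => [[s _ ->]|[s ->]]; first by exists s.
by exists s; rewrite ?mem_enum.
Qed.

Lemma conj_roots_perm s a : perm_eq [seq conjugate s b | b <- conj_roots a] (conj_roots a).
Proof.
apply: uniq_perm => [||b]; rewrite ?undup_uniq //.
  by rewrite map_inj_uniq ?undup_uniq //; exact: conjugate_inj.
apply/mapP/conj_rootsP => [[c /conj_rootsP[t ->] ->]|[t ->]].
  by exists (s + t); rewrite conjugateD.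
exists (conjugate (t - s) a); first by apply/conj_rootsP; exists (t - s).
by rewrite -conjugateD addrC subrK.
Qed.

Lemma monic_mul_inj (A : comNzRingType) (p q r : {poly A}) :
  p \is monic -> q * p = r * p -> q = r.
Proof. by move=> /monic_rreg p_reg /p_reg. Qed.

Lemma monic_not_unit (A : comNzRingType) (p : {poly A}) :
  p \is monic -> (1 < size p)%N -> ~ is_unit p.
Proof.
move=> p_mon p1 [b pb1].
have b0 : b != 0 by apply/eqP => b0; move/eqP: pb1; rewrite b0 mulr0 eq_sym oner_eq0.
have := size_monicM p_mon b0; rewrite pb1 size_poly1.
by move: p1 (b0); rewrite -size_poly_gt0; lia.
Qed.

(** Galois descent. Every conjugate of zeta is a root of f, so f = Q P with P the product over the
    orbit. Both factors are invariant, hence have coefficients in C{x_1, x_2}, and irreducibility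
    forces the monic Q to be 1. The degree then counts the orbit. *)
Theorem branch_factorization (f : {poly cps C}) (zeta : cps C) :
  f \is monic -> size f = n.+1 -> irreducible_elt f -> is_branch n f zeta ->
  map_poly (@ramify C n) f = \prod_(b <- conj_roots zeta) ('X - b%:P) /\
  size (conj_roots zeta) = n.
Proof.
move=> f_mon f_size [f0 f_unit f_irr] f_zeta.
set F := map_poly (@ramify C n) f.
set P := \prod_(b <- conj_roots zeta) ('X - b%:P).
have F_inv s : map_poly (conjugate s) F = F.
  by rewrite /F -map_poly_comp; apply: eq_map_poly => a /=; rewrite conjugate_ramify.
have P_inv s : map_poly (conjugate s) P = P.
  rewrite /P rmorph_prod /= -[RHS](perm_big _ (conj_roots_perm s zeta)) big_map.
  by apply: eq_bigr => b _; rewrite rmorphB /= map_polyX map_polyC.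
have P_mon : P \is monic by exact: monic_prod_XsubC.
have P_size : size P = (size (conj_roots zeta)).+1 by rewrite size_prod_XsubC.
have F_roots : all (root F) (conj_roots zeta).
  apply/allP => b /conj_rootsP[s ->]; apply/rootP; rewrite -(F_inv s) horner_map.
  by rewrite (rootP f_zeta) rmorph0.
have [Q QE'] := uniq_roots_factor (@cps_nzd C) (undup_uniq _) F_roots.
have QE : F = Q * P := QE'.
have Q_inv s : map_poly (conjugate s) Q = Q.
  apply: (monic_mul_inj P_mon); rewrite -QE -[in LHS](P_inv s) -rmorphM /= -QE.
  exact: F_inv.
have lift (q : {poly cps C}) : (forall s, map_poly (conjugate s) q = q) ->
    exists q0, q = map_poly (@ramify C n) q0.
  move=> q_inv; exists (\poly_(i < size q) contract n' q`_i); apply/polyP => i.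
  rewrite coef_map coef_poly /=; case: ltnP => [_|/(nth_default 0)->]; last by rewrite rmorph0.
  by rewrite contractK // => s; rewrite -{2}(q_inv s) coef_map.
have [P0 P0E] := lift _ P_inv; have [Q0 Q0E] := lift _ Q_inv.
have size_map (q : {poly cps C}) : size (map_poly (@ramify C n) q) = size q.
  by apply: size_map_inj_poly; [exact: ramify_inj|rewrite rmorph0].
have mon_map (q : {poly cps C}) : map_poly (@ramify C n) q \is monic -> q \is monic.
  rewrite !monicE /lead_coef size_map coef_map /= => /eqP q1; apply/eqP.
  by apply: (@ramify_inj _ n'); rewrite q1 rmorph1.
have fE : f = Q0 * P0.
  apply: (map_inj_poly (@ramify_inj C n')); first exact: rmorph0.
  by rewrite -/F QE P0E Q0E rmorphM.
have P0_mon : P0 \is monic by apply: mon_map; rewrite -P0E.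
have Q0_mon : Q0 \is monic by have := f_mon; rewrite fE monicMr.
have Q0_unit : is_unit Q0.
  have [//|P0_unit] := f_irr _ _ fE.
  case: (monic_not_unit P0_mon _ P0_unit).
  rewrite -size_map -P0E P_size ltnS lt0n size_eq0; apply/eqP => roots0.
  by have : zeta \in conj_roots zeta;
    [apply/conj_rootsP; exists 0; rewrite conjugate0|rewrite roots0].
have Q1 : Q0 = 1.
  have [Q_gt1|] := ltnP 1 (size Q0); first by case: (monic_not_unit Q0_mon Q_gt1).
  by move=> /size1_polyC QC; move: Q0_mon; rewrite monicE QC lead_coefC => /eqP->.
have FP : F = P by rewrite /F fE Q1 mul1r -P0E.
split; first exact: FP.
by apply: succn_inj; rewrite -P_size -FP size_map.
Qed.

End Conjugates.

(** * The lattices M_j and their annihilators *)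

(** Converts sums over all conjugations into sums over the distinct roots, and sums over a finite
    group into sums over its cosets. *)
Lemma sum_undup_const (U : eqType) (s : seq U) (k : nat) (F : U -> nat) :
  (forall u, u \in s -> count_mem u s = k) ->
  (\sum_(u <- s) F u = k * \sum_(u <- undup s) F u)%N.
Proof.
move=> sk; rewrite -big_undup_iterop_count big_distrr /= big_seq [RHS]big_seq.
apply: eq_bigr => u; rewrite mem_undup => /sk->.
by rewrite Monoid.iteropE iter_addn addn0 mulnC.
Qed.

Lemma mulr_pair (U V : zmodType) (y : U * V) (k : int) : y *~ k = (y.1 *~ k, y.2 *~ k).
Proof.
have natE (i : nat) : y *+ i = (y.1 *+ i, y.2 *+ i).
  by case: y => y1 y2 /=; elim: i => // i IHi; rewrite !mulrS IHi.
by case: k => i; rewrite /intmul natE.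
Qed.

Section Lattice.
Variable lam : nat -> rat * rat.

Lemma latM0P (v : rat * rat) :
  latM lam 0 v <-> v.1 \is a Num.int /\ v.2 \is a Num.int.
Proof. by split=> [/andP|] []; [|move=> *; apply/andP]. Qed.

Lemma latM_step j v : latM lam j v -> latM lam j.+1 v.
Proof. by move=> Mv; exists v => //; exists 0; rewrite mulr0z addr0. Qed.

Lemma latM_le i j v : (i <= j)%N -> latM lam i v -> latM lam j v.
Proof.
by move=> /subnK <-; elim: (j - i)%N => // k IHk Mv; apply: latM_step; exact: IHk.
Qed.

Lemma latM_sub j v w : latM lam j v -> latM lam j w -> latM lam j (v - w).
Proof.
elim: j v w => [|j IHj] v w.
  by move=> /latM0P[v1 v2] /latM0P[w1 w2]; apply/latM0P; rewrite !rpredB.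
move=> [v' Mv' [c ->]] [w' Mw' [d ->]]; exists (v' - w'); first exact: IHj.
by exists (c - d); rewrite mulrzBr opprD addrACA.
Qed.

Lemma latM_zero j : latM lam j 0.
Proof. by apply: (@latM_le 0) => //; apply/latM0P. Qed.

Lemma latM_opp j v : latM lam j v -> latM lam j (- v).
Proof. by rewrite -sub0r => Mv; apply: latM_sub => //; exact: latM_zero. Qed.

Lemma latM_add j v w : latM lam j v -> latM lam j w -> latM lam j (v + w).
Proof. by move=> Mv /latM_opp Mw; rewrite -(opprK w); exact: latM_sub. Qed.

Lemma latM_trans j u v w : latM lam j (u - v) -> latM lam j (v - w) -> latM lam j (u - w).
Proof. by move=> uv vw; rewrite -(subrKA v); exact: latM_add. Qed.

Lemma latM_sym j v w : latM lam j (v - w) -> latM lam j (w - v).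
Proof. by rewrite -(opprB w v) => /latM_opp; rewrite opprK. Qed.

Lemma latM_coset j v w : latM lam j (v - w) ->
  [set u | latM lam j (u - v)]%classic = [set u | latM lam j (u - w)]%classic.
Proof.
move=> vw; apply/seteqP; split => u /= uv; first exact: latM_trans vw.
exact: latM_trans (latM_sym vw).
Qed.

End Lattice.

(** * Characters of (Z/n)^2 and the annihilators of the lattices M_j *)

Section Characters.
Variables (C : numClosedFieldType) (n' : nat) (omega : C).
Local Notation n := n'.+1.
Local Notation T := ('I_n'.+1 * 'I_n'.+1)%type.
Hypothesis omega_prim : n.-primitive_root omega.
Implicit Types (s t h : T).

Local Notation cc s h := (chi omega s h.1 h.2).

Lemma chi_sym s h : cc s h = cc h s.
Proof. by rewrite /chi; congr (_ ^+ _); rewrite ![(s.1 * _)%N]mulnC ![(s.2 * _)%N]mulnC. Qed.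

Lemma chiDr s h k : cc s (h + k) = cc s h * cc s k.
Proof. by rewrite (chi_sym s (h + k)) (chiD omega_prim h k) (chi_sym s h) (chi_sym s k). Qed.

(** If the character is not 1 at some k in H, translation by k multiplies the sum by a factor
    different from 1 while permuting its terms, so the sum vanishes. *)
Lemma sum_chi (H : {set T}) s : (forall h k, h \in H -> k \in H -> h - k \in H) ->
  \sum_(h in H) cc s h = if [forall h in H, cc s h == 1] then #|H|%:R else 0.
Proof.
move=> H_sub; case: ifP => [/'forall_implyP /= all1|/negbT].
  by rewrite (eq_bigr (fun => 1)) ?sumr_const // => h /all1/eqP.
rewrite negb_forall => /existsP[k]; rewrite negb_imply => /andP[kH k1].
have H0 : 0 \in H by rewrite -(subrr k) H_sub.
have H_add h : (h + k \in H) = (h \in H).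
  apply/idP/idP => hk; first by rewrite -(addrK k h) H_sub.
  by rewrite -[k]opprK H_sub // -sub0r H_sub.
have E : \sum_(h in H) cc s h = cc s k * \sum_(h in H) cc s h.
  rewrite [LHS](reindex_inj (addIr k)) /= mulr_sumr; apply: eq_big => h; first exact: H_add.
  by move=> _; rewrite [RHS]mulrC; exact: chiDr.
apply/eqP; have /eqP := E; rewrite -subr_eq0 -[X in X - _]mul1r -mulrBl mulf_eq0.
by rewrite subr_eq0 eq_sym (negbTE k1).
Qed.

Definition annihilator (H : {set T}) := [set s : T | [forall h in H, cc s h == 1]].

(** Double counting of the sum of all chi_s(h), s in (Z/n)^2 and h in H: summing over h first leaves
    |H| for each s in the annihilator, summing over s first leaves n^2 from h = 0. *)
Lemma card_annihilator (H : {set T}) :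
  0 \in H -> (forall h k, h \in H -> k \in H -> h - k \in H) ->
  (#|annihilator H| * #|H| = n * n)%N.
Proof.
move=> H0 H_sub; apply/eqP; rewrite -(eqr_nat C); apply/eqP.
transitivity (\sum_(s : T) \sum_(h in H) cc s h).
  rewrite (eq_bigr _ (fun s _ => sum_chi s H_sub)) -big_mkcond /=.
  rewrite (eq_bigl (fun s => s \in annihilator H)); last by move=> s; rewrite inE.
  by rewrite sumr_const natrM mulr_natl.
rewrite exchange_big /= (bigD1 (0 : T)) //= [X in _ + X]big1 ?addr0.
  rewrite (eq_bigr (fun => 1)) => [|s _]; last by rewrite /chi /= !muln0 expr0.
  by rewrite sumr_const card_prod !card_ord.
move=> h /andP[_ h0]; rewrite (eq_bigr (fun s => cc h s)) => [|s _]; last exact: chi_sym.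
transitivity (\sum_(s in [set: T]) cc h s); first by apply: eq_bigl => s; rewrite inE.
rewrite sum_chi // => [|? ? _ _]; last by rewrite inE.
case: ifP => // /'forall_implyP /= all1; case/eqP: h0.
have : (n %| h.1)%N && (n %| h.2)%N.
  apply: (chi_trivial omega_prim) => s.
  by rewrite (chi_sym s h); apply/eqP/all1; rewrite inE.
case/andP; case: h {all1} => h1 h2 /= d1 d2.
have dvd0 (x : 'I_n) : (n %| x)%N -> x = 0.
  by move=> nx; apply: val_inj => /=; apply/eqP; rewrite -(modn_small (ltn_ord x)).
by rewrite (dvd0 _ d1) (dvd0 _ d2).
Qed.

Definition frac (p q : nat) : rat * rat := (p%:R / n%:R, q%:R / n%:R).

Lemma frac_int p : (p%:R / n%:R : rat) \is a Num.int = (n %| p)%N.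
Proof.
have n0 : n%:R != 0 :> rat by rewrite pnatr_eq0.
apply/idP/idP => [/intrP[z zE]|/dvdnP[k ->]]; last by rewrite natrM mulfK ?natr_int.
have : (p%:Z = z * n%:Z)%R.
  by apply: (@intr_inj rat); rewrite rmorphM /= -zE mulfVK.
by move=> pE; apply/dvdnP; exists `|z|%N; have := congr1 absz pE; rewrite abszM.
Qed.

Lemma fracD p q p' q' : frac (p + p') (q + q') = frac p q + frac p' q'.
Proof. by rewrite /frac !natrD !mulrDl. Qed.

Lemma frac_mod_aux (x : nat) : ((x %% n)%N%:R / n%:R : rat) - x%:R / n%:R \is a Num.int.
Proof.
have n0 : n%:R != 0 :> rat by rewrite pnatr_eq0.
by rewrite {2}(divn_eq x n) natrD natrM mulrDl mulfK // opprD addrCA subrr addr0 rpredN natr_int.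
Qed.

Variables (g : nat) (lam : nat -> rat * rat) (L : nat -> nat * nat).
Hypothesis lamE : forall j, (1 <= j <= g)%N -> lam j = frac (L j).1 (L j).2.

Lemma latM_frac_add h k j : latM lam j (frac (h + k).1 (h + k).2 - (frac h.1 h.2 + frac k.1 k.2)).
Proof.
apply: (@latM_le _ 0) => //; apply/latM0P; rewrite -fracD.
by split; exact: frac_mod_aux.
Qed.

(** The finite group M_j / Z^2, seen in (Z/n)^2 because M_j is contained in (1/n) Z^2 for j <= g. *)
Definition latH j : {set T} := [set h : T | `[< latM lam j (frac h.1 h.2) >]].

Lemma latHP j h : reflect (latM lam j (frac h.1 h.2)) (h \in latH j).
Proof. by rewrite inE; exact: asboolP. Qed.

Lemma latM_fracB h k j :
  latM lam j (frac (h - k).1 (h - k).2) <-> latM lam j (frac h.1 h.2 - frac k.1 k.2).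
Proof.
have := latM_frac_add (h - k) k j; rewrite subrK.
move: (frac h.1 h.2) (frac k.1 k.2) (frac (h - k).1 _) => a c b M0.
split=> [Mb|Mac].
  by rewrite (_ : a - c = a - (b + c) + b); [exact: latM_add|rewrite opprD addrA addrAC addrNK].
by rewrite (_ : b = a - c - (a - (b + c)));
  [exact: latM_sub|rewrite opprB [RHS]addrC subrKA addrK].
Qed.

Lemma latH_sub j h k : h \in latH j -> k \in latH j -> h - k \in latH j.
Proof.
by move=> /latHP Mh /latHP Mk; apply/latHP/latM_fracB; exact: latM_sub.
Qed.

Lemma latH0 j : 0 \in latH j.
Proof. by apply/latHP; rewrite /frac /= mul0r; exact: latM_zero. Qed.

Definition annA j := annihilator (latH j).

(** Modulo Z^2, every element of M_j is a combination of lambda_1, ..., lambda_j with natural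
    coefficients. An additive property of exponents thus needs to be checked on the generators
    only. *)
Lemma latM_frac_ind (Pr : nat -> nat -> Prop) j v : (j <= g)%N ->
  Pr 0 0%N -> (forall p q p' q', Pr p q -> Pr p' q' -> Pr (p + p')%N (q + q')%N) ->
  (forall i, (1 <= i <= j)%N -> Pr (L i).1 (L i).2) ->
  latM lam j v -> exists p q, Pr p q /\ latM lam 0 (v - frac p q).
Proof.
move=> jg Pr0 PrD; elim: j v jg => [|j IHj] v jg PrL.
  by move=> Mv; exists 0%N, 0%N; rewrite /frac mul0r subr0.
case=> w Mw [c ->].
have [|i /andP[i0 ij]|p [q [Ppq Mpq]]] := IHj w _ _ Mw; first exact: ltnW.
  by apply: (PrL); rewrite i0 (leq_trans ij).
(* As n lambda_(j+1) is integral, an integer coefficient may be replaced by its residue modulo n. *)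
pose c' := `|(c %% n%:Z)%Z|%N.
have cE : c = (c %/ n%:Z)%Z * n%:Z + c'%:Z.
  by rewrite /c' gez0_abs ?modz_ge0 // -divz_eq.
exists (p + c' * (L j.+1).1)%N, (q + c' * (L j.+1).2)%N; split.
  apply: (PrD) => //; elim: c' {cE} => [|k IHk]; first by rewrite !mul0n.
  by rewrite !mulSn; apply: (PrD) => //; apply: (PrL); rewrite leqnn.
rewrite fracD opprD addrACA; apply: latM_add => //.
rewrite lamE ?jg //; apply/latM0P; rewrite cE.
have n0 : n%:R != 0 :> rat by rewrite pnatr_eq0.
have X (x : nat) : (x%:R / n%:R : rat) *~ ((c %/ n%:Z)%Z * n%:Z + c'%:Z) -
    (c' * x)%N%:R / n%:R = (x%:Z * (c %/ n%:Z)%Z)%:~R.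
  rewrite mulrzDr -[_ *~ c'%:Z]pmulrn -[_ *~ (_ * _)]mulrzr -[_ *+ c']mulr_natr !intrM natrM.
  rewrite -![_%:Z%:~R]pmulrn; move: (n%:R : rat) n0 => N n0.
  by field.
by rewrite mulr_pair /= !X; split; exact: intr_int.
Qed.

Lemma latM_frac j v : (j <= g)%N -> latM lam j v ->
  exists h, latM lam 0 (v - frac h.1 h.2).
Proof.
move=> jg Mv; have [p [q [_ Mpq]]] := @latM_frac_ind (fun _ _ => True) j v jg I
  (fun _ _ _ _ _ _ => I) (fun _ _ => I) Mv.
exists (inZp p, inZp q); rewrite -(subrK (frac p q) v) -addrA; apply: latM_add => //.
by rewrite -opprB; apply: latM_opp; apply/latM0P; split; exact: frac_mod_aux.
Qed.

Lemma annAP s j p q : s \in annA j -> latM lam j (frac p q) -> chi omega s p q = 1.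
Proof.
rewrite inE => /'forall_implyP /= sA Mpq.
have /sA/eqP <- : (inZp p, inZp q) \in latH j.
  apply/latHP; rewrite -(subrK (frac p q) (frac _ _)); apply: latM_add => //.
  by apply: (@latM_le _ 0) => //; apply/latM0P; split; exact: frac_mod_aux.
have H x y : omega ^+ (x * (y %% n)) = omega ^+ (x * y).
  by apply: (omega_mod omega_prim); rewrite modnMmr.
by rewrite /chi !exprD /= !H.
Qed.

Lemma card_annA_latH j : (#|annA j| * #|latH j| = n * n)%N.
Proof. by apply: card_annihilator; [exact: latH0|move=> h k; exact: latH_sub]. Qed.

(** Dividing by Z^2 does not change the index: each coset of M_(j-1) in M_j is represented by as
    many elements of [latH j] as [latH j.-1] has. *)
Lemma ind_n_latH j : (1 <= j <= g)%N -> (ind_n lam j * #|latH j.-1| = #|latH j|)%N.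
Proof.
move=> /andP[j0 jg]; have jj : (j.-1 <= j)%N by exact: leq_pred.
pose coset h : set (rat * rat) := [set v | latM lam j.-1 (v - frac h.1 h.2)]%classic.
pose cosets := [seq coset h | h <- enum (latH j)].
have cosetP (h k : T) : coset h = coset k <-> (h - k \in latH j.-1).
  split=> [hk|/latHP/latM_fracB hk].
    apply/latHP/latM_fracB.
    have : coset h (frac h.1 h.2) by rewrite /coset /= subrr; exact: latM_zero.
    by rewrite hk.
  exact: latM_coset.
have -> : ind_n lam j = size (undup cosets).
  rewrite /ind_n /subgroup_index.
  have -> : [set [set v | latM lam j.-1 (v - w)] | w in latM lam j]%classic =
      [set` [fset c in cosets]%fset]%classic.
    apply/seteqP; split => c /=.
      move=> [w Mw <-]; rewrite in_fset; have [h Mh] := latM_frac jg Mw.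
      apply/mapP; exists h.
        rewrite mem_enum; apply/latHP; rewrite -(subrK w (frac h.1 h.2)); apply: latM_add => //.
        by rewrite -opprB; apply: latM_opp; apply: latM_le Mh.
      by apply: latM_coset; apply: latM_le Mh.
    rewrite in_fset => /mapP[h]; rewrite mem_enum => /latHP Mh ->.
    by exists (frac h.1 h.2).
  by rewrite set_fsetK card_fseq.
have cosets_count c : c \in cosets -> count_mem c cosets = #|latH j.-1|.
  move=> /mapP[h]; rewrite mem_enum => hj ->.
  rewrite count_map -sum1_count big_enum_cond /= sum1dep_card.
  rewrite -[RHS](card_imset _ (addrI h)); apply: eq_card => k.
  apply/idP/imsetP; rewrite finset.in_set.
    by move=> /andP[kj /eqP/cosetP kh]; exists (k - h); rewrite // addrC subrK.
  case=> l lj ->; apply/andP; split; last first.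
    by apply/eqP/cosetP; rewrite addrC addKr.
  have lj' : l \in latH j by apply/latHP; apply: latM_le (jj) _; apply/latHP.
  by rewrite -[l]opprK latH_sub // -sub0r latH_sub ?latH0.
have := sum_undup_const (fun=> 1%N) cosets_count.
by rewrite !sum1_size size_map -cardE mulnC => ->.
Qed.

Lemma card_annA_step j : (1 <= j <= g)%N ->
  #|annA j.-1| = (ind_n lam j * #|annA j|)%N.
Proof.
move=> jg; have := card_annA_latH j.-1; rewrite -(card_annA_latH j) -(ind_n_latH jg).
rewrite (mulnA #|annA j|) (mulnC #|annA j|) => /eqP; rewrite eqn_pmul2r; first by move/eqP.
by apply/card_gt0P; exists 0; exact: latH0.
Qed.

Lemma card_annA j : (j <= g)%N -> #|annA j| = (#|annA g| * ind_e g lam j)%N.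
Proof.
move=> jg; rewrite -(subKn jg); elim: (g - j)%N (leq_subr j g) => [|k IHk] kg.
  by rewrite subn0 /ind_e big_geq ?muln1.
have -> : (g - k.+1 = (g - k).-1)%N by lia.
rewrite card_annA_step ?IHk; [|lia..].
rewrite mulnCA; congr muln; rewrite /ind_e prednK; last by lia.
by rewrite [RHS]big_ltn //; lia.
Qed.

(** * The stabilizer of the branch *)

Section Stabilizer.
Variable zeta : cps C.
Hypothesis zeta_supp : forall p q, zeta p q != 0 -> latM lam g (frac p q).
Hypothesis zeta_L : forall j, (1 <= j <= g)%N -> zeta (L j).1 (L j).2 != 0.

(** All exponents of zeta lie in M_g, so its annihilator fixes zeta. Conversely, a conjugation
    fixing zeta has character 1 at lambda_1, ..., lambda_g, which occur in zeta and generate M_g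
    over Z^2. *)
Lemma annA_stab s : (s \in annA g) = (conjugate omega_prim s zeta == zeta).
Proof.
apply/idP/eqP => [sA|sz].
  apply: cpsP => p q; rewrite conjugateE.
  have [->|/zeta_supp Mpq] := eqVneq (zeta p q) 0; first by rewrite mul0r.
  by rewrite (annAP sA Mpq) mulr1.
rewrite inE; apply/'forall_implyP => h /= /latHP.
move=> Mh; have [||i ig|p [q [pq1 Mpq]]] :=
    @latM_frac_ind (fun p q => chi omega s p q = 1) g _ (leqnn g) _ _ _ Mh.
- by rewrite /chi !muln0 expr0.
- by move=> p q p' q' pq1 pq1'; have := chi_add omega_prim s p q p' q'; rewrite pq1 pq1' mulr1.
- by apply: (mulfI (zeta_L ig)); rewrite mulr1 -conjugateE sz.
move/latM0P: Mpq => [Mp Mq].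
have eq_mod (x y : nat) : (x%:R / n%:R : rat) - y%:R / n%:R \is a Num.int -> x = y %[mod n].
  move=> xy; apply/eqP; wlog yx : x y xy / (y <= x)%N => [H|].
    by have [|/ltnW] := leqP y x; [exact: H|rewrite eq_sym; apply: H; rewrite -opprB rpredN].
  by rewrite eqn_mod_dvd // -frac_int natrB // mulrBl.
apply/eqP; rewrite -pq1 /chi; apply: (omega_mod omega_prim).
by rewrite -modnDm -modnMmr (eq_mod _ _ Mp) modnMmr -(modnMmr _ h.2) (eq_mod _ _ Mq) modnMmr modnDm.
Qed.

Lemma count_conjugates u : u \in [seq conjugate omega_prim s zeta | s <- enum {: T}] ->
  count_mem u [seq conjugate omega_prim s zeta | s <- enum {: T}] = #|annA g|.
Proof.
case/mapP => s _ ->; rewrite count_map -sum1_count big_enum_cond /= sum1dep_card.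
rewrite -[RHS](card_imset _ (addrI s)); apply: eq_card => t; rewrite finset.in_set.
apply/eqP/imsetP => [ts|[r rA ->]]; last first.
  by move: rA; rewrite annA_stab => /eqP r0; rewrite conjugateD r0.
exists (t - s); last by rewrite addrC subrK.
by rewrite annA_stab addrC conjugateD ts -conjugateD addNr conjugate0.
Qed.

(** Orbit and stabilizer: n^2 conjugations produce n distinct roots. *)
Lemma card_annA_n : size (conj_roots omega_prim zeta) = n -> #|annA g| = n.
Proof.
move=> n_roots; have := sum_undup_const (fun=> 1%N) count_conjugates.
rewrite !sum1_size size_map -cardE card_prod !card_ord n_roots => /eqP.
by rewrite eqn_pmul2r // => /eqP.
Qed.

Lemma annA0 s : s \in annA 0.
Proof.
rewrite inE; apply/'forall_implyP => h /= /latHP/latM0P[]; rewrite !frac_int => h1 h2.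
by rewrite chi_dvd.
Qed.

(** The annihilator of Z^2 is the whole of (Z/n)^2, so n^2 = n e_0. *)
Lemma ind_e0 : size (conj_roots omega_prim zeta) = n -> ind_e g lam 0 = n.
Proof.
move=> /card_annA_n An; have := card_annA (leq0n g); rewrite An.
rewrite (_ : annA 0 = [set: T]%SET); last by apply/setP => s; rewrite annA0 inE.
by rewrite cardsT card_prod !card_ord => /eqP; rewrite eqn_pmul2l // => /eqP.
Qed.

End Stabilizer.

End Characters.

(** * The index sets *)

Lemma head_filter_iota d (P : pred nat) a b i : (a <= i < a + b)%N -> P i ->
  let h := head d [seq i <- iota a b | P i] in
  [/\ (a <= h < a + b)%N, P h & forall j, (a <= j < h)%N -> ~~ P j].
Proof.
elim: b a => [|b IHb] a aib Pi /=; first by lia.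
case: ifP => Pa /=; first by split => //; [lia|move=> j; lia].
have [|h1 h2 h3] := IHb a.+1 _ Pi.
  by have [ai|] := eqVneq a i; [rewrite -ai Pa in Pi|lia].
split => //; first by lia.
move=> j /andP[aj jh]; have [<-|ja] := eqVneq a j; first by rewrite Pa.
by apply: h3; lia.
Qed.

Section IndexData.
Variables (n' g : nat) (lam : nat -> rat * rat) (L : nat -> nat * nat).
Local Notation n := n'.+1.
Hypothesis g_gt0 : (0 < g)%N.
Hypothesis lamE : forall j, (1 <= j <= g)%N -> lam j = frac n' (L j).1 (L j).2.
Hypothesis L_mono : forall j, (1 <= j < g)%N ->
  ((L j).1 <= (L j.+1).1)%N && ((L j).2 <= (L j.+1).2)%N.
Hypothesis e0 : ind_e g lam 0 = n.
Implicit Types nu : nat * nat.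

(* n <nu, lambda_j> *)
Definition npair nu j := (nu.1 * (L j).1 + nu.2 * (L j).2)%N.

Lemma npair_mono nu i j : (1 <= i <= j)%N -> (j <= g)%N -> (npair nu i <= npair nu j)%N.
Proof.
move=> /andP[i1 /subnK <-]; elim: (j - i)%N => // k IHk kg.
apply: (leq_trans (IHk _)); first by lia.
have /andP[? ?] := L_mono (j := (k + i)%N) ltac:(lia).
by rewrite /npair /= leq_add // leq_mul.
Qed.

Lemma pairing_frac nu p q :
  pairing nu (frac n' p q) = (nu.1 * p + nu.2 * q)%N%:R / n%:R.
Proof. by rewrite /pairing /frac /= natrD !natrM mulrDl !mulrA. Qed.

Lemma pairing_lam nu j : (1 <= j <= g)%N -> pairing nu (lam j) = (npair nu j)%:R / n%:R.
Proof. by move=> jg; rewrite lamE // pairing_frac. Qed.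

Lemma pairingD nu v w : pairing nu (v + w) = pairing nu v + pairing nu w.
Proof. by rewrite /pairing !mulrDr addrACA. Qed.

Lemma pairingN nu v : pairing nu (- v) = - pairing nu v.
Proof. by rewrite /pairing !mulrN opprD. Qed.

Lemma pairingMn nu v k : pairing nu (v *+ k) = pairing nu v *+ k.
Proof.
elim: k => [|k IHk]; first by rewrite /pairing !mulr0 addr0.
by rewrite !mulrSr pairingD IHk.
Qed.

Lemma gam_step j : (1 <= j)%N ->
  gam lam j.+1 = gam lam j *+ ind_n lam j + lam j.+1 - lam j.
Proof. by case: j. Qed.

Lemma pair_gam_step nu j : (1 <= j < g)%N ->
  pairing nu (gam lam j.+1) = (ind_n lam j)%:R * pairing nu (gam lam j)
    + ((npair nu j.+1)%:R - (npair nu j)%:R) / n%:R.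
Proof.
move=> /andP[j1 jg]; rewrite gam_step // !pairingD pairingN pairingMn.
by rewrite !pairing_lam ?mulrBl ?mulr_natl ?addrA //; lia.
Qed.

(** This is n l_i(nu). Indeed l_i(nu) = e_(i-1) <nu, gamma_i>, and the recursion for gamma
    telescopes it to e_0 <nu, lambda_1> plus the sum over j < i of e_j <nu, lambda_(j+1) -
    lambda_j>. *)
Definition nell nu i :=
  (n * npair nu 1 + \sum_(1 <= j < i) ind_e g lam j * (npair nu j.+1 - npair nu j))%N.

Lemma ind_e_step i : (1 <= i <= g)%N -> ind_e g lam i.-1 = (ind_n lam i * ind_e g lam i)%N.
Proof.
move=> /andP[i1 ig]; rewrite /ind_e prednK; last exact: i1.
by rewrite big_ltn; last exact: ig.
Qed.

Lemma ellE nu i : (1 <= i <= g)%N -> ell g lam nu i = ((nell nu i)%:R / n%:R)%:E.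
Proof.
move=> ig; rewrite /ell (_ : (i <= g)%N = true); last by lia.
congr (_%:E); rewrite -ind_e_step //.
have n0 : n%:R != 0 :> rat by rewrite pnatr_eq0.
case: i ig => // i; elim: i => [|i IHi] ig.
  by rewrite /= e0 pairing_lam // /nell big_geq // addn0 natrM mulrA.
rewrite pair_gam_step; last by lia.
rewrite mulrDr mulrA -natrM [X in X%:R * _]mulnC -ind_e_step /=; last by lia.
rewrite IHi; last by lia.
rewrite /nell [in RHS]big_nat_recr //= [in RHS]addnA [in RHS]natrD [RHS]mulrDl.
congr (_ + _); rewrite natrM natrB ?mulrA //.
by apply: npair_mono; lia.
Qed.

(** For i < g the inequality that defines m(nu) reads <nu, lambda_i> < <nu, lambda_(i+1)>, by the
    recursion for gamma. *)
Lemma idx_mP nu : let k := idx_m g lam nu in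
  [/\ (1 <= k <= g)%N, forall j, (1 <= j <= k)%N -> npair nu j = npair nu 1 &
      (k < g)%N -> (npair nu k < npair nu k.+1)%N].
Proof.
pose P i := ((((ind_n lam i)%:R * pairing nu (gam lam i))%:E < pair_gam g lam nu i.+1)%E).
have PE i : (1 <= i < g)%N -> P i = (npair nu i < npair nu i.+1)%N.
  move=> ig; rewrite /P /pair_gam (_ : (i < g)%N); last by lia.
  rewrite lte_fin pair_gam_step // ltrDl pmulr_lgt0 ?invr_gt0 ?ltr0n //.
  by rewrite subr_gt0 ltr_nat.
have Pg : P g by rewrite /P /pair_gam ltnn ltry.
have [] := @head_filter_iota g P 1 g g _ Pg; first by lia.
rewrite -/(idx_m g lam nu); set k := idx_m _ _ _ => k1 Pk kmin; split; first by lia.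
- case=> // j; elim: j => // j IHj jk; rewrite -IHj; last by lia.
  have := kmin j.+1 _; rewrite PE; last by lia.
  have := @npair_mono nu j.+1 j.+2; lia.
- by move=> kg; move: Pk; rewrite PE //; lia.
Qed.

Lemma latN_le nu i j : (i <= j)%N -> latN lam j nu -> latN lam i nu.
Proof. by move=> ij Nj l Ml; apply: Nj; apply: latM_le Ml. Qed.

Lemma idx_iP nu : let i := idx_i g lam nu in
  [/\ (1 <= i <= g.+1)%N, forall j, (1 <= j < i)%N -> latN lam j nu &
      (i <= g)%N -> ~ latN lam i nu].
Proof.
rewrite /idx_i; case: ifPn => [/set_mem Ng|/negP nNg].
  by split=> [|j ji|]; [lia|apply: latN_le Ng; lia|rewrite ltnn].
have [||] := @head_filter_iota g.+1 (fun i => nu \notin latN lam i) 1 g g.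
- by lia.
- by apply/negP.
set i := head _ _ => i1 Ni i2; split; first by lia.
- by move=> j /i2; rewrite negbK => /set_mem.
- by move=> _ Ni'; move: Ni; rewrite mem_set.
Qed.

Lemma latN_dvd nu j p q : latN lam j nu -> latM lam j (frac n' p q) ->
  (n %| nu.1 * p + nu.2 * q)%N.
Proof. by move=> Nj /Nj; rewrite pairing_frac frac_int. Qed.

Lemma latN_npair nu j : (1 <= j <= g)%N -> latN lam j nu -> (n %| npair nu j)%N.
Proof.
move=> jg Nj; apply: latN_dvd Nj _; rewrite -lamE //.
case: j jg => // j _; exists 0; first exact: latM_zero.
by exists 1; rewrite add0r mulr1z.
Qed.

Variables (S : sing_type) (m : nat).

Lemma nell_idx_m nu : nell nu (idx_m g lam nu) = (n * npair nu 1)%N.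
Proof.
have [k1 kc _] := idx_mP nu; rewrite /nell big_nat big1 ?addn0 // => j jk.
by rewrite !kc ?subnn ?muln0 //; lia.
Qed.

(** The pairings with lambda_1, ..., lambda_(m(nu)) coincide, so l_(m(nu))(nu) = n <nu, lambda_1>.
    Membership in H_m thus includes m < n <nu, lambda_1>, and membership in L_m the opposite
    inequality. *)
Lemma ell_idx_m nu : ell g lam nu (idx_m g lam nu) = (npair nu 1)%:R%:E.
Proof.
have [k1 _ _] := idx_mP nu; rewrite ellE // nell_idx_m natrM mulrC mulKf //.
by rewrite pnatr_eq0.
Qed.

Lemma setHP nu : setH g lam S m nu -> in_box m nu /\ (m < npair nu 1)%N.
Proof. by case=> box _; rewrite ell_idx_m lee_fin ler_nat. Qed.

Lemma nell_gt nu i : (1 <= i <= g)%N -> (m%:R%:E < ell g lam nu i)%E -> (n * m < nell nu i)%N.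
Proof.
by move=> ig; rewrite ellE // lte_fin ltr_pdivlMr ?ltr0n // -natrM ltr_nat mulnC.
Qed.

Lemma setLP nu : setL g lam S m nu ->
  [/\ in_box m nu, (npair nu 1 <= m)%N, (n %| npair nu 1)%N &
   exists2 i, (1 <= i <= g.+1)%N & (latN lam i.-1 nu /\ ((i <= g)%N -> (n * m < nell nu i)%N))].
Proof.
case=> box _ N1 /andP[]; rewrite ell_idx_m lee_fin ler_nat => mk mi; split => //.
  by apply: latN_npair.
have [i1 i2 i3] := idx_iP nu; exists (idx_i g lam nu) => //; split; last first.
  by move=> ig; apply: nell_gt => //; lia.
case: (idx_i g lam nu) i1 i2 {i3 mi} => // -[|i] _ i2 /=.
  by apply: latN_le N1.
by apply: i2; lia.
Qed.

Lemma setLeqP nu : setLeq g lam S m nu ->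
  [/\ in_box m nu, (npair nu 1 <= m)%N, (n %| npair nu 1)%N &
   exists k, [/\ (1 <= k <= g)%N, forall j, (1 <= j <= k)%N -> npair nu j = npair nu 1,
     (m < npair nu 1 + ind_e g lam k)%N, latN lam k nu &
     (k < g)%N -> (npair nu 1 < npair nu k.+1)%N /\
       (~ latN lam k.+1 nu -> (n * m < nell nu k.+1)%N)]].
Proof.
case=> nuL m_lt; have [box mk n_nu _] := setLP nuL; split => //.
have [k1 kc kg] := idx_mP nu; have [i1 i2 i3] := idx_iP nu.
set k := idx_m g lam nu in k1 kc kg m_lt *; set i := idx_i g lam nu in i1 i2 i3 m_lt.
have [m1 m2] : ((m < npair nu 1 + ind_e g lam k)%N /\ (m%:R%:E < ell g lam nu i)%E).
  by move: m_lt; rewrite lt_min => /andP[+ ->]; rewrite ell_idx_m -EFinD lte_fin -natrD ltr_nat.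
(* If i(nu) <= m(nu), both indices would give the same value n <nu, lambda_1> <= m of l, against m <
   l_(i(nu))(nu). *)
have ki : (k < i)%N.
  rewrite ltnNge; apply/negP => ik; have := @nell_gt nu i _ m2.
  rewrite /nell big_nat big1 ?addn0; last by move=> j jk; rewrite !kc ?subnn ?muln0 //; lia.
  by rewrite ltn_mul2l /= => H; have := H ltac:(lia); lia.
exists k; split => //; first by apply: i2; lia.
move=> lt_kg; split; first by rewrite -(kc k) ?kg //; lia.
move=> nN; have ik : i = k.+1.
  have : ~~ (k.+1 < i)%N by apply/negP => ki'; apply: nN; apply: i2; lia.
  by lia.
by apply: nell_gt; [lia|rewrite -ik].
Qed.

End IndexData.

Local Open Scope classical_set_scope.
Local Open Scope ring_scope.

(** * Roots of f along a jet *)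

Section Orders.
Variable F : fieldType.
Implicit Types (p q : {poly F}) (N d : nat).

Lemma eqm0M p q d d' : eqm d p 0 -> eqm d' q 0 -> eqm (d + d') (p * q) 0.
Proof.
move=> pd qd j jd; rewrite coefM coef0 big1 // => i _.
have [id|id] := ltnP i d; first by rewrite pd // coef0 mul0r.
by rewrite [q`_ _]qd ?coef0 ?mulr0 //; case: i id => i /= ? ?; lia.
Qed.

Lemma eqm0_prod (I : Type) (s : seq I) (p : I -> {poly F}) (d : I -> nat) :
  (forall i, eqm (d i) (p i) 0) -> eqm (\sum_(i <- s) d i)%N (\prod_(i <- s) p i) 0.
Proof.
move=> pd; elim: s => [|i s IHs]; first by rewrite !big_nil => j.
by rewrite !big_cons; exact: eqm0M.
Qed.

(** The order truncated at [N]: its value is [N] when the first [N] coefficients vanish. *)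
Definition order N p := find (fun j => p`_j != 0) (iota 0 N).

Lemma order_eqm N p : eqm (order N p) p 0.
Proof.
move=> j jN; rewrite coef0; apply/eqP/negPn.
have jN' : (j < N)%N by rewrite (leq_trans jN) // (leq_trans (find_size _ _)) ?size_iota.
by have := before_find 0%N jN; rewrite nth_iota // add0n => /negbT.
Qed.

Lemma eqm_order N p d : eqm d p 0 -> order N p = N \/ (d <= order N p)%N.
Proof.
move=> pd; have : (order N p <= N)%N by rewrite (leq_trans (find_size _ _)) ?size_iota.
rewrite leq_eqVlt => /orP[/eqP|oN]; first by left.
right; rewrite leqNgt; apply/negP => od.
have : has (fun j => p`_j != 0) (iota 0 N) by rewrite has_find size_iota.
move/(nth_find 0%N); rewrite -/(order N p) nth_iota // add0n.
by rewrite pd // coef0 eqxx.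
Qed.

Lemma prod_coef_neq0 (I : eqType) (s : seq I) (p : I -> {poly F}) d :
  (forall i, i \in s -> exists2 j, (j <= d)%N & (p i)`_j != 0) ->
  exists2 j, (j <= size s * d)%N & (\prod_(i <- s) p i)`_j != 0.
Proof.
elim: s => [_|i s IHs sd]; first by exists 0%N; rewrite // big_nil coef1 oner_eq0.
have [|j js pj] := IHs; first by move=> k ks; apply: sd; rewrite inE ks orbT.
have [k kd pk] := sd i (mem_head _ _).
have [a pa amin] := ex_minnP (ex_intro (fun k => (p i)`_k != 0) k pk).
have [b pb bmin] := ex_minnP (ex_intro (fun k => (\prod_(i <- s) p i)`_k != 0) j pj).
exists (a + b)%N.
  by rewrite mulSn leq_add // ?(leq_trans (amin _ pk)) // (leq_trans (bmin _ pj)).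
have ab : (a < (a + b).+1)%N by rewrite ltnS leq_addr.
rewrite big_cons coefM (bigD1 (Ordinal ab)) //= addKn.
rewrite [X in _ + X]big1 ?addr0 ?mulf_neq0 // => l /eqP la.
have [lta|gea] := ltnP l a.
  have -> : (p i)`_l = 0 by apply: contraTeq lta => /amin; rewrite -leqNgt.
  by rewrite mul0r.
have : nat_of_ord l != a by apply/eqP => lE; apply: la; apply: val_inj.
move=> la'; have ltb : (a + b - l < b)%N by case: l gea la' {la} => l /= ? ? ?; lia.
have -> : (\prod_(i <- s) p i)`_(a + b - l) = 0.
  by apply: contraTeq ltb => /bmin; rewrite -leqNgt.
by rewrite mulr0.
Qed.

End Orders.

(** * Fractional roots of the coordinates of a jet *)

Section NthRoot.
Variable C : numClosedFieldType.
Implicit Types (u v X : {poly C}) (n : nat).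

Lemma exprD_order2 (A : comNzRingType) (x y : A) n : exists q,
  (x + y) ^+ n = x ^+ n + x ^+ n.-1 * y * n%:R + y ^+ 2 * q.
Proof.
case: n => [|n]; first by exists 0; rewrite !mulr0 !addr0.
elim: n => [|n [q E]]; first by exists 0; rewrite mulr0 addr0 !expr1 expr0 mul1r mulr1.
exists (x * q + x ^+ n * n.+1%:R + y * q).
rewrite exprS E /= !exprS -[n.+2%:R]natr1.
move: (n.+1%:R : A) (x ^+ n) => N X; ring.
Qed.

Lemma nth_root_mod n u (b : C) N : (0 < n)%N -> b != 0 -> b ^+ n = u`_0 ->
  exists2 v : {poly C}, v`_0 = b & eqm N (v ^+ n) u.
Proof.
move=> n0 b0 bu; elim: N => [|N [v v0 vu]]; first by exists b%:P; rewrite ?coefC.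
have [N0|N0] := posnP N.
  exists b%:P; first by rewrite coefC.
  by rewrite N0 => -[|//] _; rewrite -polyC_exp coefC.
(* Newton step: adding c t^N to v changes the coefficient of t^N in v^n by n b^(n-1) c and none
   below; the quadratic terms start at t^(2N). *)
pose c := (u - v ^+ n)`_N / (n%:R * b ^+ n.-1).
have nb : n%:R * b ^+ n.-1 != 0 by rewrite mulf_neq0 ?expf_neq0 ?pnatr_eq0 -?lt0n.
exists (v + c *: 'X^N); first by rewrite coefD coefZ coefXn (ltn_eqF N0) mulr0 addr0.
move=> j; rewrite ltnS leq_eqVlt => jN.
have [q ->] := exprD_order2 v (c *: 'X^N) n; rewrite mulr_natr.
rewrite exprZn -exprM -scalerAl coefD coefZ coefXnM (_ : (j < N * 2)%N = true); last first.
  by case/orP: jN => [/eqP->|]; lia.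
rewrite mulr0 addr0 coefD coefMn -scalerAr coefZ coefMXn.
case/orP: jN => [/eqP->|jN]; last by rewrite jN mulr0 mul0rn addr0 vu.
rewrite ltnn subnn (_ : (v ^+ n.-1)`_0 = b ^+ n.-1); last first.
  by rewrite -!horner_coef0 horner_exp horner_coef0 v0.
rewrite (_ : _ *+ n = c * (n%:R * b ^+ n.-1)); last by rewrite -mulr_natl mulrCA.
by rewrite /c mulfVK // coefB addrC subrK.
Qed.

Lemma coef_comp_Xn X n j : (0 < n)%N ->
  (X \Po 'X^n)`_j = if (n %| j)%N then X`_(j %/ n) else 0.
Proof. by move=> n0; rewrite coef_comp_poly_Xn. Qed.

Lemma eqm_comp_Xn X Y n N : (0 < n)%N -> eqm N X Y -> eqm (n * N) (X \Po 'X^n) (Y \Po 'X^n).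
Proof.
move=> n0 XY j jN; rewrite !coef_comp_Xn //; case: ifP => // nj.
by rewrite XY // ltn_divLR // mulnC.
Qed.

Lemma fractional_root n X a (b : C) N : (0 < n)%N -> b != 0 ->
  has_ord X a -> b ^+ n = X`_a ->
  exists2 v : {poly C}, v`_0 = b & eqm (n * N) (('X^a * (v \Po 'X^n)) ^+ n) (X \Po 'X^n).
Proof.
move=> n0 b0 [Xlow Xa] bX.
pose u := drop_poly a X.
have XE : X = 'X^a * u.
  apply/polyP => j; rewrite coefXnM coef_drop_poly; case: ltnP => [/Xlow//|aj].
  by rewrite subnK.
have bu : b ^+ n = u`_0 by rewrite coef_drop_poly.
have [v v0 vu] := nth_root_mod N n0 b0 bu.
exists v => //; rewrite exprMn -exprM -rmorphXn XE rmorphM /=.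
rewrite [in X in eqm _ _ X]rmorphXn /= comp_polyX -exprM (mulnC a n).
by apply: eqmM => //; exact: eqm_comp_Xn.
Qed.

End NthRoot.

(** * Factorization of f along a jet *)

Section RamifiedEvaluation.
Variable C : numClosedFieldType.
Hypothesis hC : geo_complete C.
Variables (n' m : nat) (rho : C).
Local Notation n := n'.+1.
Local Notation N := (n * m.+1)%N.
Implicit Types (a : cps C) (X w : {poly C}).

Lemma cvg_subseq_mulS (u : nat -> C) (l : C) :
  u @ \oo --> l -> u (n * i).+1 @[i --> \oo] --> l.
Proof.
move=> /cvgrPdist_lt ul; apply/cvgrPdist_lt => e /ul[K _ uK]; exists K => // i /= Ki.
by apply: uK => /=; rewrite (leq_trans Ki) // ltnW // ltnS leq_pmull.
Qed.

Lemma ev_ramify a X1 X2 w1 w2 j : converges_on rho (ramify n a) ->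
  `|w1`_0| < rho -> `|w2`_0| < rho ->
  eqm N (w1 ^+ n) (X1 \Po 'X^n) -> eqm N (w2 ^+ n) (X2 \Po 'X^n) -> (j < N)%N ->
  ev (ramify n a) w1 w2 j = if (n %| j)%N then ev a X1 X2 (j %/ n) else 0.
Proof.
move=> a_rho w10 w20 wX1 wX2 jN.
have E p q : (w1 ^+ (n * p) * w2 ^+ (n * q))`_j =
    if (n %| j)%N then (X1 ^+ p * X2 ^+ q)`_(j %/ n) else 0.
  rewrite !exprM -coef_comp_Xn // rmorphM !rmorphXn /=.
  by apply: (eqmM (N := N)) => //; exact: eqmX.
have termE p q : ramify n a p q * (w1 ^+ p * w2 ^+ q)`_j =
    if (n %| p)%N && (n %| q)%N then a (p %/ n)%N (q %/ n)%N *
      (if (n %| j)%N then (X1 ^+ (p %/ n) * X2 ^+ (q %/ n))`_(j %/ n) else 0) else 0.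
  rewrite ramifyE; case: ifP => [/andP[/dvdnP[k ->] /dvdnP[l ->]]|_]; last by rewrite mul0r.
  by rewrite !mulnK // ![(_ * n)%N]mulnC E.
have [nj|nj] := boolP (n %| j)%N; last first.
  by apply: dsum0 => p q; rewrite termE (negbTE nj) mulr0; case: ifP.
(* Along the indices n i + 1 the partial sums for [ramify n a] are those for [a], so the latter
   converge as a subsequence of the former. *)
have part i : dpart (fun p q => ramify n a p q * (w1 ^+ p * w2 ^+ q)`_j) (n * i).+1 =
    dpart (fun p q => a p q * (X1 ^+ p * X2 ^+ q)`_(j %/ n)) i.+1.
  rewrite /dpart -(sum_dvdn n' (fun p => \sum_(q < i.+1) a p q * (X1 ^+ p * X2 ^+ q)`_(j %/ n))).
  apply: eq_bigr => p _; case: ifP => np; last first.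
    by apply: big1 => q _; rewrite termE np.
  rewrite -(sum_dvdn n' (fun q => a (p %/ n)%N q * (X1 ^+ (p %/ n) * X2 ^+ q)`_(j %/ n))).
  by apply: eq_bigr => q _; rewrite termE np nj.
symmetry; apply: dsum_lim; rewrite -cvg_shiftS /=.
under eq_cvg => i do rewrite -part.
by apply: cvg_subseq_mulS; apply: dsum_cvg => //; exact: ev_geo a_rho w10 w20.
Qed.

Variables (omega : C) (zeta : cps C) (f : {poly cps C}).
Hypothesis omega_prim : n.-primitive_root omega.
Hypothesis zeta_rho : converges_on rho zeta.
Local Notation roots := (conj_roots omega_prim zeta).
Hypothesis f_roots : map_poly (@ramify C n) f = \prod_(b <- roots) ('X - b%:P).

Lemma converges_on_conjugate s : converges_on rho (conjugate omega_prim s zeta).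
Proof.
move=> e e_rho; have [M zM] := zeta_rho e_rho; exists M => p q.
by rewrite conjugateE normrM chi_norm // mulr1.
Qed.

Lemma conj_roots_rho b : b \in roots -> converges_on rho b.
Proof. by move=> /conj_rootsP[s ->]; exact: converges_on_conjugate. Qed.

Variables (gm : jet C m) (w1 w2 : {poly C}).
Hypotheses (w10 : `|w1`_0| < rho) (w20 : `|w2`_0| < rho).
Hypothesis wX1 : eqm N (w1 ^+ n) (jet_poly ix1 gm \Po 'X^n).
Hypothesis wX2 : eqm N (w2 ^+ n) (jet_poly ix2 gm \Po 'X^n).
Local Notation z := (jet_poly iz gm \Po 'X^n).

Lemma f_comp_factor :
  eqm N (f_comp f gm \Po 'X^n) (\prod_(b <- roots) (z - evp N w1 w2 b)).
Proof.
have [fE f_rho] := eval_poly_prod hC N w10 w20 z conj_roots_rho.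
apply: eqm_trans fE; rewrite -f_roots /eval_poly.
rewrite size_map_inj_poly; [|exact: ramify_inj|exact: rmorph0].
rewrite /f_comp rmorph_sum /=; apply: eqm_sum => k.
rewrite rmorphM rmorphXn /=; apply: eqmM => // j jN.
have := f_rho k; rewrite -f_roots coef_map /= => fk_rho.
rewrite coef_comp_Xn // !coef_poly jN (ev_ramify fk_rho w10 w20 wX1 wX2 jN).
by case: ifP => // nj; rewrite ltn_divLR // mulnC jN.
Qed.

(** Otherwise each of the n factors has order at most m, their product has order at most n m, and f
    has a nonzero coefficient in some degree at most m. *)
Lemma f_comp_root : size roots = n -> (forall j, (j <= m)%N -> (f_comp f gm)`_j = 0) ->
  exists s, forall j, (j <= m)%N -> z`_j = ev (conjugate omega_prim s zeta) w1 w2 j.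
Proof.
move=> n_roots f0; apply: contrapT => /forallNP no_root.
have [|j jn] := @prod_coef_neq0 C _ roots (fun b => z - evp N w1 w2 b) m.
  move=> b /conj_rootsP[s ->]; apply: contrapT => nz; apply: (no_root s) => j jm.
  have jN : (j < N)%N by rewrite mulSn; lia.
  apply/eqP; rewrite -subr_eq0; apply/negPn/negP => zj; apply: nz; exists j => //.
  by rewrite coefB coef_poly jN.
rewrite n_roots in jn; have jN : (j < N)%N by lia.
rewrite -(f_comp_factor jN) coef_comp_Xn //; case: ifP => nj; last by rewrite eqxx.
have jm : (j %/ n <= m)%N by rewrite leq_divLR // mulnC.
by rewrite (f0 _ jm) => /eqP.
Qed.

End RamifiedEvaluation.

(** * Continuity of regular functions on jets *)

Section RegularFunctions.
Variable C : numClosedFieldType.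
Hypothesis hC : geo_complete C.
Implicit Types (r B : C) (m : nat).

Lemma cps_evalE (a : cps C) c1 c2 : cps_eval a c1 c2 = ev a c1%:P c2%:P 0.
Proof.
rewrite /ev /dsum /cps_eval; congr (limn _); apply: funext => N.
rewrite /dpart; apply: eq_bigr => p _; apply: eq_bigr => q _.
by rewrite -!polyC_exp -polyCM coefC eqxx mulrA.
Qed.

Lemma wnormC (t c : C) : wnorm t c%:P = `|c|.
Proof. by rewrite -alg_polyC -(expr0 'X) wnormZXn mulr1. Qed.

Lemma cvg_prodr (I : Type) (s : seq I) (u : I -> nat -> C) (l : I -> C) :
  (forall i, u i k @[k --> \oo] --> l i) ->
  \prod_(i <- s) u i k @[k --> \oo] --> \prod_(i <- s) l i.
Proof. by move=> ul; apply: cvg_big => //; exact: mul_continuous. Qed.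

Lemma cvg_exprn (u : nat -> C) (l : C) e :
  u k @[k --> \oo] --> l -> u k ^+ e @[k --> \oo] --> l ^+ e.
Proof.
move=> ul; elim: e => [|e IHe].
  by rewrite expr0; under eq_cvg do rewrite expr0; exact: cvg_cst.
by rewrite exprS; under eq_cvg do rewrite exprS; exact: cvgM.
Qed.

Lemma cps_eval_cvg (a : cps C) r B (c1 c2 : nat -> C) (l1 l2 : C) :
  converges_on r a -> 0 <= B < r ->
  (forall k, `|c1 k| <= B) -> (forall k, `|c2 k| <= B) ->
  c1 k @[k --> \oo] --> l1 -> c2 k @[k --> \oo] --> l2 ->
  cps_eval a (c1 k) (c2 k) @[k --> \oo] --> cps_eval a l1 l2.
Proof.
move=> ar Br c1B c2B cl1 cl2; rewrite cps_evalE.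
under eq_cvg do rewrite cps_evalE.
have cC (c : nat -> C) (l : C) : c k @[k --> \oo] --> l ->
    forall i, (c k)%:P`_i @[k --> \oo] --> l%:P`_i.
  move=> cl [|i]; rewrite coefC /=; first by under eq_cvg do rewrite coefC.
  by under eq_cvg do rewrite coefC; exact: cvg_cst.
by apply: (ev_cvg hC ar ltr01 Br) => [k|k|i|i]; rewrite ?wnormC //; exact: cC.
Qed.

(** The bound B < r keeps the centers in a smaller closed polydisc, where the holomorphic
    coefficients have a uniform majorant. *)
Lemma regular_cvg r B m (F : jet C m -> C) (gm_ : nat -> jet C m) (gm : jet C m) :
  regular r F -> 0 <= B < r -> centered r gm ->
  (forall k, `|gm_ k ix1 ord0| <= B) -> (forall k, `|gm_ k ix2 ord0| <= B) ->
  (forall i j, gm_ k i j @[k --> \oo] --> gm i j) ->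
  F (gm_ k) @[k --> \oo] --> F gm.
Proof.
move=> [s [s_r FE]] Br gm_c gB1 gB2 gmE.
have ctr k : centered r (gm_ k).
  have /andP[_ Blt] := Br.
  by rewrite /centered /in_polydisc (le_lt_trans (gB1 k)) // (le_lt_trans (gB2 k)).
pose G (t : cps C * ('I_3 -> 'I_m.+1 -> nat)) (y : jet C m) :=
  cps_eval t.1 (y ix1 ord0) (y ix2 ord0) * \prod_i \prod_j y i j ^+ t.2 i j.
have FE' : (fun k => F (gm_ k)) = fun k => \sum_(t <- s) G t (gm_ k).
  by apply: funext => k; rewrite FE.
rewrite FE' (FE _ gm_c).
rewrite -[X in _ --> X]/(\sum_(t <- s) G t gm).
elim: s s_r {FE FE'} => [_|t s' IHs ts].
  by rewrite big_nil; under eq_cvg do rewrite big_nil; exact: cvg_cst.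
rewrite big_cons; under eq_cvg do rewrite big_cons.
apply: cvgD; last by apply: IHs => u us; apply: ts; rewrite inE us orbT.
rewrite /G; apply: cvgM.
  by apply: (cps_eval_cvg _ Br) => //; apply: ts; exact: mem_head.
by apply: cvg_prodr => i; apply: cvg_prodr => j; apply: cvg_exprn.
Qed.

Lemma regular_coord r m (i0 : 'I_3) (j0 : 'I_m.+1) : regular r (fun gm : jet C m => gm i0 j0).
Proof.
exists [:: (1, fun i j => ((i == i0) && (j == j0) : nat))]; split=> [t|gm _].
  by rewrite inE => /eqP->; exact: converges_on1.
rewrite big_cons big_nil addr0 cps_evalE /= ev1 mul1r.
rewrite (bigD1 i0) //= (bigD1 j0) //= !eqxx expr1 big1 ?mulr1 => [|j /negbTE->]; last first.
  by rewrite expr0.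
by rewrite big1 ?mulr1 // => i /negbTE->; rewrite big1 // => j _; rewrite expr0.
Qed.

End RegularFunctions.

Section MakeJet.
Variables (C : numClosedFieldType) (m : nat).

Definition mkjet (X1 X2 Z : {poly C}) : jet C m :=
  \matrix_(i < 3, k < m.+1) (if i == ix1 then X1`_k else if i == ix2 then X2`_k else Z`_k).

Lemma ix_neq : [/\ ix2 == ix1 = false, iz == ix1 = false & iz == ix2 = false].
Proof. by split; apply/negbTE; rewrite -val_eqE /= !inordK. Qed.

Lemma ix_cases (i : 'I_3) : [\/ i = ix1, i = ix2 | i = iz].
Proof.
case: i => [[|[|[|//]]] i3]; [apply: Or31|apply: Or32|apply: Or33];
  by apply: val_inj; rewrite /= inordK.
Qed.

Lemma coef_mkjet X1 X2 Z k : (k <= m)%N ->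
  [/\ (jet_poly ix1 (mkjet X1 X2 Z))`_k = X1`_k,
      (jet_poly ix2 (mkjet X1 X2 Z))`_k = X2`_k &
      (jet_poly iz (mkjet X1 X2 Z))`_k = Z`_k].
Proof.
rewrite -ltnS => km; have [E1 E2 E3] := ix_neq.
by split; rewrite -[k]/(nat_of_ord (Ordinal km)) coef_rVpoly_ord !mxE ?eqxx ?E1 ?E2 ?E3.
Qed.

End MakeJet.

(** * The jet strata *)

Lemma coef_jet (C : numClosedFieldType) m (i : 'I_3) (gm : jet C m) (k : 'I_m.+1) :
  (jet_poly i gm)`_k = gm i k.
Proof. by rewrite coef_rVpoly_ord mxE. Qed.

Lemma coef_jet_ge (C : numClosedFieldType) m (i : 'I_3) (gm : jet C m) k :
  (m < k)%N -> (jet_poly i gm)`_k = 0.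
Proof. by move=> mk; rewrite coef_rVpoly insubN // -leqNgt. Qed.

Section Branch.
Variable C : numClosedFieldType.
Hypothesis hC : geo_complete C.
Variables (n' : nat) (rho omega : C) (zeta : cps C) (f : {poly cps C}).
Local Notation n := n'.+1.
Local Notation T := ('I_n'.+1 * 'I_n'.+1)%type.
Hypothesis omega_prim : n.-primitive_root omega.
Hypothesis zeta_rho : converges_on rho zeta.
Local Notation roots := (conj_roots omega_prim zeta).
Hypothesis f_roots : map_poly (@ramify C n) f = \prod_(b <- roots) ('X - b%:P).
Hypothesis n_roots : size roots = n.
Variables (g : nat) (lam : nat -> rat * rat) (L : nat -> nat * nat).
Hypothesis g_gt0 : (0 < g)%N.
Hypothesis lamE : forall j, (1 <= j <= g)%N -> lam j = frac n' (L j).1 (L j).2.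
Hypothesis L_mono : forall j, (1 <= j < g)%N ->
  ((L j).1 <= (L j.+1).1)%N && ((L j).2 <= (L j.+1).2)%N.
Hypothesis zeta_supp : forall p q j, (j <= g)%N -> zeta p q != 0 ->
  ~ latM lam j (frac n' p q) ->
  (j < g)%N /\ ((L j.+1).1 <= p)%N && ((L j.+1).2 <= q)%N.
Hypothesis zeta_low : forall p q, zeta p q != 0 -> ((L 1).1 <= p)%N && ((L 1).2 <= q)%N.
Hypothesis zeta_L : forall j, (1 <= j <= g)%N -> zeta (L j).1 (L j).2 != 0.

Lemma zeta_suppg p q : zeta p q != 0 -> latM lam g (frac n' p q).
Proof.
move=> zpq; apply: contrapT => /(zeta_supp (leqnn g) zpq)[].
by rewrite ltnn.
Qed.

Lemma ind_e0_n : ind_e g lam 0 = n.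
Proof. exact: (ind_e0 lamE zeta_suppg zeta_L n_roots). Qed.

Lemma card_annA_e j : (j <= g)%N -> #|annA n' omega lam j| = (n * ind_e g lam j)%N.
Proof.
move=> jg; rewrite (card_annA omega_prim lamE jg).
by rewrite (card_annA_n lamE zeta_suppg zeta_L n_roots).
Qed.

(** The shape of an n-th root of x(t) at t = s^n when x has order a: s^a times a series in s^n. *)
Definition wpoly a (v : {poly C}) : {poly C} := 'X^a * (v \Po 'X^n).

Lemma coef_wpoly (nu : nat * nat) v1 v2 p q j :
  (wpoly nu.1 v1 ^+ p * wpoly nu.2 v2 ^+ q)`_j =
  let k := (nu.1 * p + nu.2 * q)%N in
  if (k <= j)%N && (n %| j - k)%N then (v1 ^+ p * v2 ^+ q)`_((j - k) %/ n) else 0.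
Proof.
rewrite /wpoly !exprMn mulrACA -!exprM -exprD -!rmorphXn -rmorphM /= coefXnM.
rewrite ltnNge; case: leqP => //= _.
by rewrite coef_comp_Xn.
Qed.

Section Evaluations.
Variables (nu : nat * nat) (v1 v2 : {poly C}).
Local Notation w1 := (wpoly nu.1 v1).
Local Notation w2 := (wpoly nu.2 v2).
Local Notation npair := (npair L nu).

Lemma npair_le p q j : ((L j).1 <= p)%N && ((L j).2 <= q)%N ->
  (npair j <= nu.1 * p + nu.2 * q)%N.
Proof. by case/andP => Lp Lq; rewrite leq_add // leq_mul. Qed.

Lemma coef_wpoly_lt p q l : (l < nu.1 * p + nu.2 * q)%N -> (w1 ^+ p * w2 ^+ q)`_l = 0.
Proof. by move=> lpq; rewrite coef_wpoly /= leqNgt lpq. Qed.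

(** Monomials with exponent in M_j are fixed by s, and the others have exponent >= lambda_(j+1),
    hence order at least n <nu, lambda_(j+1)> in s. *)
Lemma ev_annA s j l : s \in annA n' omega lam j -> (j <= g)%N ->
  ((j < g)%N -> (l < npair j.+1)%N) ->
  ev (conjugate omega_prim s zeta) w1 w2 l = ev zeta w1 w2 l.
Proof.
move=> sA jg lj; apply: eq_dsum => p q; rewrite conjugateE.
have [->|zpq] := eqVneq (zeta p q) 0; first by rewrite mul0r.
have [Mpq|nMpq] := pselect (latM lam j (frac n' p q)).
  by rewrite (annAP omega_prim sA Mpq) mulr1.
have [lt_jg Lpq] := zeta_supp jg zpq nMpq.
by rewrite coef_wpoly_lt ?mulr0 // (leq_trans (lj lt_jg)) // npair_le.
Qed.

(** For nu in N_j, a monomial with exponent in M_j has order divisible by n and so contributes only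
    powers of s^n; the others start too late. *)
Lemma ev_nmultiple j l : latN lam j nu -> (j <= g)%N -> ((j < g)%N -> (l < npair j.+1)%N) ->
  ~~ (n %| l)%N -> ev zeta w1 w2 l = 0.
Proof.
move=> Nj jg lj nl; apply: dsum0 => p q.
have [->|zpq] := eqVneq (zeta p q) 0; first by rewrite mul0r.
have [Mpq|nMpq] := pselect (latM lam j (frac n' p q)).
  rewrite coef_wpoly /=; case: ifP => [/andP[le_l]|]; rewrite ?mulr0 //.
  by rewrite dvdn_subl // ?(negbTE nl) //; exact: latN_dvd Nj Mpq.
have [lt_jg Lpq] := zeta_supp jg zpq nMpq.
by rewrite coef_wpoly_lt ?mulr0 // (leq_trans (lj lt_jg)) // npair_le.
Qed.

Lemma ev_low s l : (l < npair 1)%N -> ev (conjugate omega_prim s zeta) w1 w2 l = 0.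
Proof.
move=> l1; apply: dsum0 => p q; rewrite conjugateE.
have [->|zpq] := eqVneq (zeta p q) 0; first by rewrite !mul0r.
by rewrite coef_wpoly_lt ?mulr0 // (leq_trans l1) // npair_le // zeta_low.
Qed.

Lemma ev_zeta_low l : (l < npair 1)%N -> ev zeta w1 w2 l = 0.
Proof. by rewrite -{1}(conjugate0 omega_prim zeta); exact: ev_low. Qed.

(** Conjugating zeta amounts to multiplying the chosen roots w_i by powers of omega. *)
Lemma ev_conj s l : ev (conjugate omega_prim s zeta) w1 w2 l =
  ev zeta (wpoly nu.1 (omega ^+ s.1 *: v1)) (wpoly nu.2 (omega ^+ s.2 *: v2)) l.
Proof.
apply: eq_dsum => p q; rewrite conjugateE /wpoly !linearZ /= -!scalerAr !exprZn.
rewrite -[LHS]mulrA; congr (_ * _).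
by rewrite -scalerAl -scalerAr scalerA coefZ /chi exprD !(exprM omega).
Qed.

End Evaluations.

(** * Criteria for a jet to lie on X *)

Section Membership.
Variables (m : nat) (gm : jet C m) (w1 w2 : {poly C}).
Local Notation N := (n * m.+1)%N.
Hypotheses (w10 : `|w1`_0| < rho) (w20 : `|w2`_0| < rho).
Hypothesis wX1 : eqm N (w1 ^+ n) (jet_poly ix1 gm \Po 'X^n).
Hypothesis wX2 : eqm N (w2 ^+ n) (jet_poly ix2 gm \Po 'X^n).
Local Notation z := (jet_poly iz gm \Po 'X^n).

Lemma sum_annA_weights (D : nat -> nat) i : (i <= g.+1)%N ->
  (\sum_(s : T) (D 1 + \sum_(1 <= j < i) (s \in annA n' omega lam j) * (D j.+1 - D j)) =
  n * (n * D 1 + \sum_(1 <= j < i) ind_e g lam j * (D j.+1 - D j)))%N.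
Proof.
move=> ig; rewrite big_split /= sum_nat_const card_prod !card_ord mulnDr mulnA; congr addn.
rewrite exchange_big /= big_distrr /= big_nat [RHS]big_nat; apply: eq_bigr => j jg.
by rewrite -big_distrl /= -big_mkcond /= sum1_card card_annA_e ?mulnA //; lia.
Qed.

(** Here D_j is an order up to which z agrees with the conjugates of zeta under the annihilator of
    M_(j-1). The order of the factor of s is then at least the weight d(s) below, and the sum of
    these weights is computed by [sum_annA_weights]. *)
Lemma f_comp_vanish (D : nat -> nat) i : (1 <= i <= g.+1)%N ->
  (forall j, (1 <= j < i)%N -> (D j <= D j.+1)%N) ->
  (forall s j l, (1 <= j <= i)%N -> s \in annA n' omega lam j.-1 ->
     (l < D j)%N -> (l < N)%N -> z`_l = ev (conjugate omega_prim s zeta) w1 w2 l) ->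
  (n * m < n * D 1 + \sum_(1 <= j < i) ind_e g lam j * (D j.+1 - D j))%N ->
  forall j, (j <= m)%N -> (f_comp f gm)`_j = 0.
Proof.
move=> i1g D_mono zD Dm.
have arith (x a b : nat) (t : bool) : (x <= a -> a <= b -> x + t * (b - a) <= b)%N.
  by case: t; lia.
(* The annihilators decrease with j, so this telescopes to D_(j+1) for the last j < i such that s
   annihilates M_j. *)
pose d (s : T) := (D 1 + \sum_(1 <= j < i) (s \in annA n' omega lam j) * (D j.+1 - D j))%N.
pose o b := order N (z - evp N w1 w2 b).
have vanish s : eqm (d s) (z - evp N w1 w2 (conjugate omega_prim s zeta)) 0.
  have [j ji [sj dj]] : exists2 j, (1 <= j <= i)%N & s \in annA n' omega lam j.-1 /\ (d s <= D j)%N.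
    rewrite /d; elim: i i1g D_mono {zD Dm d} => // i IHi ig D_mono.
    have [i0|i0] := posnP i.
      by rewrite i0 big_geq // addn0; exists 1%N; rewrite //= annA0.
    have le_Di k : (k <= i)%N -> (D 1 + \sum_(1 <= j < k.+1)
        (s \in annA n' omega lam j) * (D j.+1 - D j) <= D k.+1)%N.
      elim: k => [|k IHk] ki; first by rewrite big_geq // addn0.
      rewrite big_nat_recr //= addnA.
      apply: arith (IHk (ltnW ki)) (D_mono k.+1 _).
      by rewrite ltnS.
    have [sA|sA] := boolP (s \in annA n' omega lam i).
      by exists i.+1; [lia|split; [|exact: le_Di]].
    have [||j ji [sj dj]] := IHi; [lia|by move=> j ji; apply: D_mono; lia|].
    exists j; first by lia.
    by split => //; rewrite big_nat_recr //= (negbTE sA) mul0n addn0.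
  move=> l ld; rewrite coefB coef0 coef_poly; case: ltnP => lN.
    by rewrite (zD s j) ?subrr //; lia.
  rewrite subr0 coef_comp_Xn //; case: ifP => // nl.
  by rewrite coef_jet_ge // leq_divRL // mulnC.
have sum_o : (n * m < \sum_(b <- roots) o b)%N.
  (* A factor that vanishes to the full order N > n m suffices alone. Otherwise no order is
     truncated and each is at least the weight of every conjugation giving that root. *)
  have [[b bR bN]|no_big] := pselect (exists2 b, b \in roots & o b = N).
    rewrite (@leq_trans N) //; first by rewrite ltn_mul2l /= ltnSn.
    by rewrite (big_rem b) //= bN leq_addr.
  rewrite -(ltn_pmul2l (isT : (0 < n)%N)) (leq_trans (n := \sum_(s : T) d s)) //.
    by rewrite sum_annA_weights ?ltn_pmul2l //; lia.
  (* Each root comes from exactly n conjugations, which accounts for the factor n. *)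
  have /(_ o) := sum_undup_const _
    (count_conjugates lamE zeta_suppg zeta_L (omega_prim := omega_prim)).
  rewrite big_map big_enum /= (card_annA_n lamE zeta_suppg zeta_L n_roots) => <-.
  rewrite [leqRHS](eq_bigl xpredT) //; apply: leq_sum => s _.
  have [oN|//] := eqm_order N (vanish s).
  by case: no_big; exists (conjugate omega_prim s zeta) => //; apply/conj_rootsP; exists s.
have prod0 : eqm (n * m).+1 (\prod_(b <- roots) (z - evp N w1 w2 b)) 0.
  move=> l lnm; apply: (eqm0_prod (d := o)) => [b|]; first exact: order_eqm.
  by apply: leq_trans sum_o.
move=> j jm; have jN : (n * j < N)%N by rewrite ltn_mul2l.
have := f_comp_factor hC zeta_rho f_roots w10 w20 wX1 wX2 jN.
rewrite coef_comp_Xn // dvdn_mulr // mulKn // => ->.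
by rewrite prod0 ?coef0 // ltnS leq_mul2l jm orbT.
Qed.

End Membership.

Variables (S : sing_type) (m : nat) (r : C).
Hypotheses (r_gt0 : 0 < r) (r_rho : r < rho ^+ n).
Hypothesis rho_gt0 : 0 < rho.
Local Notation N := (n * m.+1)%N.
Local Notation inH nu := (setH g lam S m nu).
Local Notation inL nu := (setL g lam S m nu).
Local Notation inLeq nu := (setLeq g lam S m nu).

Lemma in_boxHL nu : inH nu \/ inL nu -> in_box m nu.
Proof. by case=> []; case. Qed.

Lemma root_small (b : C) : `|b ^+ n| < r -> `|b| < rho.
Proof.
rewrite normrX => br; have {}br := lt_trans br r_rho.
by move: br; rewrite ltr_pXn2r ?nnegrE ?normr_ge0 ?(ltW rho_gt0).
Qed.

Lemma wpoly_coef0 a v : (wpoly a v)`_0 = if a == 0%N then v`_0 else 0.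
Proof.
rewrite /wpoly coefXnM; case: a => [|a] //=.
by rewrite coef_comp_Xn // dvdn0 div0n.
Qed.

Lemma wpoly_small a (v : {poly C}) (x : C) : v`_0 ^+ n = x -> (a = 0%N -> `|x| < r) ->
  `|(wpoly a v)`_0| < rho.
Proof.
move=> vx xr; rewrite wpoly_coef0; case: eqP => [/xr|]; last by rewrite normr0.
by rewrite -vx; exact: root_small.
Qed.

Lemma jet_coef0 (i : 'I_3) (gm : jet C m) : (jet_poly i gm)`_0 = gm i ord0.
Proof. by rewrite -(coef_jet i gm ord0). Qed.

Lemma jet_wpoly (i : 'I_3) (gm : jet C m) a (b : C) :
  `|gm i ord0| < r -> has_ord (jet_poly i gm) a -> b ^+ n = (jet_poly i gm)`_a ->
  exists v : {poly C}, [/\ v`_0 = b, eqm N (wpoly a v ^+ n) (jet_poly i gm \Po 'X^n) &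
    `|(wpoly a v)`_0| < rho].
Proof.
move=> gr ga bE; have b0 : b != 0.
  by apply/eqP => b0; case: ga => _; rewrite -bE b0 expr0n.
have [v v0 vE] := fractional_root m.+1 (ltn0Sn n') b0 ga bE.
exists v; split => //; apply: (@wpoly_small _ _ ((jet_poly i gm)`_a)).
  by rewrite v0.
by move=> a0; rewrite a0 jet_coef0.
Qed.

Lemma jets_D_elim nu gm : jets_D f r m nu gm -> exists v1 v2 : {poly C},
  [/\ v1`_0 ^+ n = (jet_poly ix1 gm)`_(nu.1), v2`_0 ^+ n = (jet_poly ix2 gm)`_(nu.2) &
   forall l, (l <= m)%N ->
     (jet_poly iz gm \Po 'X^n)`_l = ev zeta (wpoly nu.1 v1) (wpoly nu.2 v2) l].
Proof.
move=> [[/andP[c1 c2] f0] o1 o2].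
have nroot (x : C) : (n.-root x) ^+ n = x by rewrite rootCK.
have [v1 [v10 wX1 w10]] := jet_wpoly c1 o1 (nroot _).
have [v2 [v20 wX2 w20]] := jet_wpoly c2 o2 (nroot _).
have [s sE] := f_comp_root hC zeta_rho f_roots w10 w20 wX1 wX2 n_roots f0.
exists (omega ^+ s.1 *: v1), (omega ^+ s.2 *: v2); split.
- by rewrite coefZ exprMn -exprM mulnC exprM (prim_expr_order omega_prim) expr1n mul1r v10 nroot.
- by rewrite coefZ exprMn -exprM mulnC exprM (prim_expr_order omega_prim) expr1n mul1r v20 nroot.
- by move=> l lm; rewrite sE // ev_conj.
Qed.

Section Introduction.
Variables (nu : nat * nat) (gm : jet C m) (v1 v2 : {poly C}).
Local Notation w1 := (wpoly nu.1 v1).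
Local Notation w2 := (wpoly nu.2 v2).
Hypotheses (w10 : `|w1`_0| < rho) (w20 : `|w2`_0| < rho).
Hypothesis wX1 : eqm N (w1 ^+ n) (jet_poly ix1 gm \Po 'X^n).
Hypothesis wX2 : eqm N (w2 ^+ n) (jet_poly ix2 gm \Po 'X^n).
Local Notation z := (jet_poly iz gm \Po 'X^n).
Local Notation npair := (npair L nu).

(** As m < n <nu, lambda_1>, all conjugates of zeta vanish modulo s^(m+1), and so does z: each of
    the n factors has order at least m + 1. *)
Lemma f_comp_setH : inH nu -> (forall l, (l <= m)%N -> z`_l = ev zeta w1 w2 l) ->
  forall j, (j <= m)%N -> (f_comp f gm)`_j = 0.
Proof.
move=> /(setHP g_gt0 lamE L_mono ind_e0_n)[_ m_lt] zE.
apply: (f_comp_vanish w10 w20 wX1 wX2 (D := fun=> m.+1) (i := 1)) => //.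
  move=> s j l _ _ lm _; rewrite zE // ev_low ?ev_zeta_low //.
  - by rewrite (leq_ltn_trans _ m_lt).
  - by rewrite (leq_ltn_trans _ m_lt).
by rewrite big_geq // addn0 ltn_mul2l /= ltnSn.
Qed.

Lemma f_comp_setLeq : inLeq nu ->
  (forall l, (l <= npair 1)%N -> z`_l = ev zeta w1 w2 l) ->
  forall j, (j <= m)%N -> (f_comp f gm)`_j = 0.
Proof.
move=> /(setLeqP g_gt0 lamE L_mono ind_e0_n)[_ le_m n_nu [k [k1g kc m_lt Nk kg]]] zE.
(* The agreement of z and zeta assumed through order n <nu, lambda_1> extends to [D2]: the next
   multiple of n is n <nu, lambda_1> + n, and below n <nu, lambda_(k+1)> only powers of s^n occur in
   zeta, because nu is in N_k. *)
pose D2 := if (k < g)%N then minn (npair 1 + n) (npair k.+1) else (npair 1 + n)%N.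
have D2_le : (npair 1 <= D2)%N.
  rewrite /D2; case: ifP => [/kg[kl _]|_]; last by rewrite leq_addr.
  by rewrite leq_min leq_addr ltnW.
have D2_n : (D2 <= npair 1 + n)%N by rewrite /D2; case: ifP => // _; exact: geq_minl.
pose D j := if (j <= k)%N then npair 1 else D2.
apply: (f_comp_vanish w10 w20 wX1 wX2 (D := D) (i := k.+1)) => //.
- by lia.
- by move=> j jk; rewrite /D; case: ifP => jk1; case: ifP => // jk2; lia.
- move=> s j l /andP[j1 jk] sA; rewrite /D; case: (leqP j k) => [jk' ll _|kj ll _].
    by rewrite zE ?(ltnW ll) // ev_low // ev_zeta_low.
  have jE : j = k.+1 by lia.
  rewrite jE /= in sA.
  have l_lt : (k < g)%N -> (l < npair k.+1)%N.
    by move=> kg'; apply: leq_trans ll _; rewrite /D2 kg' geq_minr.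
  rewrite (ev_annA _ _ sA _ l_lt); last by lia.
  have [l1|l1] := leqP l (npair 1); first exact: zE.
  have nl : ~~ (n %| l)%N.
    have := leq_trans ll D2_n; move: l1.
    case/dvdnP: n_nu => q ->; move=> lq1 lq2; apply/negP => /dvdnP[p pE].
    rewrite pE -mulSnr !ltn_mul2r /= in lq1 lq2; lia.
  by rewrite coef_comp_Xn // (negbTE nl) (ev_nmultiple _ _ Nk _ l_lt) //; lia.
- rewrite big_nat_recr /=; last by lia.
  rewrite big_nat big1 ?add0n; last first.
    move=> j jk; rewrite /D (_ : (j <= k)%N); last by lia.
    by rewrite (_ : (j.+1 <= k)%N) ?subnn ?muln0 //; lia.
  rewrite /D (_ : (1 <= k)%N) ?leqnn ?ltnn; last by lia.
  rewrite /D2; case: ifP => [kg'|_]; last first.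
    by rewrite addKn [(_ * n)%N]mulnC -mulnDr ltn_mul2l.
  have [kl Nk1] := kg kg'; case: (leqP (npair 1 + n) (npair k.+1)) => [_|lt_n].
    by rewrite addKn [(_ * n)%N]mulnC -mulnDr ltn_mul2l.
  (* When n <nu, lambda_(k+1)> comes before the next multiple of n, it is not such a multiple; nu is
     then outside N_(k+1) and the bound by l_(k+1)(nu) applies. *)
  have : (n * m < nell n' g lam L nu k.+1)%N.
    apply: Nk1 => /(latN_npair lamE (j := k.+1)).
    move=> H; have {H} := H ltac:(lia).
    case/dvdnP: n_nu => q qE /dvdnP[p pE]; move: lt_n kl.
    rewrite qE pE -mulSnr !ltn_mul2r /=; lia.
  rewrite /nell big_nat_recr /=; last by lia.
  rewrite big_nat big1 ?add0n; last first.
    by move=> j jk; rewrite !kc ?subnn ?muln0 //; lia.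
  by rewrite (kc k) //; lia.
Qed.

Lemma f_comp_setL : inL nu ->
  (forall k, (k <= m)%N -> (jet_poly iz gm)`_k = ev zeta w1 w2 (n * k)) ->
  forall j, (j <= m)%N -> (f_comp f gm)`_j = 0.
Proof.
move=> /(setLP g_gt0 lamE L_mono ind_e0_n)[_ le_m n_nu [i i1g [Ni iE]]] zE.
(* The value at g + 1 stands for infinity, in accordance with lambda_(g+1): past lambda_g the
   agreement holds up to the truncation order N. *)
pose D j := if (j <= g)%N then npair j else (npair g + N)%N.
apply: (f_comp_vanish w10 w20 wX1 wX2 (D := D) (i := i)) => //.
- move=> j ji; rewrite /D; case: ifP => jg; last by lia.
  case: ifP => jg'; last by rewrite (_ : j = g) ?leq_addr //; lia.
  by apply: (npair_mono g_gt0 L_mono ind_e0_n nu); lia.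
- move=> s j l /andP[j1 ji] sA ll lN.
  have l_lt k : (j <= k.+1 <= i)%N -> (k < g)%N -> (l < npair k.+1)%N.
    move=> jk kg; apply: leq_trans ll _; rewrite /D (_ : (j <= g)%N); last by lia.
    by apply: (npair_mono g_gt0 L_mono ind_e0_n nu); lia.
  have l_j : (j.-1 < g)%N -> (l < npair j.-1.+1)%N.
    by move=> jg; rewrite prednK //; apply: leq_trans ll _; rewrite /D ifT //; lia.
  rewrite (ev_annA _ _ sA _ l_j); last by lia.
  rewrite coef_comp_Xn //; case: ifP => nl.
    have lm : (l %/ n <= m)%N by rewrite -ltnS ltn_divLR // mulnC.
    by rewrite zE // mulnC divnK.
  rewrite (ev_nmultiple _ _ Ni) //; first by lia.
    by move=> ig; apply: l_lt; lia.
  by rewrite nl.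
- have [ig|ig] := leqP i g.
    have := iE ig; rewrite /nell /D (_ : (1 <= g)%N) //.
    rewrite (_ : \sum_(1 <= j < i) ind_e g lam j * (npair j.+1 - npair j) =
      \sum_(1 <= j < i) ind_e g lam j * ((if (j.+1 <= g)%N then npair j.+1 else npair g + N) -
        if (j <= g)%N then npair j else npair g + N))%N //.
    rewrite big_nat [RHS]big_nat; apply: eq_bigr => j ji.
    by rewrite !ifT //; lia.
  have iE' : i = g.+1 by lia.
  rewrite iE' big_nat_recr //= /D ltnn leqnn addKn.
  rewrite (_ : ind_e g lam g = 1%N); last by rewrite /ind_e big_geq.
  rewrite mul1n addnA addnC (@leq_trans N) ?leq_addr //.
  by rewrite ltn_mul2l /= ltnSn.
Qed.

End Introduction.

(** * Nonempty strata *)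

Lemma small_center : exists b : C, b != 0 /\ `|b ^+ n| < r.
Proof.
have /orP[r1|r1] : (r <= 1) || (1 <= r) by apply: real_leVge; rewrite ?gtr0_real.
  have r2 : 0 < r / 2 by rewrite divr_gt0.
  exists (r / 2); split; first by rewrite gt_eqF.
  have r21 : r / 2 < r by rewrite ltr_pdivrMr // mulr_natr mulr2n ltrDl.
  rewrite normrX gtr0_norm // (le_lt_trans _ r21) // exprS ler_piMr ?(ltW r2) //.
  by rewrite exprn_ile1 ?(ltW r2) // ltW // (lt_le_trans r21).
exists (1 / 2); split; first by rewrite mulf_neq0 ?oner_eq0 // invr_eq0 pnatr_eq0.
have h1 : (1 : C) / 2 < 1 by rewrite ltr_pdivrMr // mul1r ltr1n.
rewrite normrX ger0_norm ?divr_ge0 // (lt_le_trans _ r1) //.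
by rewrite exprn_ilt1 ?divr_ge0.
Qed.

(** The jet has x_i = b^n t^(nu_i), with b small enough for its center, and its z collects the
    powers of s^n in zeta along w_i = b s^(nu_i). *)
Lemma jets_D_nonempty nu : inH nu \/ inL nu -> exists gm, jets_D f r m nu gm.
Proof.
move=> nuHL; have /andP[nu1 nu2] := in_boxHL nuHL.
have [b [b0 br]] := small_center.
pose X a : {poly C} := b ^+ n *: 'X^a.
pose w a := wpoly a b%:P.
have wX a : w a ^+ n = X a \Po 'X^n.
  rewrite /w /wpoly /X comp_polyC comp_polyZ comp_Xn_poly mulrC mul_polyC exprZn.
  by rewrite -!exprM mulnC.
pose Z := \poly_(k < m.+1) ev zeta (w nu.1) (w nu.2) (n * k).
pose gm := mkjet m (X nu.1) (X nu.2) Z.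
have Xj a j : (X a)`_j = if j == a then b ^+ n else 0.
  by rewrite coefZ coefXn; case: eqP => _; rewrite ?mulr1 ?mulr0.
have ordX (i : 'I_3) a : (a <= m)%N -> (forall j, (j <= m)%N -> (jet_poly i gm)`_j = (X a)`_j) ->
    has_ord (jet_poly i gm) a.
  move=> am iX; split=> [j ja|].
    by rewrite iX ?Xj ?ltn_eqF // (leq_trans (ltnW ja)).
  by rewrite iX // Xj eqxx; apply/eqP; rewrite expf_neq0.
have c1 j : (j <= m)%N -> (jet_poly ix1 gm)`_j = (X nu.1)`_j.
  by case/(coef_mkjet (X nu.1) (X nu.2) Z).
have c2 j : (j <= m)%N -> (jet_poly ix2 gm)`_j = (X nu.2)`_j.
  by case/(coef_mkjet (X nu.1) (X nu.2) Z).
have c3 j : (j <= m)%N -> (jet_poly iz gm)`_j = Z`_j.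
  by case/(coef_mkjet (X nu.1) (X nu.2) Z).
have wXi (i : 'I_3) a : (forall j, (j <= m)%N -> (jet_poly i gm)`_j = (X a)`_j) ->
    eqm N (w a ^+ n) (jet_poly i gm \Po 'X^n).
  move=> iX; rewrite wX; apply: eqm_comp_Xn => // j jm; rewrite iX //.
have wsmall a : `|(w a)`_0| < rho.
  by apply: (@wpoly_small a b%:P (b ^+ n)); rewrite ?coefC.
have Xr (i : 'I_3) a : (forall j, (j <= m)%N -> (jet_poly i gm)`_j = (X a)`_j) ->
    `|gm i ord0| < r.
  by move=> iX; rewrite -jet_coef0 iX // Xj; case: eqP => _; rewrite ?normr0.
exists gm; split; [|exact: ordX|exact: ordX]; split.
  by rewrite /centered /in_polydisc (Xr _ _ c1) (Xr _ _ c2).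
have ZE k : (k <= m)%N -> (jet_poly iz gm)`_k = ev zeta (w nu.1) (w nu.2) (n * k).
  by move=> km; rewrite c3 // coef_poly ltnS km.
case: nuHL => [nuH|nuL]; last first.
  exact: (f_comp_setL (wsmall _) (wsmall _) (wXi _ _ c1) (wXi _ _ c2) nuL ZE).
apply: (f_comp_setH (wsmall _) (wsmall _) (wXi _ _ c1) (wXi _ _ c2) nuH) => l lm.
have [_ m_lt] := setHP g_gt0 lamE L_mono ind_e0_n nuH.
rewrite coef_comp_Xn //; case: ifP => [nl|_].
  by rewrite ZE ?[(n * _)%N]mulnC ?divnK // (leq_trans (leq_div _ _)).
by rewrite ev_zeta_low // (leq_ltn_trans lm).
Qed.

(** * Deformation of jets and inclusion of the closures *)

Lemma coef0_mulX (v u : {poly C}) p q : (v ^+ p * u ^+ q)`_0 = v`_0 ^+ p * u`_0 ^+ q.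
Proof. by rewrite -!horner_coef0 hornerM !horner_exp. Qed.

(** In degree n <nu, lambda_1> only monomials of exactly this nu-order count, and they see only the
    initial coefficients of the roots. A coordinate whose order is larger for nu' kills the
    monomials that contain it, on the left through b_i = 0 and on the right by its order. *)
Lemma ev_initial (nu nu' : nat * nat) (v1 v2 : {poly C}) (b1 b2 : C) :
  (nu.1 <= nu'.1)%N -> (nu.2 <= nu'.2)%N ->
  b1 = (if nu.1 == nu'.1 then v1`_0 else 0) -> b2 = (if nu.2 == nu'.2 then v2`_0 else 0) ->
  ev zeta (wpoly nu.1 b1%:P) (wpoly nu.2 b2%:P) (npair L nu 1) =
  ev zeta (wpoly nu'.1 v1) (wpoly nu'.2 v2) (npair L nu 1).
Proof.
move=> le1 le2 b1E b2E; apply: eq_dsum => p q.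
have [->|zpq] := eqVneq (zeta p q) 0; first by rewrite !mul0r.
have k_ge := npair_le nu (zeta_low zpq).
set Lam := npair L nu 1 in k_ge *.
have kk' : (nu.1 * p + nu.2 * q <= nu'.1 * p + nu'.2 * q)%N by rewrite leq_add // leq_mul.
congr (_ * _); rewrite !coef_wpoly /=.
have pow0 (a a' e : nat) (b v : C) : (a <= a')%N -> b = (if a == a' then v else 0) ->
    (a * e = a' * e)%N -> b ^+ e = v ^+ e.
  move=> aa' ->; case: eqVneq => // ne ae; have -> : e = 0%N by nia.
  by rewrite !expr0.
have [k'L|k'L] := leqP (nu'.1 * p + nu'.2 * q) Lam.
  have kE : (nu.1 * p + nu.2 * q = Lam)%N by lia.
  have k'E : (nu'.1 * p + nu'.2 * q = Lam)%N by lia.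
  rewrite kE k'E leqnn subnn dvdn0 div0n !coef0_mulX !coefC /=.
  by rewrite (pow0 _ _ p _ _ le1 b1E) ?(pow0 _ _ q _ _ le2 b2E) //; nia.
case: leqP => //= kL; have kE : (nu.1 * p + nu.2 * q = Lam)%N by lia.
rewrite kE subnn dvdn0 div0n coef0_mulX !coefC /= b1E b2E.
case: (eqVneq nu.1 nu'.1) => [e1|n1].
  case: (eqVneq nu.2 nu'.2) => [e2|n2]; first by move: k'L; rewrite -e1 -e2 kE ltnn.
  have q0 : q != 0%N by apply/eqP => q0; move: k'L; rewrite -kE e1 q0 !muln0 ltnn.
  by rewrite (expr0n C q) (negbTE q0) mulr0.
case: (eqVneq p 0%N) => [p0|p0]; last by rewrite expr0n (negbTE p0) mul0r.
case: (eqVneq nu.2 nu'.2) => [e2|n2]; first by move: k'L; rewrite -kE e2 p0 !muln0 ltnn.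
have q0 : q != 0%N by apply/eqP => q0; move: k'L; rewrite -kE p0 q0 !muln0 ltnn.
by rewrite (expr0n C q) (negbTE q0) mulr0.
Qed.

Lemma lt_bound (x y s : C) : 0 <= x < s -> 0 <= y < s -> exists B, [/\ x <= B, y <= B & 0 <= B < s].
Proof.
move=> /andP[x0 xs] /andP[y0 ys].
have /orP[xy|yx] : (x <= y) || (y <= x) by apply: real_leVge; rewrite ger0_real.
  by exists y; rewrite y0.
by exists x; rewrite x0.
Qed.

Lemma cvg_coef_line (X Y : {poly C}) j (u : nat -> C) (l : C) : u k @[k --> \oo] --> l ->
  (X + u k *: Y)`_j @[k --> \oo] --> (X + l *: Y)`_j.
Proof.
move=> ul; rewrite (_ : (fun k => _) = fun k => X`_j + u k * Y`_j); last first.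
  by apply: funext => k; rewrite coefD coefZ.
rewrite coefD coefZ; apply: cvgD; first exact: cvg_cst.
by apply: cvgM => //; exact: cvg_cst.
Qed.

Lemma wpolyC a (c : C) : wpoly a c%:P = c *: 'X^a.
Proof. by rewrite /wpoly comp_polyC mulrC mul_polyC. Qed.

(** For a > 0 a small weight absorbs any bound M; for a = 0 the weight has no effect and M itself
    must be below rho. *)
Lemma wnorm_wpolyC a (u : nat -> C) (M : C) : (forall k, `|u k| <= M) ->
  (a = 0%N -> M < rho) ->
  exists t B, [/\ 0 < t, 0 <= B < rho & forall s, 0 < s <= t -> forall k,
    wnorm s (wpoly a (u k)%:P) <= B].
Proof.
move=> uM M_rho; have M0 : 0 <= M by exact: le_trans (uM 0%N).
case: a M_rho => [/(_ erefl) M_rho|a _].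
  exists 1, M; split => //; first by rewrite M0.
  by move=> s _ k; rewrite wpolyC wnormZXn mulr1.
pose t := rho / 2 / (M + rho).
have rho2 : 0 < rho / 2 by rewrite divr_gt0.
have Mr : 0 < M + rho by rewrite ltr_wpDl.
have t0 : 0 < t by rewrite divr_gt0.
have rho2_lt : rho / 2 < rho by rewrite ltr_pdivrMr // mulr_natr mulr2n ltrDl.
have t1 : t <= 1.
  by rewrite ler_pdivrMr // mul1r (le_trans (ltW rho2_lt)) // lerDr.
exists t, (rho / 2); split => //; first by rewrite ltW.
move=> s /andP[s0 st] k; rewrite wpolyC wnormZXn.
have s1 : s <= 1 by exact: le_trans t1.
apply: (@le_trans _ _ (M * t)).
  rewrite ler_pM ?exprn_ge0 ?(ltW s0) // (le_trans _ st) // exprS ler_piMr ?(ltW s0) //.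
  by rewrite exprn_ile1 // ltW.
rewrite /t mulrA ler_pdivrMr // mulrC ler_wpM2l ?(ltW rho2) //.
by rewrite lerDl ltW.
Qed.

(* A jet of order nu' is the limit of jets of order nu: add eps^n t^nu_i to   *)
(* the coordinates whose order has to drop, and follow the branch through the *)
(* given jet by correcting the coefficient of t^<nu, lambda_1> in z.          *)
Lemma jets_D_closure nu nu' gm : inH nu \/ inLeq nu -> in_box m nu' ->
  (nu.1 <= nu'.1)%N -> (nu.2 <= nu'.2)%N -> jets_D f r m nu' gm -> jets_C f r m nu gm.
Proof.
move=> nuHL /andP[box1 box2] le1 le2 gmD.
have [v1 [v2 [vX1 vX2 zE]]] := jets_D_elim gmD.
have [[/andP[c1 c2] gm0] o1 o2] := gmD.
split; first by case: gmD.
move=> F F_reg F0.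
have [b [b_neq0 br]] := small_center.
pose half : C := 2^-1.
have half01 : 0 <= half < 1 by rewrite invr_ge0 ler0n invf_lt1 ?ltr1n.
have /andP[half0 half1] := half01.
(* Nonzero and tending to 0, with |eps^n| <= |b^n| < r, so that a coordinate that acquires the
   constant term eps^n keeps its center in the polydisc. *)
pose eps k := b * half ^+ k.
have eps0 k : eps k != 0 by rewrite mulf_neq0 // expf_neq0 // invr_eq0 pnatr_eq0.
have eps_le k : `|eps k| <= `|b|.
  by rewrite normrM ler_piMr // normrX ger0_norm // exprn_ile1 // ltW.
have epsn_le k : `|eps k ^+ n| <= `|b ^+ n| by rewrite !normrX lerXn2r ?nnegrE.
have eps_cvg : eps k @[k --> \oo] --> (0 : C).
  apply: (cvg_geometricP hC (M := `|b|) half01) => k.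
  by rewrite sub0r normrN normrM normrX (ger0_norm half0).
pose X1 := jet_poly ix1 gm; pose X2 := jet_poly ix2 gm; pose Z := jet_poly iz gm.
pose PX (X : {poly C}) (a a' k : nat) := X + (if a == a' then 0 else eps k ^+ n *: 'X^a).
pose pb (v : C) (a a' k : nat) := if a == a' then v else eps k.
pose Lam := npair L nu 1.
(* The coefficient of s^Lam in zeta along the deformed coordinates. By [ev_initial], with nu in both
   places, the initial coefficients of the roots determine it, so constants stand in for the full
   roots. *)
pose c k := ev zeta (wpoly nu.1 (pb v1`_0 nu.1 nu'.1 k)%:P)
  (wpoly nu.2 (pb v2`_0 nu.2 nu'.2 k)%:P) Lam.
pose PZ k := Z + (if (Lam <= m)%N then (c k - Z`_(Lam %/ n)) *: 'X^(Lam %/ n) else 0).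
pose gm_ k := mkjet m (PX X1 nu.1 nu'.1 k) (PX X2 nu.2 nu'.2 k) (PZ k).
have PX_ord (X : {poly C}) a a' k (v : C) : (a <= a')%N -> has_ord X a' -> v ^+ n = X`_a' ->
    has_ord (PX X a a' k) a /\ pb v a a' k ^+ n = (PX X a a' k)`_a.
  rewrite /PX /pb; case: eqVneq => [-> _ Xo vE|ne aa' [Xl Xa'] vE]; first by rewrite addr0.
  have lt_a : (a < a')%N by rewrite ltn_neqAle ne.
  split; last by rewrite coefD coefZ coefXn eqxx mulr1 Xl // add0r.
  split=> [j ja|]; rewrite coefD coefZ coefXn.
    by rewrite Xl ?(ltn_trans ja) // ltn_eqF // mulr0 addr0.
  by rewrite Xl // eqxx mulr1 add0r; apply/eqP; rewrite expf_neq0.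
have mkE k j : (j <= m)%N -> [/\ (jet_poly ix1 (gm_ k))`_j = (PX X1 nu.1 nu'.1 k)`_j,
    (jet_poly ix2 (gm_ k))`_j = (PX X2 nu.2 nu'.2 k)`_j & (jet_poly iz (gm_ k))`_j = (PZ k)`_j].
  by move=> jm; have [] := coef_mkjet (PX X1 nu.1 nu'.1 k) (PX X2 nu.2 nu'.2 k) (PZ k) jm.
have [B0 [B01 B02 B0r]] : exists B, [/\ `|X1`_0| <= B, `|X2`_0| <= B & 0 <= B < r].
  by apply: lt_bound; rewrite normr_ge0 /X1 /X2 jet_coef0.
have [B [BB0 Bb Br]] : exists B, [/\ B0 <= B, `|b ^+ n| <= B & 0 <= B < r].
  by apply: lt_bound => //; rewrite normr_ge0.
have /andP[B_ge0 B_lt] := Br.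
have PX_B (X : {poly C}) a a' k : `|X`_0| <= B0 -> (a <= a')%N -> has_ord X a' ->
    `|(PX X a a' k)`_0| <= B.
  rewrite /PX => XB; case: eqVneq => [_ _ _|ne aa' [Xl _]]; first by rewrite addr0 (le_trans XB).
  rewrite coefD Xl ?add0r; last by case: a' aa' ne {Xl} => [|//]; case: a.
  rewrite coefZ coefXn normrM (le_trans _ Bb) // (le_trans _ (epsn_le k)) // ler_piMr //.
  by case: (_ == _); rewrite ?normr1 ?normr0.
have box_nu : (nu.1 <= m)%N && (nu.2 <= m)%N by rewrite (leq_trans le1) // (leq_trans le2).
have /andP[box_nu1 box_nu2] := box_nu.
have Lam_le : (Lam <= npair L nu' 1)%N by rewrite /Lam /npair leq_add // leq_mul.
have z_low l : (l < Lam)%N -> (l <= m)%N -> (Z \Po 'X^n)`_l = 0.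
  by move=> lL lm; rewrite zE // ev_zeta_low // (leq_trans lL Lam_le).
have gm_D k : jets_D f r m nu (gm_ k).
  have [p1 q1] := PX_ord X1 _ _ k _ le1 o1 vX1; have [p2 q2] := PX_ord X2 _ _ k _ le2 o2 vX2.
  have ordE (P Q : {poly C}) a : (forall j, (j <= m)%N -> P`_j = Q`_j) -> (a <= m)%N ->
      has_ord Q a -> has_ord P a.
    move=> PQ am [Ql Qa]; split=> [j ja|]; last by rewrite PQ.
    by rewrite PQ ?Ql // (leq_trans (ltnW ja)).
  have E1 j : (j <= m)%N -> (jet_poly ix1 (gm_ k))`_j = (PX X1 nu.1 nu'.1 k)`_j by case/(mkE k).
  have E2 j : (j <= m)%N -> (jet_poly ix2 (gm_ k))`_j = (PX X2 nu.2 nu'.2 k)`_j by case/(mkE k).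
  have E3 j : (j <= m)%N -> (jet_poly iz (gm_ k))`_j = (PZ k)`_j by case/(mkE k).
  have g1 : `|gm_ k ix1 ord0| < r by rewrite -jet_coef0 E1 // (le_lt_trans (PX_B _ _ _ k _ le1 o1)).
  have g2 : `|gm_ k ix2 ord0| < r by rewrite -jet_coef0 E2 // (le_lt_trans (PX_B _ _ _ k _ le2 o2)).
  have go1 := ordE _ _ _ E1 box_nu1 p1; have go2 := ordE _ _ _ E2 box_nu2 p2.
  rewrite -E1 // in q1; rewrite -E2 // in q2.
  have [u1 [u10 wX1 w10]] := jet_wpoly g1 go1 q1; have [u2 [u20 wX2 w20]] := jet_wpoly g2 go2 q2.
  split=> //; split; first by rewrite /centered /in_polydisc g1 g2.
  (* For nu in H_m, Lam exceeds m and z needs no correction. For nu in L_m^=, the corrected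
     coefficient meets the hypothesis of [f_comp_setLeq] at order Lam, and both sides vanish
     below. *)
  case: nuHL => [nuH|nuL].
    have [_ m_lt] := setHP g_gt0 lamE L_mono ind_e0_n nuH.
    apply: (f_comp_setH w10 w20 wX1 wX2 nuH) => l lm.
    have lL : (l < Lam)%N by exact: leq_ltn_trans m_lt.
    rewrite ev_zeta_low //; transitivity ((Z \Po 'X^n)`_l); last exact: z_low.
    rewrite !coef_comp_Xn //; case: ifP => // _.
    by rewrite E3 ?(leq_trans (leq_div _ _)) // /PZ leqNgt m_lt addr0.
  have [_ le_m n_nu _] := setLeqP g_gt0 lamE L_mono ind_e0_n nuL.
  apply: (f_comp_setLeq w10 w20 wX1 wX2 nuL) => l lL.
  have lm : (l <= m)%N by exact: leq_trans le_m.
  move: lL; rewrite leq_eqVlt => /orP[/eqP->|lL].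
    rewrite coef_comp_Xn // n_nu E3 ?(leq_trans (leq_div _ _)) // /PZ le_m coefD coefZ coefXn.
    by rewrite eqxx mulr1 addrC subrK /c; apply: ev_initial; rewrite ?leqnn ?eqxx.
  rewrite ev_zeta_low //; transitivity ((Z \Po 'X^n)`_l); last exact: z_low.
  rewrite !coef_comp_Xn //; case: ifP => // nl.
  rewrite E3 ?(leq_trans (leq_div _ _)) // /PZ le_m coefD coefZ coefXn.
  rewrite (_ : _ == _ = false) ?mulr0 ?addr0 //; apply/negbTE/eqP => E.
  by move: lL; rewrite -(divnK nl) E divnK ?ltnn.
have PX_cvg (X : {poly C}) a a' j : (PX X a a' k)`_j @[k --> \oo] --> X`_j.
  rewrite /PX; case: eqVneq => [_|_]; first by rewrite addr0; exact: cvg_cst.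
  have := @cvg_coef_line X 'X^a j _ _ (cvg_exprn (e := n) eps_cvg).
  by rewrite expr0n scale0r addr0.
have pb_cvg (v : C) a a' : pb v a a' k @[k --> \oo] --> (if a == a' then v else 0).
  by rewrite /pb; case: (a == a'); [exact: cvg_cst|exact: eps_cvg].
have pb_wpoly (v : C) a a' : (a = 0%N -> a' = 0%N -> `|v| < rho) ->
    exists t B, [/\ 0 < t, 0 <= B < rho & forall s, 0 < s <= t -> forall k,
      wnorm s (wpoly a (pb v a a' k)%:P) <= B].
  move=> v_rho; rewrite /pb; case: eqVneq => [aa'|_].
    by apply: (wnorm_wpolyC (M := `|v|)) => // a0; apply: v_rho; rewrite // -aa'.
  by apply: (wnorm_wpolyC (M := `|b|)) => // _; exact: root_small.
(* [ev_initial] from nu to nu' identifies the limit with the coefficient of zeta along the given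
   jet, which is that of z. The correction of z therefore tends to 0. *)
have c_cvg : (Lam <= m)%N -> c k @[k --> \oo] --> Z`_(Lam %/ n).
  move=> le_m; have n_nu : (n %| Lam)%N.
    case: nuHL => [nuH|nuL]; last by have [] := setLeqP g_gt0 lamE L_mono ind_e0_n nuL.
    by have [_] := setHP g_gt0 lamE L_mono ind_e0_n nuH; rewrite ltnNge le_m.
  have -> : Z`_(Lam %/ n) = ev zeta (wpoly nu.1 (if nu.1 == nu'.1 then v1`_0 else 0)%:P)
      (wpoly nu.2 (if nu.2 == nu'.2 then v2`_0 else 0)%:P) Lam.
    have := zE _ le_m; rewrite coef_comp_Xn // n_nu => ->.
    by apply/esym; exact: ev_initial.
  have v1_rho : nu.1 = 0%N -> nu'.1 = 0%N -> `|v1`_0| < rho.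
    by move=> _ a0; apply: root_small; rewrite vX1 a0 jet_coef0.
  have v2_rho : nu.2 = 0%N -> nu'.2 = 0%N -> `|v2`_0| < rho.
    by move=> _ a0; apply: root_small; rewrite vX2 a0 jet_coef0.
  have [t1 [A1 [t10 A1r A1P]]] := pb_wpoly _ _ _ v1_rho.
  have [t2 [A2 [t20 A2r A2P]]] := pb_wpoly _ _ _ v2_rho.
  have [A [A1A A2A Ar]] := lt_bound A1r A2r.
  have [t [t0 tt1 tt2]] : exists t, [/\ 0 < t, t <= t1 & t <= t2].
    have /orP[?|?] : (t1 <= t2) || (t2 <= t1) by apply: real_leVge; apply: gtr0_real.
      by exists t1.
    by exists t2.
  have wcvg (v : C) a a' i : (wpoly a (pb v a a' k)%:P)`_i @[k --> \oo] -->
      (wpoly a (if a == a' then v else 0)%:P)`_i.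
    rewrite wpolyC coefZ; under eq_cvg do rewrite wpolyC coefZ.
    by apply: cvgM; [exact: pb_cvg|exact: cvg_cst].
  apply: (ev_cvg hC zeta_rho t0 Ar) => [k|k|i|i]; [| |exact: wcvg|exact: wcvg].
    by rewrite (le_trans (A1P t _ k)) // t0.
  by rewrite (le_trans (A2P t _ k)) // t0.
have PZ_cvg j : (PZ k)`_j @[k --> \oo] --> Z`_j.
  rewrite /PZ; case: leqP => [le_m|_]; last by rewrite addr0; exact: cvg_cst.
  have d_cvg : c k - Z`_(Lam %/ n) @[k --> \oo] --> Z`_(Lam %/ n) - Z`_(Lam %/ n).
    by apply: cvgB; [exact: c_cvg|exact: cvg_cst].
  have := @cvg_coef_line Z 'X^(Lam %/ n) j _ _ d_cvg.
  by rewrite subrr scale0r addr0.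
have gm_cvg i j : gm_ k i j @[k --> \oo] --> gm i j.
  have jm : (j <= m)%N by rewrite -ltnS.
  have ext (u v : nat -> C) (l : C) : (forall k, u k = v k) -> v @ \oo --> l -> u @ \oo --> l.
    by move=> uv; rewrite (_ : u = v) //; apply: funext.
  have [->|->|->] := ix_cases i; rewrite -coef_jet.
  - apply: (ext _ _ _ _ (@PX_cvg X1 nu.1 nu'.1 j)) => k.
    by rewrite -coef_jet; have [-> _ _] := mkE k j jm.
  - apply: (ext _ _ _ _ (@PX_cvg X2 nu.2 nu'.2 j)) => k.
    by rewrite -coef_jet; have [_ -> _] := mkE k j jm.
  - apply: (ext _ _ _ _ (PZ_cvg j)) => k.
    by rewrite -coef_jet; have [_ _ ->] := mkE k j jm.
have gm_c : centered r gm by rewrite /centered /in_polydisc c1 c2.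
have B_1 k : `|gm_ k ix1 ord0| <= B.
  by rewrite -jet_coef0; have [-> _ _] := mkE k 0%N (leq0n m); exact: PX_B.
have B_2 k : `|gm_ k ix2 ord0| <= B.
  by rewrite -jet_coef0; have [_ -> _] := mkE k 0%N (leq0n m); exact: PX_B.
have F_cvg := regular_cvg hC F_reg Br gm_c B_1 B_2 gm_cvg.
have F_0 : (fun k => F (gm_ k)) = (fun=> 0) by apply: funext => k; exact: F0.
rewrite F_0 in F_cvg.
have <- : limn (fun=> 0 : C) = F gm by apply/cvg_lim; [exact: norm_hausdorff|exact: F_cvg].
by apply/cvg_lim; [exact: norm_hausdorff|exact: cvg_cst].
Qed.

Lemma jets_D_jets_C nu gm : jets_D f r m nu gm -> jets_C f r m nu gm.
Proof. by move=> gmD; split=> [|F _]; [case: gmD|apply]. Qed.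

(** The coefficients of x_i below t^(nu_i) are regular functions vanishing on D^nu, hence on its
    closure. A jet of D^nu' lies in that closure and has a nonzero coefficient at t^(nu'_i). *)
Lemma jets_C_sub_le nu nu' : inH nu' \/ inL nu' ->
  jets_C f r m nu' `<=` jets_C f r m nu -> le_p nu nu'.
Proof.
move=> nu'HL sub; have /andP[box1 box2] := in_boxHL nu'HL.
have [gm gmD] := jets_D_nonempty nu'HL.
have [_ gmC] := sub _ (jets_D_jets_C gmD).
have [_ o1 o2] := gmD.
have coord (i : 'I_3) a a' : (a' <= m)%N -> has_ord (jet_poly i gm) a' ->
    (forall y, jets_D f r m nu y -> has_ord (jet_poly i y) a) -> (a <= a')%N.
  move=> am [_ ga'] ya; rewrite leqNgt; apply/negP => a'a; apply: ga'.
  have am' : (a' < m.+1)%N by rewrite ltnS.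
  rewrite -[a']/(nat_of_ord (Ordinal am')) coef_jet.
  apply: (gmC (fun y => y i (Ordinal am'))); first exact: regular_coord.
  by move=> y /ya[yl _]; rewrite -coef_jet yl.
apply/andP; split; rewrite leEnat.
  by apply: coord box1 o1 _ => y [].
by apply: coord box2 o2 _ => y [].
Qed.

Lemma jets_C_sub nu nu' : inH nu \/ inLeq nu -> inH nu' \/ inL nu' ->
  le_p nu nu' -> jets_C f r m nu' `<=` jets_C f r m nu.
Proof.
move=> nuHL /in_boxHL box /andP[le1 le2] gm [gmX gmC]; split=> // F F_reg F0.
by apply: gmC => // y /(jets_D_closure nuHL box le1 le2)[_]; exact.
Qed.

End Branch.

Lemma primitive_root_exists (C : numClosedFieldType) n : (0 < n)%N ->
  exists omega : C, n.-primitive_root omega.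
Proof.
move=> n0; have [rs rsE] := closed_field_poly_normal ('X^n - 1 : {poly C}).
rewrite (monicP (monicXnsubC 1 n0)) scale1r in rsE.
have rs_uniq : uniq rs.
  by rewrite -separable_prod_XsubC -rsE separable_Xn_sub_1 // pnatr_eq0 -lt0n.
have rs_size : size rs = n.
  by apply: succn_inj; rewrite -(size_prod_XsubC rs id) -rsE size_XnsubC.
have rs_root : all n.-unity_root rs.
  by apply/allP => x xrs; rewrite /root_of_unity rsE root_prod_XsubC.
have /hasP[x _ xP] := has_prim_root n0 rs_root rs_uniq (eq_leq (esym rs_size)).
by exists x.
Qed.

Lemma cps_converges (C : numClosedFieldType) (a : cps C) :
  exists2 rho : C, 0 < rho & converges_on rho a.
Proof.
have [M [K [M0 K0 aMK]]] := coefs_bounded a.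
have K1 : 0 < K + 1 by rewrite ltr_wpDl.
exists (K + 1)^-1; first by rewrite invr_gt0.
move=> s /andP[s0 sK]; exists M => i j.
have Ks : K * s <= 1.
  rewrite (@le_trans _ _ ((K + 1) * s)) ?ler_wpM2r ?lerDl ?(ltW s0) //.
  by rewrite mulrC -ler_pdivlMr // mul1r ltW.
rewrite (le_trans (ler_wpM2r _ (aMK i j))) ?exprn_ge0 ?(ltW s0) //.
by rewrite -mulrA -exprMn ler_piMr // exprn_ile1 // mulr_ge0 // ltW.
Qed.

(** * Integral coordinates for the characteristic exponents *)

Section Exponents.
Variables (C : numClosedFieldType) (n' g : nat) (zeta : cps C) (lam : nat -> rat * rat).
Local Notation n := n'.+1.

Let n_neq0 : n%:R != 0 :> rat. Proof. by rewrite pnatr_eq0. Qed.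

Lemma beta_frac p q : beta n zeta (frac n' p q) = zeta p q.
Proof.
have E x : n%:R * (x%:R / n%:R) = x%:R :> rat by rewrite mulrC mulfVK.
by rewrite /beta /= !E !natr_nat /= !natrK.
Qed.

Lemma le_frac p q p' q' :
  le_p (frac n' p q) (frac n' p' q') = ((p <= p')%N && (q <= q')%N).
Proof.
by rewrite /le_p /= !ler_pM2r ?invr_gt0 ?ltr0n // !ler_nat.
Qed.

Lemma beta_neq0 l : beta n zeta l <> 0 -> exists p q, l = frac n' p q /\ zeta p q != 0.
Proof.
move=> bl; have E (x : rat) (k : nat) : n%:R * x = k%:R -> x = k%:R / n%:R.
  by move=> <-; rewrite mulrC mulKf.
have lE : l = frac n' (Num.truncn (n%:R * l.1)) (Num.truncn (n%:R * l.2)).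
  move: bl; rewrite /beta; case: ifP => // /andP[l1 l2] _.
  by rewrite [LHS]surjective_pairing; congr pair; apply: E; rewrite truncnK.
exists (Num.truncn (n%:R * l.1)), (Num.truncn (n%:R * l.2)); split=> //.
by apply/eqP; rewrite -beta_frac -lE.
Qed.

Lemma char_exponents_lattice : char_exponents n zeta g lam -> good_coordinates n zeta lam ->
  exists L : nat -> nat * nat, [/\ forall j, (1 <= j <= g)%N -> lam j = frac n' (L j).1 (L j).2,
    forall j, (1 <= j < g)%N -> ((L j).1 <= (L j.+1).1)%N && ((L j).2 <= (L j.+1).2)%N,
    forall p q j, (j <= g)%N -> zeta p q != 0 -> ~ latM lam j (frac n' p q) ->
      (j < g)%N /\ ((L j.+1).1 <= p)%N && ((L j.+1).2 <= q)%N,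
    forall p q, zeta p q != 0 -> ((L 1).1 <= p)%N && ((L 1).2 <= q)%N &
    forall j, (1 <= j <= g)%N -> zeta (L j).1 (L j).2 != 0].
Proof.
move=> [[g1 _] lam_mono lam_beta lam_latM _] zeta_coord.
pose L j := (Num.truncn (n%:R * (lam j).1), Num.truncn (n%:R * (lam j).2)).
have lamE j : (1 <= j <= g)%N -> lam j = frac n' (L j).1 (L j).2 /\ zeta (L j).1 (L j).2 != 0.
  move=> /lam_beta/beta_neq0[p [q [lE zpq]]].
  have tr (x : nat) : Num.truncn (n%:R * (x%:R / n%:R) : rat) = x.
    by rewrite mulrC mulfVK // natrK.
  by rewrite /L lE /= !tr.
have zb p q : zeta p q != 0 -> beta n zeta (frac n' p q) <> 0.
  by move=> zpq; rewrite beta_frac; apply/eqP.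
exists L; split=> [j /lamE[]//|j jg|p q j jg zpq nM|p q zpq|j /lamE[]//].
- rewrite -le_frac; have [<- _] := lamE j ltac:(lia).
  by have [<- _] := lamE j.+1 ltac:(lia); exact: lam_mono.
(* An exponent not above lambda_(i+1) lies in M_i: descend to the largest k <= i with lambda_k below
   it, or to k = 0, and use that M_k is contained in M_i. *)
- have key i : (i <= g)%N -> ((i < g)%N -> ~~ le_p (lam i.+1) (frac n' p q)) ->
      latM lam i (frac n' p q).
    elim: i => [|i IHi] ig le_i; first by apply: lam_latM => //; exact: zb.
    have [le_i1|nle_i1] := boolP (le_p (lam i.+1) (frac n' p q)).
      by apply: lam_latM => //; exact: zb.
    by apply: latM_step; apply: IHi => //; exact: ltnW.
  have [lt_jg|ge_jg] := ltnP j g; last first.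
    by case: nM; apply: key => // /leq_trans/(_ ge_jg); rewrite ltnn.
  split=> //; apply: contrapT => /negP nle; apply: nM; apply: key => // _.
  by have [-> _] := lamE j.+1 ltac:(lia); rewrite le_frac.
- rewrite -le_frac; have [<- _] := lamE 1%N ltac:(lia).
  by apply: zeta_coord; exact: zb.
Qed.

End Exponents.

Theorem jets_C_order (C : numClosedFieldType) (hC : geo_complete C) (n : nat)
    (f : {poly cps C}) (zeta : cps C) (g : nat) (lam : nat -> rat * rat) (S : sing_type) :
  weierstrass n f -> irreducible_elt f -> is_branch n f zeta ->
  char_exponents n zeta g lam -> good_coordinates n zeta lam ->
  exists2 r0 : C, 0 < r0 & forall r : C, 0 < r < r0 ->
  forall m : nat, (0 < m)%N -> forall nu nu' : nat * nat,
    (setH g lam S m `|` setL g lam S m) nu ->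
    (setH g lam S m `|` setL g lam S m) nu' ->
    (jets_C f r m nu' `<=` jets_C f r m nu -> le_p nu nu') /\
    ((setH g lam S m `|` setLeq g lam S m) nu ->
     (setH g lam S m `|` setLeq g lam S m) nu' ->
     (jets_C f r m nu' `<=` jets_C f r m nu <-> le_p nu nu')).
Proof.
move=> [f_mon f_size _] f_irr f_zeta lam_char zeta_coord.
have g1 : (1 <= g)%N by case: lam_char => [[]].
case: n f_size f_zeta lam_char zeta_coord => [|n'] f_size f_zeta lam_char zeta_coord.
  case: f_irr => _ f_unit _; case: f_unit; exists 1.
  have /size1_polyC fC : (size f <= 1)%N by rewrite f_size.
  by move: f_mon; rewrite monicE fC lead_coefC => /eqP->; rewrite mulr1.
have [omega omega_prim] := primitive_root_exists C (ltn0Sn n').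
have [rho rho0 zeta_rho] := cps_converges zeta.
have [f_roots n_roots] := branch_factorization omega_prim f_mon f_size f_irr f_zeta.
have [L [lamE L_mono zeta_supp zeta_low zeta_L]] := char_exponents_lattice lam_char zeta_coord.
(* If |x_i| < rho^n at the center, every n-th root satisfies |u_i| < rho, where zeta converges. *)
exists (rho ^+ n'.+1); first exact: exprn_gt0.
move=> r /andP[r0 r_rho] m m0 nu nu' nuHL nu'HL.
have sub_le : jets_C f r m nu' `<=` jets_C f r m nu -> le_p nu nu'.
  exact: (jets_C_sub_le hC zeta_rho f_roots n_roots g1 lamE L_mono zeta_supp zeta_low
    zeta_L r0 r_rho rho0 nu'HL).
split=> // nu_eq nu'_eq; split=> //.
exact: (jets_C_sub hC zeta_rho f_roots n_roots g1 lamE L_mono zeta_supp zeta_low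
  zeta_L r0 r_rho rho0 nu_eq nu'HL).
Qed.

Theorem proposition4p19 (R : realType) (n : nat) (f : {poly cps R[i]})
    (zeta : cps R[i]) (g : nat) (lam : nat -> rat * rat) (S : sing_type)
    (f_weierstrass : weierstrass n f)
    (f_irreducible : irreducible_elt f)
    (f_quasi_ordinary : quasi_ordinary f)
    (zeta_root : is_branch n f zeta)
    (lam_char : char_exponents n zeta g lam)
    (lam_lex : lex_ordered g lam)
    (lam_normalized : normalized lam)
    (zeta_coord : good_coordinates n zeta lam)
    (f_sing : has_sing_type f S) :
  (* X is a germ: any sufficiently small representative will do *)
  exists2 r0 : R[i], 0 < r0 & forall r : R[i], 0 < r < r0 ->
  forall m : nat, (0 < m)%N -> forall nu nu' : nat * nat,
    (setH g lam S m `|` setL g lam S m) nu ->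
    (setH g lam S m `|` setL g lam S m) nu' ->
    (jets_C f r m nu' `<=` jets_C f r m nu -> le_p nu nu') /\
    ((setH g lam S m `|` setLeq g lam S m) nu ->
     (setH g lam S m `|` setLeq g lam S m) nu' ->
     (jets_C f r m nu' `<=` jets_C f r m nu <-> le_p nu nu')).
Proof.
exact: (jets_C_order (@complex_geo_complete R) S f_weierstrass f_irreducible
  zeta_root lam_char zeta_coord).
Qed.
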